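(* Let $d\geq 5$ and let $\mathfrak{k}=[k_1,k_2,\dots,k_d]$ be a $d$-tuple of integers with $3\leq k_i<\infty$ and $\vartheta(\mathfrak{k})\geq 2$. Then there exists a pseudo-homogeneous tiling of the plane of type $\mathfrak{k}$.
   Context: A tiling of the plane is a locally finite edge-to-edge decomposition of the plane into topological polygons (closed discs with finitely many, possibly curved, sides); the size of a face is its number of sides. The type of a vertex is the cyclic sequence of sizes of the faces incident to it (up to reversal). A tiling is pseudo-homogeneous if all vertex types are the same up to a permutation of the entries; its type is then the unordered tuple (multiset) $\mathfrak{k}=[k_1,\dots,k_d]$ of sizes of the faces around each vertex. The angle-sum of $\mathfrak{k}=[k_1,\dots,k_d]$ is $\vartheta(\mathfrak{k})=\sum_{i=1}^d \frac{k_i-2}{k_i}$. *)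

(* Defs.v *)
From HB Require Import structures.
From mathcomp Require Import all_boot all_order all_algebra.
From mathcomp Require Import all_classical all_reals all_analysis.

Set Implicit Arguments.
Unset Strict Implicit.
Unset Printing Implicit Defensive.

Import Order.TTheory GRing.Theory Num.Theory.
Import numFieldNormedType.Exports.

Local Open Scope classical_set_scope.
Local Open Scope ring_scope.

Definition closed_disc (R : realType) : set (R * R) :=
  [set p | p.1 ^+ 2 + p.2 ^+ 2 <= 1].
Arguments closed_disc : clear implicits.

(* The point of the unit circle reached after t full turns. *)
Definition circle_point (R : realType) (t : R) : R * R :=
  (cos (2 * pi * t), sin (2 * pi * t)).

(* A topological n-gon is given by a parametrisation phi of it by the closed
   disc.  A homeomorphism of the disc moves any n boundary points, in cyclic
   order, to the n-th roots of unity, so the corners are taken to be the images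
   of the roots of unity, and the sides the images of the closed arcs between
   consecutive ones.  Since the disc is compact, a continuous injection phi is
   a homeomorphism onto its image. *)
Record polygon_family (R : realType) := PolygonFamily {
  face : Type;
  face_size : face -> nat;
  face_param : face -> R * R -> R * R
}.

Definition tile (R : realType) (T : polygon_family R) (f : face T) :
    set (R * R) :=
  face_param f @` closed_disc R.

Definition corner (R : realType) (T : polygon_family R) (f : face T)
    (i : 'I_(face_size f)) : R * R :=
  face_param f (circle_point (i%:R / (face_size f)%:R)).

Definition side (R : realType) (T : polygon_family R) (f : face T)
    (i : 'I_(face_size f)) : set (R * R) :=
  [set face_param f (circle_point t) | t in
    [set t | i%:R / (face_size f)%:R <= t <= i.+1%:R / (face_size f)%:R]].

(* The last clause also makes the interiors of distinct faces disjoint, because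
   corners and sides lie on the boundary of a face. *)
Record is_tiling (R : realType) (T : polygon_family R) : Prop := IsTiling {
  face_size_gt0 : forall f : face T, (0 < face_size f)%N;
  face_param_continuous :
    forall f : face T, {within closed_disc R, continuous (face_param f)};
  face_param_inj : forall f : face T, set_inj (closed_disc R) (face_param f);
  tiling_cover : \bigcup_(f : face T) tile f = setT;
  tiling_locally_finite : forall x : R * R,
    exists2 U, nbhs x U & finite_set [set f : face T | tile f `&` U !=set0];
  tiling_edge_to_edge : forall f g : face T, f <> g ->
    [\/ tile f `&` tile g = set0,
        exists (i : 'I_(face_size f)) (j : 'I_(face_size g)),
          corner i = corner j /\ tile f `&` tile g = [set corner i]
      | exists (i : 'I_(face_size f)) (j : 'I_(face_size g)),
          side i = side j /\ tile f `&` tile g = side i]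
}.

Definition is_vertex (R : realType) (T : polygon_family R) (v : R * R) : Prop :=
  exists (f : face T) (i : 'I_(face_size f)), v = corner i.

Definition share_edge_at (R : realType) (T : polygon_family R) (v : R * R)
    (f g : face T) : Prop :=
  exists (i : 'I_(face_size f)) (j : 'I_(face_size g)),
    side i = side j /\ side i v.

(* The cyclic sequence of face sizes around v, up to reversal, is represented
   by a relation: it holds of every sequence s read off by going once around v
   from any starting face and in either direction. *)
Definition vertex_type (R : realType) (T : polygon_family R) (v : R * R)
    (s : seq nat) : Prop :=
  exists fs : 'I_(size s) -> face T,
    [/\ injective fs,
        range fs = [set f | tile f v],
        forall i, share_edge_at v (fs i) (fs (ordS i))
      & forall i : 'I_(size s), nth 0%N s i = face_size (fs i)].

Definition pseudo_homogeneous (R : realType) (T : polygon_family R) : Prop :=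
  forall v w s t, is_vertex T v -> is_vertex T w ->
    vertex_type T v s -> vertex_type T w t -> perm_eq s t.

(* The multiset k is represented by any sequence of its entries. *)
Definition tiling_has_type (R : realType) (T : polygon_family R)
    (k : seq nat) : Prop :=
  forall v, is_vertex T v -> exists2 s, vertex_type T v s & perm_eq s k.

Definition angle_sum (d : nat) (k : d.-tuple nat) : rat :=
  \sum_(i < d) ((tnth k i)%:R - 2) / (tnth k i)%:R.

(* Main.v *)
From HB Require Import structures.
Require Import Defs.
From Stdlib Require BinNat.
From mathcomp Require Import all_boot all_order all_algebra.
From mathcomp Require Import all_classical all_reals all_analysis.
From mathcomp Require Import zify ring lra.

(** The plane is cut into horizontal strips by the lines of integer height, the
    strips are cut into trapezoids, and the vertices are the points with integer
    coordinates.  A trapezoid with [p] edges on its bottom and [q] on its top is a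
    polygon of size [p + q + 2], so a strip is described by two monotone maps that
    tell where its sides begin and where they end ([tiling_of_strips]).

    Such a tiling grows upwards and downwards from one strip.  When everything
    below a line is given, each vertex of the line has a word of lower faces; its
    upper faces must complete these to the multiset [k], and neighbouring vertices
    must agree on the face over the edge between them.  The upper faces of all
    vertices determine the strip over the line and hence the lower faces of the
    vertices of the next line ([strip_over_line]): most of these see a single face,
    and the others two faces that are neighbours in the strip, or a few more if
    triangles stand on edges.  It remains to find a property of lines that allows
    upper faces to be chosen in such a way that the next line has the property
    again ([tiling_of_growth]).  Choices on longer and longer stretches suffice, by
    compactness ([bi_infinite_choice]).

    There are three kinds of types.  If enough entries are at least 4, the faces
    over the edges are taken from these greedily, from left to right; a counting
    argument shows that a choice remains ([tiling_of_many_wide]).  If there are at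
    least seven entries and at least four triangles, all edges carry triangles, and
    only the order of the other faces has to be chosen ([tiling_of_many_triangles]).

    The types that remain have five or six entries.  In them an entry other than 3
    matters only through a lower bound for it, because a larger face has more top
    sides, that is, the next line has a longer run of vertices that see only this
    face.  So there are finitely many cases.  In each of them the admissible pairs
    of lower and upper words form the alphabet of a finite automaton that reads the
    letters of a line from left to right.  A finite search follows simultaneously
    an arbitrary path of the automaton along a line and all labellings of the
    letters that this path emits on the next line; if it never gets stuck, every
    line that can be labelled has a choice of upper faces after which the next line
    can be labelled ([tiling_of_tables]).  The search is carried out by computation.

    The angle-sum excludes exactly the types 33333, 33334 and 33335. *)

Set Implicit Arguments.
Unset Strict Implicit.
Unset Printing Implicit Defensive.

Import Order.TTheory GRing.Theory Num.Theory.
Import numFieldNormedType.Exports.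

Local Open Scope classical_set_scope.
Local Open Scope ring_scope.

(** * Polar coordinates and embeddings of the disc *)

Definition polar (R : realType) (a : R * R) : R * R :=
  (a.1 * cos (2 * pi * a.2), a.1 * sin (2 * pi * a.2)).

Definition unit_square (R : realType) : set (R * R) :=
  `[0, 1]%classic `*` `[0, 1]%classic.

Section Disc.
Variable R : realType.
Implicit Types (a b : R * R) (x y t u : R).

Lemma in_unit_square a :
  unit_square a <-> (0 <= a.1 <= 1) /\ (0 <= a.2 <= 1).
Proof. by rewrite /unit_square /= !in_itv. Qed.

Lemma cos_eq1_small x : `|x| < 2 * pi -> cos x = 1 -> x = 0.
Proof.
move=> xpi cx; have e : x = (x / 2) *+ 2 by rewrite -mulr_natr; field.
have s0 : sin (x / 2) = 0.
  have := cos_mulr2n (x / 2); rewrite -e cx cos2sin2 => h.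
  by apply/eqP; rewrite -sqrf_eq0; apply/eqP; move: h; rewrite -mulr_natr; lra.
case: (ltgtP x 0) => // hx.
- have /sin_gt0_pi : 0 < - (x / 2) < pi by move: xpi; rewrite ltr0_norm //; lra.
  by rewrite sinN s0 oppr0 ltxx.
- have /sin_gt0_pi : 0 < x / 2 < pi by move: xpi; rewrite gtr0_norm //; lra.
  by rewrite s0 ltxx.
Qed.

Lemma polar_inj a b : unit_square a -> unit_square b -> polar a = polar b ->
  a.1 = b.1 /\ (a.1 = 0 \/ a.2 = b.2 \/
    (a.2 = 0 /\ b.2 = 1) \/ (a.2 = 1 /\ b.2 = 0)).
Proof.
case: a b => [r t] [s u] /in_unit_square /= [r01 t01] /in_unit_square /= [s01 u01].
rewrite /polar /= => -[ec es].
have rs : r = s.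
  have : r ^+ 2 = s ^+ 2.
    have -> : r ^+ 2 = (r * cos (2 * pi * t)) ^+ 2 + (r * sin (2 * pi * t)) ^+ 2.
      by rewrite !exprMn -mulrDr cos2Dsin2 mulr1.
    by rewrite ec es !exprMn -mulrDr cos2Dsin2 mulr1.
  by move/eqP; rewrite eqf_sqr => /orP[/eqP//|/eqP]; lra.
split=> //; subst s; case: (eqVneq r 0) => [->|r0]; [by left|right].
have {}ec := mulfI r0 ec; have {}es := mulfI r0 es.
have c1 : cos (2 * pi * t - 2 * pi * u) = 1.
  by rewrite cosB ec es -!expr2 cos2Dsin2.
have p0 := pi_gt0 R.
case: (ltP (`|t - u|) 1) => tu.
  left; have : 2 * pi * t - 2 * pi * u = 0.
    apply: cos_eq1_small => //; rewrite -mulrBr normrM gtr0_norm; nra.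
  by rewrite -mulrBr => /eqP; rewrite mulf_eq0 => /orP[/eqP|/eqP]; lra.
right; move: tu; case: (ltP t u) => h.
- by rewrite ltr0_norm; lra.
- by rewrite ger0_norm; lra.
Qed.

Lemma circle_point_ex x y : x ^+ 2 + y ^+ 2 = 1 ->
  exists2 t, 0 <= t <= 1 & circle_point t = (x, y).
Proof.
move=> xy1; have p0 := pi_gt0 R.
have x1 : -1 <= x <= 1 by nra.
have xin : x \in `[(-1), 1] by rewrite in_itv.
have sac : sin (acos x) = `|y|.
  by rewrite sin_acos // -sqrtr_sqr; congr Num.sqrt; lra.
have a0 := acos_ge0 x1; have api := acos_lepi x1.
have two : 2 * pi != 0 :> R by apply/eqP; lra.
case: (leP 0 y) => y0.
- exists (acos x / (2 * pi)).
    by rewrite divr_ge0 ?ler_pdivrMr; lra.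
  rewrite /circle_point mulrC divfK // acosK // sac ger0_norm //.
- exists (1 - acos x / (2 * pi)).
    have /andP[? ?] : 0 <= acos x / (2 * pi) <= 1.
      by rewrite divr_ge0 ?ler_pdivrMr; lra.
    by apply/andP; split; lra.
  rewrite /circle_point.
  have -> : 2 * pi * (1 - acos x / (2 * pi)) = - acos x + pi *+ 2 :> R.
    by rewrite -mulr_natl; field; apply/eqP; lra.
  by rewrite cosD2pi sinD2pi cosN sinN acosK // sac ltr0_norm // opprK.
Qed.

Lemma polar_image : @polar R @` @unit_square R = closed_disc R.
Proof.
apply/seteqP; split=> [_ [[r t] /in_unit_square /= [r01 t01] <-]|[x y]].
  rewrite /closed_disc /polar /= !exprMn -mulrDr cos2Dsin2; nra.
rewrite /closed_disc /= => xy1.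
set r := Num.sqrt (x ^+ 2 + y ^+ 2).
have r2 : r ^+ 2 = x ^+ 2 + y ^+ 2 by rewrite sqr_sqrtr //; nra.
have r0 : 0 <= r by rewrite sqrtr_ge0.
have r1 : r <= 1 by rewrite -(@ler_pXn2r _ 2) ?nnegrE // expr1n r2.
case: (eqVneq r 0) => [rz|rnz].
  exists (0, 0); first by apply/in_unit_square => /=; rewrite lexx ler01.
  rewrite /polar /= !mul0r; move: r2; rewrite rz => e; congr (_, _); nra.
have [|t t01 [ct st]] := @circle_point_ex (x / r) (y / r).
  by rewrite !expr_div_n -mulrDl -r2 divff // expf_neq0.
exists (r, t); first by apply/in_unit_square => /=; rewrite r0.
by rewrite /polar /= ct st ![r * _]mulrC !divfK.
Qed.

Lemma continuous_pair (T : topologicalType) (f g : T -> R) :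
  continuous f -> continuous g -> continuous (fun z => (f z, g z)).
Proof. by move=> cf cg z; exact: (cvg_pair (cf z) (cg z)). Qed.

Lemma polar_continuous : continuous (@polar R).
Proof.
have c1 : continuous (fun a : R * R => a.1) by move=> a; exact: cvg_fst.
have c2 : continuous (fun a : R * R => 2 * pi * a.2).
  by move=> a; apply: cvgM; [exact: cvg_cst|exact: cvg_snd].
apply: continuous_pair => a; apply: cvgM; try exact: c1.
- by apply: (continuous_comp (c2 a)); exact: continuous_cos.
- by apply: (continuous_comp (c2 a)); exact: continuous_sin.
Qed.

Lemma unit_square_compact : compact (@unit_square R).
Proof. by apply: compact_setX; exact: segment_compact. Qed.

(** A continuous map of the square that makes exactly the identifications of
    polar coordinates descends to an embedding of the disc: a closed set pulls
    back to the polar image of a compact set, hence to a closed set. *)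
Lemma disc_embedding (Phi : R * R -> R * R) : continuous Phi ->
  (forall a b, unit_square a -> unit_square b ->
    Phi a = Phi b <-> polar a = polar b) ->
  exists phi : R * R -> R * R,
    [/\ {within closed_disc R, continuous phi}, set_inj (closed_disc R) phi &
        forall a, unit_square a -> phi (polar a) = Phi a].
Proof.
move=> cP eqv.
have sec z : exists a, closed_disc R z -> unit_square a /\ polar a = z.
  case: (pselect (closed_disc R z)) => [|nz]; last by exists z.
  by rewrite -{1}polar_image => -[a sa az]; exists a.
have [lift liftP] := boolp.choice sec.
have pol a : unit_square a -> Phi (lift (polar a)) = Phi a.
  move=> sa; have da : closed_disc R (polar a) by rewrite -polar_image; exists a.
  by have [sl pl] := liftP _ da; exact: (proj2 (eqv _ _ sl sa) pl).
exists (Phi \o lift); split => //.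
- apply/continuous_closedP => C cC; apply/closed_subspaceP.
  exists (@polar R @` (@unit_square R `&` Phi @^-1` C)).
    apply: compact_closed; first exact: (@norm_hausdorff R (R * R)%type).
    apply: continuous_compact; last first.
      apply: compact_closedI; first exact: unit_square_compact.
      by apply: preimage_closed => // z _; exact: cP.
    exact: continuous_subspaceT polar_continuous.
  apply/seteqP; split=> z /=.
  + by move=> [[a [sa Ca] <-] dz]; split => //; change (C (Phi (lift (polar a)))); rewrite pol.
  + move=> [Cz dz]; split => //; have [sl pl] := liftP _ dz.
    by exists (lift z).
- move=> z w /[!inE] dz dw /= e.
  have [sz pz] := liftP _ dz; have [sw pw] := liftP _ dw.
  by rewrite -pz -pw; exact: (proj1 (eqv _ _ sz sw) e).
Qed.

End Disc.

(** * Trapezoids as topological polygons *)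

Section Trapezoid.
Variables (R : realType) (p q : nat).
Hypothesis pq_gt0 : (0 < p + q)%N.
Implicit Types (s t u x y r : R) (z w : R * R).

Local Notation P := (p%:R : R).
Local Notation Q := (q%:R : R).
Local Notation N := (p%:R + q%:R + 2 : R).

Definition trapezoid : set (R * R) :=
  [set z | 0 <= z.2 <= 1 /\ 0 <= z.1 <= P + (Q - P) * z.2].

Definition clamp u : R := Num.min (Num.max u 0) 1.

(** The boundary of the trapezoid as a closed path: [p] units along the bottom,
    one up the right side, [q] back along the top and one down the left side, so
    that the corners are the points of integer time.  Writing it as a single
    expression in [Num.min] and [Num.max] makes its continuity evident. *)
Definition rim s : R * R :=
  (Num.min s P + (Q - P) * clamp (s - P) - Num.min (Num.max (s - P - 1) 0) Q,
   clamp (s - P) - clamp (s - P - Q - 1)).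

(** The middle of the section at half height, interior even if [p] or [q] vanishes. *)
Definition center : R * R := ((P + Q) / 4, 1 / 2).

Definition from_center r z : R * R :=
  (center.1 + r * (z.1 - center.1), center.2 + r * (z.2 - center.2)).

(** The Minkowski functional of the trapezoid about its centre: the four
    arguments of the maxima come from the bottom, the top, the left and the right
    side.  It is 1 exactly on the boundary and is multiplied by [r] when the plane
    is scaled by [r] from the centre, which makes the trapezoid a cone over its
    rim. *)
Definition gauge z : R :=
  Num.max (Num.max (1 - 2 * z.2) (2 * z.2 - 1))
    (Num.max (1 - 4 / (P + Q) * z.1)
             (1 + 4 / (P + Q) * (z.1 - P - (Q - P) * z.2))).

Lemma P_ge0 : 0 <= P. Proof. exact: ler0n. Qed.
Lemma Q_ge0 : 0 <= Q. Proof. exact: ler0n. Qed.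
Lemma PQ_gt0 : 0 < P + Q. Proof. by rewrite -natrD ltr0n. Qed.

Lemma clamp0 u : u <= 0 -> clamp u = 0.
Proof. by move=> u0; rewrite /clamp max_r // min_l. Qed.
Lemma clamp1 u : 1 <= u -> clamp u = 1.
Proof. by move=> u1; rewrite /clamp max_l ?min_r //; lra. Qed.
Lemma clamp_id u : 0 <= u <= 1 -> clamp u = u.
Proof. by move=> /andP[u0 u1]; rewrite /clamp max_l // min_l. Qed.

Lemma rim_bottom s : 0 <= s <= P -> rim s = (s, 0).
Proof.
move=> sP; have hQ := Q_ge0; have hP := P_ge0.
rewrite /rim (_ : Num.min s P = s); last by apply: min_l; lra.
rewrite (@clamp0 (s - P)); last by lra.
rewrite (@clamp0 (s - P - Q - 1)); last by lra.
rewrite (@max_r _ _ _ 0); last by lra.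
by rewrite min_l //; congr (_, _); lra.
Qed.

Lemma rim_right s : P <= s <= P + 1 -> rim s = (P + (Q - P) * (s - P), s - P).
Proof.
move=> sP; have hQ := Q_ge0; have hP := P_ge0.
rewrite /rim (_ : Num.min s P = P); last by apply: min_r; lra.
rewrite (@clamp_id (s - P)); last by lra.
rewrite (@clamp0 (s - P - Q - 1)); last by lra.
rewrite (@max_r _ _ _ 0); last by lra.
by rewrite min_l //; congr (_, _); lra.
Qed.

Lemma rim_top s : P + 1 <= s <= P + Q + 1 -> rim s = (Q - (s - P - 1), 1).
Proof.
move=> sP; have hQ := Q_ge0; have hP := P_ge0.
rewrite /rim (_ : Num.min s P = P); last by apply: min_r; lra.
rewrite (@clamp1 (s - P)); last by lra.
rewrite (@clamp0 (s - P - Q - 1)); last by lra.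
rewrite (@max_l _ _ _ 0); last by lra.
rewrite min_l; last by lra.
by congr (_, _); lra.
Qed.

Lemma rim_left s : P + Q + 1 <= s <= N -> rim s = (0, N - s).
Proof.
move=> sP; have hQ := Q_ge0; have hP := P_ge0.
rewrite /rim (_ : Num.min s P = P); last by apply: min_r; lra.
rewrite (@clamp1 (s - P)); last by lra.
rewrite (@clamp_id (s - P - Q - 1)); last by lra.
rewrite (@max_l _ _ _ 0); last by lra.
rewrite min_r; last by lra.
by congr (_, _); lra.
Qed.

Variant rim_spec s : R * R -> Prop :=
| RimBottom of 0 <= s <= P : rim_spec s (s, 0)
| RimRight of P <= s <= P + 1 : rim_spec s (P + (Q - P) * (s - P), s - P)
| RimTop of P + 1 <= s <= P + Q + 1 : rim_spec s (Q - (s - P - 1), 1)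
| RimLeft of P + Q + 1 <= s <= N : rim_spec s (0, N - s).

Lemma rimP s : 0 <= s <= N -> rim_spec s (rim s).
Proof.
move=> /andP[s0 sN].
case: (leP s P) => h1; first by rewrite rim_bottom ?s0 //; constructor; lra.
case: (leP s (P + 1)) => h2.
  by rewrite rim_right; [constructor|]; lra.
case: (leP s (P + Q + 1)) => h3.
  by rewrite rim_top; [constructor|]; lra.
by rewrite rim_left; [constructor|]; lra.
Qed.

Lemma rim0 : rim 0 = (0, 0).
Proof. by rewrite rim_bottom // lexx P_ge0. Qed.

Lemma rimN : rim N = (0, 0).
Proof.
have hP := P_ge0; have hQ := Q_ge0.
by rewrite rim_left; [congr (_, _)|]; lra.
Qed.

(** The trapezoid may be a triangle, in which case its right and left sides meet
    at the apex; they do not meet elsewhere. *)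
Lemma width_eq0 u : 0 <= u <= 1 -> P + (Q - P) * u = 0 ->
  (P = 0 /\ u = 0) \/ (Q = 0 /\ u = 1).
Proof.
move=> u01 w0; have hP := P_ge0; have hQ := Q_ge0; have hPQ := PQ_gt0.
have /eqP : P * (1 - u) = 0 by nra.
have /eqP : Q * u = 0 by nra.
rewrite !mulf_eq0 => /orP[/eqP a|/eqP a] /orP[/eqP b|/eqP b].
- lra.
- by right; lra.
- by left; lra.
- lra.
Qed.

Lemma rim_inj s t : 0 <= s <= N -> 0 <= t <= N -> rim s = rim t ->
  s = t \/ (s = 0 /\ t = N) \/ (s = N /\ t = 0).
Proof.
have hP := P_ge0; have hQ := Q_ge0.
wlog st : s t / s <= t => [hw sN tN e|].
  case: (leP s t) => [/hw|/ltW /hw]; first exact.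
  by move=> /(_ tN sN (esym e)) [->|[[-> ->]|[-> ->]]]; auto.
move=> hs ht; case: (rimP hs) => h; case: (rimP ht) => h' /pair_equal_spec[e1 e2];
  try solve [left; lra | right; left; lra].
- have tP : t - P = 0 by lra.
  by move: e1; rewrite tP mulr0; left; lra.
- have sP : s - P = 1 by lra.
  by move: e1; rewrite sP mulr1; left; lra.
- have [] := @width_eq0 (s - P); [lra|exact: e1| |].
  + by move=> [a b]; right; left; lra.
  + by move=> [a b]; left; lra.
Qed.

Lemma gauge_le1 z : gauge z <= 1 <-> trapezoid z.
Proof.
have hPQ := PQ_gt0; have i0 : 0 < 4 / (P + Q) by rewrite divr_gt0.
rewrite /gauge /trapezoid /= !ge_max; split.
  move=> /andP[/andP[? ?] /andP[h3 h4]].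
  have : 0 <= 4 / (P + Q) * z.1 by lra.
  have : 4 / (P + Q) * (z.1 - P - (Q - P) * z.2) <= 0 by lra.
  by rewrite pmulr_rle0 // pmulr_rge0 // => ? ?; split; apply/andP; split; lra.
move=> [/andP[? ?] /andP[? ?]].
have : 0 <= 4 / (P + Q) * z.1 by rewrite pmulr_rge0.
have : 4 / (P + Q) * (z.1 - P - (Q - P) * z.2) <= 0 by rewrite pmulr_rle0 //; lra.
by move=> ? ?; apply/andP; split; apply/andP; split; lra.
Qed.

Lemma from_center1 z : from_center 1 z = z.
Proof. by case: z => x y; rewrite /from_center !mul1r /=; congr (_, _); ring. Qed.

Lemma gauge_from_center r z : 0 <= r -> gauge (from_center r z) = r * gauge z.
Proof.
move=> r0; have hPQ := PQ_gt0; have nPQ : P + Q != 0 by rewrite gt_eqF.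
rewrite /gauge !maxr_pMr //=; congr (Num.max (Num.max _ _) (Num.max _ _)); field;
  rewrite -?natrD ?nPQ // in nPQ *.
Qed.

Lemma gauge_rim s : 0 <= s <= N -> gauge (rim s) = 1.
Proof.
have hP := P_ge0; have hQ := Q_ge0; have hPQ := PQ_gt0.
have i0 : 0 < 4 / (P + Q) by rewrite divr_gt0.
move=> hs; apply/le_anti/andP; split.
  apply/gauge_le1.
  have width u : 0 <= u <= 1 -> 0 <= P + (Q - P) * u.
    move=> /andP[u0 u1]; have -> : P + (Q - P) * u = P * (1 - u) + Q * u by ring.
    by apply: addr_ge0; apply: mulr_ge0 => //; lra.
  rewrite /trapezoid; case: (rimP hs) => h /=.
  - by rewrite mulr0 addr0 lexx ler01.
  - by split; [lra|rewrite lexx andbT; apply: width; lra].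
  - by rewrite mulr1 lexx ler01; split=> //; apply/andP; split; lra.
  - by split; [lra|rewrite lexx; apply: width; lra].
rewrite /gauge !le_max; case: (rimP hs) => h /=.
- by apply/orP; left; apply/orP; left; lra.
- apply/orP; right; apply/orP; right.
  have -> : P + (Q - P) * (s - P) - P - (Q - P) * (s - P) = 0 by lra.
  by rewrite mulr0 addr0.
- by apply/orP; left; apply/orP; right; lra.
- by apply/orP; right; apply/orP; left; rewrite mulr0 subr0.
Qed.

Lemma rim_surj z : gauge z = 1 -> exists2 s, 0 <= s <= N & rim s = z.
Proof.
have hP := P_ge0; have hQ := Q_ge0; have hPQ := PQ_gt0.
have i0 : 4 / (P + Q) != 0 by rewrite gt_eqF // divr_gt0.
move=> gz; have [hy hx] : trapezoid z by apply/gauge_le1; rewrite gz.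
have : 1 <= gauge z by rewrite gz.
case: z hy hx {gz} => x y /= hy hx.
rewrite /gauge !le_max /= => /orP[/orP[h|h]|/orP[h|h]].
- have y0 : y = 0 by lra.
  move: hx; rewrite y0 mulr0 addr0 => hx.
  by exists x; [lra|rewrite rim_bottom].
- have y1 : y = 1 by lra.
  move: hx; rewrite y1 mulr1 => hx.
  exists (P + 1 + (Q - x)); first lra.
  by rewrite rim_top; [congr (_, _)|]; lra.
- have : 4 / (P + Q) * x <= 0 by lra.
  rewrite pmulr_rle0 ?divr_gt0 // => x0.
  have -> : x = 0 by lra.
  exists (N - y); first lra.
  by rewrite rim_left; [congr (_, _)|]; lra.
- have : 0 <= 4 / (P + Q) * (x - P - (Q - P) * y) by lra.
  rewrite pmulr_rge0 ?divr_gt0 // => h'.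
  exists (P + y); first lra.
  have e : P + y - P = y by lra.
  by rewrite rim_right; [congr (_, _); rewrite e; lra|lra].
Qed.

Lemma rim_continuous : continuous rim.
Proof.
have cid : continuous (fun s : R => s) by move=> s.
have cc (c : R) : continuous (fun _ : R => c) by move=> s; exact: cvg_cst.
have cB (c : R) (f : R -> R) : continuous f -> continuous (fun s => f s - c).
  by move=> cf s; apply: cvgB; [exact: cf|exact: cvg_cst].
have cmin (f g : R -> R) : continuous f -> continuous g ->
    continuous (fun s => Num.min (f s) (g s)).
  by move=> cf cg s; exact: (continuous_min (cf s) (cg s)).
have cmax (f g : R -> R) : continuous f -> continuous g ->
    continuous (fun s => Num.max (f s) (g s)).
  by move=> cf cg s; exact: (continuous_max (cf s) (cg s)).
have ccl (f : R -> R) : continuous f -> continuous (fun s => clamp (f s)).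
  by move=> cf; apply: cmin => //; apply: cmax.
have c1 := cB P _ cid; have c2 := cB 1 _ c1; have c3 := cB 1 _ (cB Q _ c1).
apply: continuous_pair => s.
- apply: cvgB; last exact: (cmin _ _ (cmax _ _ c2 (cc 0)) (cc Q) s).
  apply: cvgD; first exact: (cmin _ _ cid (cc P) s).
  by apply: cvgM; [exact: cvg_cst|exact: (ccl _ c1 s)].
- by apply: cvgB; [exact: (ccl _ c1 s)|exact: (ccl _ c3 s)].
Qed.

Definition spread (a : R * R) : R * R := from_center a.1 (rim (N * a.2)).

Lemma N_gt0 : 0 < N. Proof. by have := P_ge0; have := Q_ge0; lra. Qed.

Lemma scale01 t : 0 <= t <= 1 -> 0 <= N * t <= N.
Proof. by have := N_gt0 => ? /andP[? ?]; apply/andP; split; nra. Qed.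

Lemma spread_continuous : continuous spread.
Proof.
have c1 : continuous (fun a : R * R => a.1) by move=> a; exact: cvg_fst.
have c2 : continuous (fun a : R * R => N * a.2).
  by move=> a; apply: cvgM; [exact: cvg_cst|exact: cvg_snd].
have cr : continuous (fun a : R * R => rim (N * a.2)).
  by move=> a; apply: (continuous_comp (c2 a)); exact: rim_continuous.
apply: continuous_pair => a; apply: cvgD; try exact: cvg_cst.
- apply: cvgM; first exact: c1; apply: cvgB; last exact: cvg_cst.
  exact: (continuous_comp (cr a) cvg_fst).
- apply: cvgM; first exact: c1; apply: cvgB; last exact: cvg_cst.
  exact: (continuous_comp (cr a) cvg_snd).
Qed.

Lemma spread_polar a b : unit_square a -> unit_square b ->
  spread a = spread b <-> polar a = polar b.
Proof.
move=> ha hb; have [a1 a2] := iffLR (in_unit_square a) ha.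
have [b1 b2] := iffLR (in_unit_square b) hb.
have N0 := N_gt0; split.
- move=> e; have e1 : a.1 = b.1.
    have := congr1 gauge e; rewrite /spread !gauge_from_center; try lra.
    by rewrite !gauge_rim ?mulr1 //; exact: scale01.
  case: (eqVneq a.1 0) => [a0|a0]; first by rewrite /polar -e1 a0 !mul0r.
  have er : rim (N * a.2) = rim (N * b.2).
    move: e; rewrite /spread /from_center -e1.
    case: (rim _) => x y; case: (rim _) => x' y' /= -[/addrI ex /addrI ey].
    by congr (_, _); [move/(mulfI a0): ex|move/(mulfI a0): ey]; lra.
  have nN : N != 0 by rewrite gt_eqF.
  case: (rim_inj (scale01 a2) (scale01 b2) er) => [/(mulfI nN) e2|[[e2 e3]|[e2 e3]]].
  + by rewrite /polar e1 e2.
  + have -> : b = (a.1, 1).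
      rewrite [b]surjective_pairing -e1; congr (_, _).
      by apply: (mulfI nN); rewrite mulr1.
    have -> : a = (a.1, 0).
      rewrite {1}[a]surjective_pairing; congr (_, _).
      by apply: (mulfI nN); rewrite mulr0.
    by rewrite /polar /= mulr0 mulr1 mulr_natl cos2pi sin2pi cos0 sin0.
  + have -> : a = (a.1, 1).
      rewrite {1}[a]surjective_pairing; congr (_, _).
      by apply: (mulfI nN); rewrite mulr1.
    have -> : b = (a.1, 0).
      rewrite [b]surjective_pairing -e1; congr (_, _).
      by apply: (mulfI nN); rewrite mulr0.
    by rewrite /polar /= mulr0 mulr1 mulr_natl cos2pi sin2pi cos0 sin0.
- move=> /(polar_inj ha hb) [e1 [z|[e2|[[e2 e3]|[e2 e3]]]]].
  + by rewrite /spread /from_center -e1 z !mul0r.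
  + by rewrite /spread e1 e2.
  + by rewrite /spread e1 e2 e3 mulr0 mulr1 rim0 rimN.
  + by rewrite /spread e1 e2 e3 mulr0 mulr1 rim0 rimN.
Qed.

Lemma spread_image : spread @` @unit_square R = trapezoid.
Proof.
have N0 := N_gt0; have hPQ := PQ_gt0.
apply/seteqP; split=> [_ [a /in_unit_square [a1 a2] <-]|z tz].
  apply/gauge_le1; rewrite gauge_from_center ?gauge_rim ?mulr1; try lra.
  exact: scale01.
have g1 := iffRL (gauge_le1 z) tz.
case: (eqVneq z center) => [->|zc].
  exists (0, 0); first by apply/in_unit_square => /=; rewrite lexx ler01.
  by rewrite /spread /from_center /= !mul0r !addr0.
have g0 : 0 < gauge z.
  rewrite ltNge; apply: contra zc => g0.
  have : 4 / (P + Q) * (P + Q) = 4 by rewrite divfK // gt_eqF.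
  have i0 : 0 < 4 / (P + Q) by rewrite divr_gt0.
  move: g0; rewrite /gauge !ge_max => /andP[/andP[h1 h2] /andP[h3 h4]] h5.
  have y : z.2 = 1 / 2 by lra.
  move: h4 h3 h5 i0; rewrite y; set i := 4 / (P + Q) => h4 h3 h5 i0.
  have e : i * (z.1 - P - (Q - P) * (1 / 2)) = i * z.1 - i * (P + Q) / 2 by field.
  have x : i * z.1 = 1 by move: h4; rewrite e; lra.
  rewrite [z]surjective_pairing y; apply/eqP; congr (_, _).
  by apply: (mulfI (lt0r_neq0 i0)); rewrite x mulrA h5 divff.
have [s sN rs] : exists2 s, 0 <= s <= N & rim s = from_center (gauge z)^-1 z.
  by apply: rim_surj; rewrite gauge_from_center ?mulVf ?gt_eqF // invr_ge0 ltW.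
exists (gauge z, s / N).
  apply/in_unit_square => /=; rewrite ltW //; split=> //.
  by rewrite divr_ge0 ?ler_pdivrMr //; lra.
rewrite /spread /= mulrC divfK ?gt_eqF // rs /from_center /=.
by rewrite [RHS]surjective_pairing; congr (_, _); field; rewrite gt_eqF.
Qed.

(** The disc is laid over the trapezoid by sending each radius linearly to the
    segment from the centre to the rim, the rim being walked at unit speed along
    the horizontal sides so that its [p + q + 2] corners are equally spaced. *)
Lemma trapezoid_param : exists phi : R * R -> R * R,
  [/\ {within closed_disc R, continuous phi}, set_inj (closed_disc R) phi,
      phi @` closed_disc R = trapezoid &
      forall t, 0 <= t <= 1 -> phi (circle_point t) = rim (N * t)].
Proof.
have [phi [cphi iphi ephi]] := disc_embedding spread_continuous spread_polar.
exists phi; split => //.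
- rewrite -polar_image -spread_image; apply/seteqP; split=> [_ [_ [a sa <-] <-]|].
    by exists a => //; rewrite ephi.
  by move=> _ [a sa <-]; exists (polar a); [exists a|rewrite ephi].
- move=> t t01; have -> : circle_point t = polar (1, t) by rewrite /polar /= !mul1r.
  rewrite ephi; last by apply/in_unit_square => /=; rewrite ler01 lexx.
  by rewrite /spread from_center1.
Qed.

End Trapezoid.

(** * Strips *)

Lemma int_crossing (P : int -> bool) (a b : int) : a <= b -> P a -> ~~ P b ->
  exists s, [/\ a <= s, s < b, P s & ~~ P (s + 1)].
Proof.
move=> ab Pa nPb; have [m bE] : exists m : nat, b = a + m%:Z.
  by exists `|b - a|%N; lia.
have exn : exists m : nat, ~~ P (a + m%:Z) by exists m; rewrite -bE.
case: (ex_minnP exn) => [[|i]] nPi mini; first by rewrite addr0 Pa in nPi.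
exists (a + i%:Z); split; first by lia.
- suff : (i.+1 <= m)%N by lia.
  by apply: mini; rewrite -bE.
- by apply/negPn/negP => /mini; rewrite ltnn.
- by rewrite (_ : a + i%:Z + 1 = a + i.+1%:Z) //; lia.
Qed.

(** The strip between two horizontal lines is cut by sides, one for each integer
    [s], going from abscissa [low s] on the lower line to [high s] on the upper
    line; face [s] lies between the sides [s] and [s + 1]. *)
Record strip := Strip { low : int -> int; high : int -> int }.

Definition climbs (f : int -> int) : Prop :=
  [/\ forall s, f s <= f (s + 1), forall z, exists s, f s <= z &
      forall z, exists s, z <= f s].

(** Two sides may share an end but not both, so that every face is a trapezoid
    or a triangle. *)
Definition is_strip (S : strip) : Prop :=
  [/\ climbs (low S), climbs (high S) &
      forall s, low S s + high S s < low S (s + 1) + high S (s + 1)].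

Definition size_at (S : strip) (s : int) : nat :=
  (`|low S (s + 1) - low S s| + `|high S (s + 1) - high S s|).+2.

(** The faces that a line with vertices [f s] meets at its vertex [z], read from
    left to right: those between the consecutive sides [a], ..., [a + size w]. *)
Definition reads_from (S : strip) (f : int -> int) (z : int) (w : seq nat)
    (a : int) : Prop :=
  [/\ (0 < size w)%N, f a < z < f (a + (size w)%:Z),
      forall i : nat, (0 < i < size w)%N -> f (a + i%:Z) = z &
      forall i : nat, (i < size w)%N -> nth 0%N w i = size_at S (a + i%:Z)].

Definition reads S f z w : Prop := exists a, reads_from S f z w a.

Lemma climbs_le f s t : climbs f -> s <= t -> f s <= f t.
Proof.
move=> [fS _ _] st; have -> : t = s + `|t - s|%N%:Z by lia.
elim: `|_|%N => [|m IH]; first by rewrite addr0.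
apply: le_trans IH _; rewrite (_ : s + m.+1%:Z = s + m%:Z + 1) //; lia.
Qed.

Lemma is_strip_lt S s t : is_strip S -> s < t ->
  low S s + high S s < low S t + high S t.
Proof.
move=> [cl ch lt] st; apply: lt_le_trans (lt s) _.
by apply: lerD; apply: climbs_le => //; lia.
Qed.

Lemma reads_range S f z w a s : climbs f -> reads_from S f z w a ->
  (f s <= z <= f (s + 1)) = (a <= s < a + (size w)%:Z).
Proof.
move=> cf [w0 /andP[az zb] inner _]; apply/idP/idP => /andP[h1 h2].
- apply/andP; split; [rewrite leNgt|rewrite ltNge]; apply/negP => h.
  + have : f (s + 1) <= f a by apply: climbs_le => //; lia.
    by lia.
  + have : f (a + (size w)%:Z) <= f s by apply: climbs_le => //; lia.
    by lia.
- have [i sE] : exists i : nat, s = a + i%:Z by exists `|(s - a)%R|%N; lia.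
  have iw : (i < size w)%N by lia.
  apply/andP; split.
  + case: i sE iw => [-> _|i sE iw]; first by rewrite addr0 ltW.
    by rewrite sE inner.
  + rewrite sE -addrA -[1]/(1%N%:Z) -PoszD addn1.
    case: (ltnP i.+1 (size w)) => iw'; first by rewrite inner.
    by rewrite (_ : i.+1 = size w) ?ltW //; lia.
Qed.

Lemma reads_inner S f z w s : climbs f -> reads S f z w ->
  f s < z < f (s + 1) -> size w = 1%N.
Proof.
move=> cf [a [w0 _ inner _]] hs.
case: (ltnP 1 (size w)) => w1; last by lia.
have e : f (a + 1%N%:Z) = z by apply: inner.
case: (leP (a + 1) s) => h.
- have : f (a + 1%N%:Z) <= f s by apply: climbs_le.
  by lia.
- have : f (s + 1) <= f (a + 1%N%:Z) by apply: climbs_le => //; lia.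
  by lia.
Qed.

(** * The tiling by stacked strips *)

Section StripTiling.
Variables (R : realType) (S : int -> strip).
Hypothesis stripS : forall n, is_strip (S n).
Implicit Types (f g : int * int) (n m s t a j : int) (x y : R) (z : R * R).

Definition bottom_length f : nat :=
  `|low (S f.1) (f.2 + 1) - low (S f.1) f.2|%N.
Definition top_length f : nat :=
  `|high (S f.1) (f.2 + 1) - high (S f.1) f.2|%N.

Local Notation lo n s := ((low (S n) s)%:~R : R).
Local Notation hi n s := ((high (S n) s)%:~R : R).
Local Notation p f := (bottom_length f).
Local Notation q f := (top_length f).

Lemma low_le n s t : s <= t -> low (S n) s <= low (S n) t.
Proof. by apply: climbs_le; case: (stripS n). Qed.

Lemma high_le n s t : s <= t -> high (S n) s <= high (S n) t.
Proof. by apply: climbs_le; case: (stripS n). Qed.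

Lemma bottom_lengthE f : (p f)%:Z = low (S f.1) (f.2 + 1) - low (S f.1) f.2.
Proof. by rewrite /bottom_length gez0_abs // subr_ge0 low_le //; lia. Qed.

Lemma top_lengthE f : (q f)%:Z = high (S f.1) (f.2 + 1) - high (S f.1) f.2.
Proof. by rewrite /top_length gez0_abs // subr_ge0 high_le //; lia. Qed.

Lemma bottom_lengthR f : (p f)%:R = lo f.1 (f.2 + 1) - lo f.1 f.2.
Proof. by rewrite -rmorphB -bottom_lengthE. Qed.

Lemma top_lengthR f : (q f)%:R = hi f.1 (f.2 + 1) - hi f.1 f.2.
Proof. by rewrite -rmorphB -top_lengthE. Qed.

Lemma lengths_gt0 f : (0 < p f + q f)%N.
Proof.
have [_ _ /(_ f.2)] := stripS f.1.
by have := bottom_lengthE f; have := top_lengthE f; lia.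
Qed.

Definition lattice a n : R * R := (a%:~R, n%:~R).

(** The abscissa at height [y] of side [s] of strip [n]. *)
Definition wall n s y : R := lo n s + (hi n s - lo n s) * (y - n%:~R).

Definition slant n s : set (R * R) :=
  [set z | n%:~R <= z.2 <= n%:~R + 1 /\ z.1 = wall n s z.2].

Definition link a n : set (R * R) :=
  [set z | a%:~R <= z.1 <= a%:~R + 1 /\ z.2 = n%:~R].

Definition slab f : set (R * R) :=
  [set z | f.1%:~R <= z.2 <= f.1%:~R + 1 /\
           wall f.1 f.2 z.2 <= z.1 <= wall f.1 (f.2 + 1) z.2].

(** The shear that carries the standard trapezoid to face [f]. *)
Definition place f z : R * R :=
  (lo f.1 f.2 + z.1 + (hi f.1 f.2 - lo f.1 f.2) * z.2, f.1%:~R + z.2).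

Lemma place_continuous f : continuous (place f).
Proof.
apply: continuous_pair => z; last by apply: cvgD; [exact: cvg_cst|exact: cvg_snd].
apply: cvgD.
  by apply: cvgD; [exact: cvg_cst|exact: cvg_fst].
by apply: cvgM; [exact: cvg_cst|exact: cvg_snd].
Qed.

Lemma place_inj f : injective (place f).
Proof.
move=> [x y] [x' y'] /pair_equal_spec /= [ex ey].
have e : y = y' by lra.
by congr (_, _) => //; move: ex; rewrite e; lra.
Qed.

Lemma place_trapezoid f : place f @` @trapezoid R (p f) (q f) = slab f.
Proof.
have hp := bottom_lengthR f; have hq := top_lengthR f.
apply/seteqP; split=> [_ [[x y] [/= hy hx] <-]|[x y] [/= hy hx]].
  rewrite /slab /wall /=; have -> : f.1%:~R + y - f.1%:~R = y by ring.
  by move: hx; rewrite hp hq => hx; split; [lra|apply/andP; split; nra].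
exists (x - wall f.1 f.2 y, y - f.1%:~R).
  split=> /=; first lra.
  by move: hx; rewrite hp hq /wall => hx; apply/andP; split; nra.
by rewrite /place /wall /=; congr (_, _); ring.
Qed.

Lemma place_bottom f (i : nat) : (i <= p f)%N ->
  place f (rim (p f) (q f) i%:R) = lattice (low (S f.1) f.2 + i%:Z) f.1.
Proof.
move=> ip; rewrite rim_bottom; last by rewrite ler0n ler_nat.
by rewrite /place /lattice /= rmorphD /= mulr0 !addr0.
Qed.

Lemma place_top f (i : nat) : (i <= q f)%N ->
  place f (rim (p f) (q f) (p f + 1 + i)%:R) =
  lattice (high (S f.1) (f.2 + 1) - i%:Z) (f.1 + 1).
Proof.
have hp := bottom_lengthR f; have hq := top_lengthR f.
move=> iq; have : i%:R <= (q f)%:R :> R by rewrite ler_nat.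
have : 0 <= i%:R :> R by exact: ler0n.
move=> i0 iq'; rewrite rim_top; last by rewrite !natrD; lra.
rewrite /place /lattice /= rmorphB rmorphD /= !natrD hp hq pmulrn.
by congr (_, _); ring.
Qed.

Variable phi : int * int -> R * R -> R * R.
Hypothesis phiP : forall f,
  [/\ {within closed_disc R, continuous (phi f)}, set_inj (closed_disc R) (phi f),
      phi f @` closed_disc R = @trapezoid R (p f) (q f) &
      forall t : R, 0 <= t <= 1 ->
        phi f (circle_point t) = rim (p f) (q f) (((p f)%:R + (q f)%:R + 2) * t)].

Definition strip_tiling : polygon_family R :=
  @PolygonFamily R (int * int)%type (fun f => (p f + q f).+2)
    (fun f z => place f (phi f z)).

Local Notation T := strip_tiling.

Lemma tile_slab f : @tile R T f = slab f.
Proof.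
have [_ _ im _] := phiP f; rewrite -place_trapezoid -im.
apply/seteqP; split=> [_ [z dz <-]|_ [_ [z dz <-] <-]].
- by exists (phi f z) => //; exists z.
- by exists z.
Qed.

Lemma sizeR f : ((p f + q f).+2)%:R = (p f)%:R + (q f)%:R + 2 :> R.
Proof. by rewrite -addn2 !natrD. Qed.

Lemma cornerE f (i : 'I_(@face_size R T f)) :
  corner i = place f (rim (p f) (q f) i%:R).
Proof.
have [_ _ _ rimE] := phiP f; rewrite /corner /= rimE.
  by rewrite sizeR mulrC divfK // -sizeR pnatr_eq0.
by rewrite divr_ge0 //= ler_pdivrMr ?ltr0n // mul1r ler_nat ltnW.
Qed.

Lemma sideE f (i : 'I_(@face_size R T f)) :
  side i = [set place f (rim (p f) (q f) u) | u in
             [set u | i%:R <= u <= i%:R + 1]].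
Proof.
have [_ _ _ rimE] := phiP f.
have N0 : 0 < ((p f + q f).+2)%:R :> R by rewrite ltr0n.
have iN : i.+1%:R <= ((p f + q f).+2)%:R :> R by rewrite ler_nat.
have i0 : 0 <= i%:R :> R by [].
have iS : i.+1%:R = i%:R + 1 :> R by rewrite -addn1 natrD.
rewrite /side; apply/seteqP; split=> [_ [t /= ht <-]|_ [u /= hu <-]].
- move: ht; rewrite ler_pdivrMr // ler_pdivlMr // iS => ht.
  exists (((p f)%:R + (q f)%:R + 2) * t) => /=.
    by rewrite -sizeR mulrC.
  rewrite rimE //; apply/andP; split.
    by rewrite -(pmulr_lge0 _ N0); lra.
  by rewrite -(ler_pM2r N0); lra.
- exists (u / ((p f + q f).+2)%:R) => /=.
    by rewrite ler_pdivrMr // ler_pdivlMr // divfK ?gt_eqF // iS.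
  rewrite rimE; first by rewrite -sizeR mulrC divfK // gt_eqF.
  by rewrite divr_ge0 ?ler_pdivrMr //; lra.
Qed.

Lemma side_bottom f (i : 'I_(@face_size R T f)) : (i < p f)%N ->
  side i = link (low (S f.1) f.2 + i%:Z) f.1.
Proof.
move=> ip; have hi1 : i%:R + 1 <= (p f)%:R :> R by rewrite natr1 ler_nat.
have i0 : 0 <= i%:R :> R by [].
rewrite sideE; apply/seteqP; split=> [_ [u /= hu <-]|[x y] /=].
  rewrite rim_bottom; last lra.
  by rewrite /link /place /= rmorphD /= mulr0 !addr0; split => //; lra.
rewrite /link /= rmorphD /= => -[hx ->]; exists (x - lo f.1 f.2) => /=.
  by move: hx; rewrite -pmulrn; lra.
rewrite rim_bottom; last by move: hx; rewrite -pmulrn; lra.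
by rewrite /place /=; congr (_, _); ring.
Qed.

Lemma side_top f (i : 'I_(@face_size R T f)) (m : nat) :
  i = (p f + 1 + m)%N :> nat -> (m < q f)%N ->
  side i = link (high (S f.1) (f.2 + 1) - m%:Z - 1) (f.1 + 1).
Proof.
have hp := bottom_lengthR f; have hq := top_lengthR f.
move=> iE mq; have hm1 : m%:R + 1 <= (q f)%:R :> R by rewrite natr1 ler_nat.
have m0 : 0 <= m%:R :> R by [].
rewrite sideE iE !natrD; apply/seteqP; split=> [_ [u /= hu <-]|[x y] /=].
  rewrite rim_top; last lra.
  rewrite /link /place /= !rmorphB rmorphD /= -pmulrn.
  by move: hu hp hq hm1 => *; split; lra.
rewrite /link /= !rmorphB rmorphD /= -pmulrn => -[hx ->].
exists (hi f.1 (f.2 + 1) - x + (p f)%:R + 1) => /=; first lra.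
rewrite rim_top; last lra.
by rewrite /place /= hp hq; congr (_, _); ring.
Qed.

Lemma side_right f (i : 'I_(@face_size R T f)) : i = p f :> nat ->
  side i = slant f.1 (f.2 + 1).
Proof.
have hp := bottom_lengthR f; have hq := top_lengthR f.
move=> iE; rewrite sideE iE; apply/seteqP; split=> [_ [u /= hu <-]|[x y] /=].
  rewrite rim_right //; rewrite /slant /place /wall /=; split; first lra.
  have -> : f.1%:~R + (u - (p f)%:R) - f.1%:~R = u - (p f)%:R by ring.
  by move: hp hq => -> ->; ring.
rewrite /slant /= => -[hy ->]; exists (y - f.1%:~R + (p f)%:R) => /=; first lra.
rewrite rim_right; last lra.
by rewrite /place /wall /= hp hq; congr (_, _); ring.
Qed.

Lemma side_left f (i : 'I_(@face_size R T f)) : i = (p f + q f + 1)%N :> nat ->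
  side i = slant f.1 f.2.
Proof.
move=> iE; rewrite sideE iE !natrD.
apply/seteqP; split=> [_ [u /= hu <-]|[x y] /=].
  rewrite rim_left; last lra.
  rewrite /slant /place /wall /= addr0; split; first lra.
  by congr (_ + _ * _); ring.
rewrite /slant /= => -[hy ->].
exists ((p f)%:R + (q f)%:R + 2 - (y - f.1%:~R)) => /=; first lra.
rewrite rim_left; last lra.
by rewrite /place /wall /= addr0; congr (_ + _ * _, _); ring.
Qed.

Lemma has_left_side f : exists i : 'I_(@face_size R T f), side i = slant f.1 f.2.
Proof.
have h : (p f + q f + 1 < (p f + q f).+2)%N by rewrite addn1.
by exists (Ordinal h); rewrite side_left.
Qed.

Lemma has_right_side f :
  exists i : 'I_(@face_size R T f), side i = slant f.1 (f.2 + 1).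
Proof.
have h : (p f < (p f + q f).+2)%N by lia.
by exists (Ordinal h); rewrite side_right.
Qed.

Lemma has_bottom_side f a : low (S f.1) f.2 <= a < low (S f.1) (f.2 + 1) ->
  exists i : 'I_(@face_size R T f), side i = link a f.1.
Proof.
have hp := bottom_lengthE f; move=> ha.
have h : (`|(a - low (S f.1) f.2)%R|%N < (p f + q f).+2)%N by lia.
exists (Ordinal h); rewrite side_bottom /=; last lia.
by congr link; lia.
Qed.

Lemma has_top_side f a : high (S f.1) f.2 <= a < high (S f.1) (f.2 + 1) ->
  exists i : 'I_(@face_size R T f), side i = link a (f.1 + 1).
Proof.
have hq := top_lengthE f; move=> ha.
have h : (p f + 1 + `|(high (S f.1) (f.2 + 1) - 1 - a)%R|%N < (p f + q f).+2)%N by lia.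
exists (Ordinal h).
rewrite (@side_top _ _ (`|(high (S f.1) (f.2 + 1) - 1 - a)%R|%N)) //; last lia.
by congr link; lia.
Qed.

Lemma has_bottom_corner f a : low (S f.1) f.2 <= a <= low (S f.1) (f.2 + 1) ->
  exists i : 'I_(@face_size R T f), corner i = lattice a f.1.
Proof.
have hp := bottom_lengthE f; move=> ha.
have h : (`|(a - low (S f.1) f.2)%R|%N < (p f + q f).+2)%N by lia.
exists (Ordinal h); rewrite cornerE place_bottom /=; last lia.
by congr lattice; lia.
Qed.

Lemma has_top_corner f a : high (S f.1) f.2 <= a <= high (S f.1) (f.2 + 1) ->
  exists i : 'I_(@face_size R T f), corner i = lattice a (f.1 + 1).
Proof.
have hq := top_lengthE f; move=> ha.
have h : (p f + 1 + `|(high (S f.1) (f.2 + 1) - a)%R|%N < (p f + q f).+2)%N by lia.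
exists (Ordinal h); rewrite cornerE /= place_top; last lia.
by congr lattice; lia.
Qed.

Lemma corner_lattice f (i : 'I_(@face_size R T f)) :
  exists a n, corner i = lattice a n.
Proof.
rewrite cornerE; case: (leqP i (p f)) => ip.
  by rewrite place_bottom //; do 2 eexists.
have iE : i = (p f + 1 + (i - (p f + 1)))%N :> nat by lia.
rewrite iE place_top; first by do 2 eexists.
by have := ltn_ord i; rewrite /=; lia.
Qed.

Lemma wallE n s y :
  wall n s y = lo n s * (1 - (y - n%:~R)) + hi n s * (y - n%:~R).
Proof. by rewrite /wall; ring. Qed.

Lemma wall_bottom n s : wall n s n%:~R = lo n s.
Proof. by rewrite /wall subrr mulr0 addr0. Qed.

Lemma wall_top n s : wall n s (n%:~R + 1) = hi n s.
Proof. by rewrite /wall; ring. Qed.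

Lemma wall_le n s t y : s <= t -> n%:~R <= y <= n%:~R + 1 ->
  wall n s y <= wall n t y.
Proof.
move=> st hy; rewrite !wallE; apply: lerD; apply: ler_wpM2r; try lra.
- by rewrite ler_int low_le.
- by rewrite ler_int high_le.
Qed.

(** Two walls of a strip are affine in [y] and ordered, so they can only meet at
    an end of both. *)
Lemma wall_eq n s t y : s < t -> n%:~R <= y <= n%:~R + 1 ->
  wall n s y = wall n t y ->
  (low (S n) s = low (S n) t /\ y = n%:~R) \/
  (high (S n) s = high (S n) t /\ y = n%:~R + 1).
Proof.
move=> st hy; rewrite !wallE => e.
have := is_strip_lt (stripS n) st.
have l1 := low_le n (ltW st); have l2 := high_le n (ltW st).
rewrite -!(ler_int R) in l1 l2 * => lt.
have /eqP : (lo n t - lo n s) * (1 - (y - n%:~R)) = 0 by nra.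
have /eqP : (hi n t - hi n s) * (y - n%:~R) = 0 by nra.
have eqi (a b : int) : b%:~R - a%:~R = 0 :> R -> a = b.
  by move=> h; apply: (@intr_inj R); lra.
rewrite !mulf_eq0 => /orP[/eqP/eqi a|/eqP a] /orP[/eqP/eqi b|/eqP b].
- by move: lt; rewrite a b ltxx.
- by right; split => //; lra.
- by left; split => //; lra.
- by lra.
Qed.

Lemma slab_next n s :
  slab (n, s) `&` slab (n, s + 1) = slant n (s + 1).
Proof.
apply/seteqP; split=> z /= [].
- move=> [/= hy /andP[_ h]] [/= _ /andP[h' _]]; split => //.
  by apply/le_anti/andP.
- move=> hy e; rewrite /slab /= e lexx; split; split => //.
  + by rewrite andbT wall_le //; lia.
  + by rewrite wall_le //; lia.
Qed.

Lemma slab_far n s t : s + 1 < t ->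
  [\/ slab (n, s) `&` slab (n, t) = set0,
      low (S n) (s + 1) = low (S n) t /\
        slab (n, s) `&` slab (n, t) = [set lattice (low (S n) t) n] |
      high (S n) (s + 1) = high (S n) t /\
        slab (n, s) `&` slab (n, t) = [set lattice (high (S n) t) (n + 1)]].
Proof.
move=> st.
have key z : (slab (n, s) `&` slab (n, t)) z ->
    (low (S n) (s + 1) = low (S n) t /\ z = lattice (low (S n) t) n) \/
    (high (S n) (s + 1) = high (S n) t /\ z = lattice (high (S n) t) (n + 1)).
  move=> [[/= hy /andP[_ h1]] [/= _ /andP[h2 _]]].
  have h3 := wall_le (ltW st) hy.
  have e : wall n (s + 1) z.2 = wall n t z.2 by lra.
  have ez : z.1 = wall n t z.2 by lra.
  case: (wall_eq st hy e) => -[el ey]; [left|right]; split => //.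
  + by rewrite [z]surjective_pairing ez ey wall_bottom.
  + by rewrite [z]surjective_pairing ez ey wall_top /lattice rmorphD.
case: (pselect (exists z, (slab (n, s) `&` slab (n, t)) z)) => [[z hz]|nz].
  have lt := is_strip_lt (stripS n) st.
  case: (key z hz) => -[e ez]; [constructor 2|constructor 3]; split => //;
    (apply/seteqP; split=> w; last by move=> ->; rewrite -ez);
    by move=> /key [[e' ->]|[e' ->]] //; lia.
by constructor 1; apply/seteqP; split=> // z hz; case: nz; exists z.
Qed.

Lemma slab_lattice f j n : slab f (lattice j n) <->
  (f.1 = n /\ low (S n) f.2 <= j <= low (S n) (f.2 + 1)) \/
  (f.1 + 1 = n /\ high (S f.1) f.2 <= j <= high (S f.1) (f.2 + 1)).
Proof.
case: f => m s /=; rewrite /slab /lattice /=; split.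
- move=> []; rewrite -[1]/(1%:~R) -rmorphD /= !ler_int => hy hx.
  have [e|e] : m = n \/ m + 1 = n by lia.
  + by left; split => //; move: hx; rewrite e !wall_bottom !ler_int.
  + right; split => //; move: hx; rewrite -e rmorphD /= !wall_top.
    by rewrite !ler_int.
- move=> [[-> h]|[<- h]].
  + by rewrite !wall_bottom !ler_int h lexx lerDl ler01.
  + by rewrite rmorphD /= !wall_top !ler_int h lexx lerDl ler01.
Qed.

Lemma slab_above n s t :
  slab (n, s) `&` slab (n + 1, t) =
  [set z | z.2 = (n + 1)%:~R /\
     (Num.max (high (S n) s) (low (S (n + 1)) t))%:~R <= z.1 <=
     (Num.min (high (S n) (s + 1)) (low (S (n + 1)) (t + 1)))%:~R].
Proof.
have maxR (a b : int) : (Num.max a b)%:~R = Num.max a%:~R b%:~R :> R.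
  by rewrite !maxEle ler_int; case: ifP.
have minR (a b : int) : (Num.min a b)%:~R = Num.min a%:~R b%:~R :> R.
  by rewrite !minEle ler_int; case: ifP.
apply/seteqP; split=> -[x y] /=; rewrite /slab /= maxR minR ge_max le_min.
- move=> [[h1 h2] [h3 h4]].
  have ey : y = (n + 1)%:~R by move: h1 h3; rewrite rmorphD /=; lra.
  split => //; move: h4 h2; rewrite ey wall_bottom wall_bottom rmorphD /= !wall_top.
  by move=> /andP[-> ->] /andP[-> ->].
- move=> [-> /andP[/andP[h1 h2] /andP[h3 h4]]].
  rewrite !wall_bottom h2 h4; split.
  + by rewrite rmorphD /= !wall_top h1 h3 lexx lerDl ler01.
  + by rewrite lexx lerDl ler01.
Qed.

Lemma slab_apart f g : f.1 + 1 < g.1 -> slab f `&` slab g = set0.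
Proof.
move=> h; apply/seteqP; split=> // z [[h1 _] [h2 _]].
have : (f.1 + 2)%:~R <= g.1%:~R :> R by rewrite ler_int; lia.
by rewrite rmorphD /=; lra.
Qed.

Lemma slab_cover : \bigcup_(f : int * int) slab f = setT.
Proof.
apply/seteqP; split=> // -[x y] _; pose n := Num.floor y.
have hy : n%:~R <= y <= n%:~R + 1.
  by have /andP[h1 h2] := floor_itv y; rewrite h1; move: h2; rewrite rmorphD /=; lra.
have [[_ dl ul] [_ dh uh] _] := stripS n.
have u01 : 0 <= y - n%:~R <= 1 by lra.
have [s0 hs0] : exists s, wall n s y <= x.
  have [s1 h1] := dl (Num.floor x); have [s2 h2] := dh (Num.floor x).
  exists (Num.min s1 s2).
  have {}h1 : lo n (Num.min s1 s2) <= (Num.floor x)%:~R.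
    by rewrite ler_int; apply: le_trans h1; apply: low_le; rewrite ge_min lexx.
  have {}h2 : hi n (Num.min s1 s2) <= (Num.floor x)%:~R.
    by rewrite ler_int; apply: le_trans h2; apply: high_le; rewrite ge_min lexx orbT.
  have /andP[h3 _] := floor_itv x.
  by rewrite wallE; nra.
have [s1 hs1] : exists s, ~~ (wall n s y <= x).
  have [s1 h1] := ul (Num.floor x + 1); have [s2 h2] := uh (Num.floor x + 1).
  exists (Num.max s1 s2); rewrite -ltNge.
  have {}h1 : (Num.floor x + 1)%:~R <= lo n (Num.max s1 s2).
    by rewrite ler_int; apply: le_trans h1 _; apply: low_le; rewrite le_max lexx.
  have {}h2 : (Num.floor x + 1)%:~R <= hi n (Num.max s1 s2).
    by rewrite ler_int; apply: le_trans h2 _; apply: high_le; rewrite le_max lexx orbT.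
  have /andP[_ h3] := floor_itv x.
  by rewrite wallE; nra.
have s01 : s0 <= s1.
  rewrite leNgt; apply/negP => h; move: hs1; rewrite -ltNge.
  by have := wall_le (ltW h) hy; lra.
have [s [_ _ h1 h2]] := int_crossing (P := fun s => wall n s y <= x) s01 hs0 hs1.
by exists (n, s) => //; split => //=; rewrite h1 ltW // ltNge.
Qed.

Lemma finite_int_interval (a b : int) : finite_set [set s : int | a <= s <= b].
Proof.
apply: (@sub_finite_set _ _ ((fun i : nat => a + i%:Z) @` `I_(`|(b - a)%R|%N.+1))).
  by move=> s /= h; exists `|(s - a)%R|%N => /=; lia.
by apply: finite_image; exact: finite_II.
Qed.

Lemma slab_locally_finite z : exists2 U, nbhs z U &
  finite_set [set f | slab f `&` U !=set0].
Proof.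
case: z => a b.
exists [set z : R * R | `|a - z.1| < 1 /\ `|b - z.2| < 1].
  exists (ball a 1, ball b 1); first by split; exact: nbhsx_ballx.
  by move=> [x y] [/= ha hb]; split.
pose A := Num.floor a; pose B := Num.floor b.
have /andP[A1 A2] := floor_itv a; have /andP[B1 B2] := floor_itv b.
rewrite !rmorphD /= in A2 B2.
have bounds n : exists l r : int, forall s y, n%:~R <= y <= n%:~R + 1 ->
    wall n s y <= a + 1 -> a - 1 <= wall n (s + 1) y -> l <= s <= r.
  have [[_ dl ul] [_ dh uh] _] := stripS n.
  have [r1 hr1] := ul (A + 3); have [r2 hr2] := uh (A + 3).
  have [l1 hl1] := dl (A - 2); have [l2 hl2] := dh (A - 2).
  exists (Num.min l1 l2 - 1), (Num.max r1 r2) => s y hy h1 h2.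
  apply/andP; split; rewrite leNgt; apply/negP => h.
  + have l1' : lo n (s + 1) <= (A - 2)%:~R.
      rewrite ler_int; apply: le_trans hl1; apply: low_le.
      by move: h; rewrite ltrBrDr lt_min => /andP[]; lia.
    have l2' : hi n (s + 1) <= (A - 2)%:~R.
      rewrite ler_int; apply: le_trans hl2; apply: high_le.
      by move: h; rewrite ltrBrDr lt_min => /andP[]; lia.
    by move: h2 l1' l2'; rewrite wallE rmorphB /=; nra.
  + have r1' : (A + 3)%:~R <= lo n s.
      rewrite ler_int; apply: le_trans hr1 _; apply: low_le.
      by move: h; rewrite gt_max => /andP[]; lia.
    have r2' : (A + 3)%:~R <= hi n s.
      rewrite ler_int; apply: le_trans hr2 _; apply: high_le.
      by move: h; rewrite gt_max => /andP[]; lia.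
    by move: h1 r1' r2'; rewrite wallE rmorphD /=; nra.
have [l hl] := boolp.choice bounds; have [r hlr] := boolp.choice hl.
apply: (@sub_finite_set _ _
  (\bigcup_(n in [set n | B - 2 <= n <= B + 2])
     ((fun s => (n, s)) @` [set s | l n <= s <= r n]))); last first.
  apply: bigcup_finite; first exact: finite_int_interval.
  by move=> n _; apply: finite_image; exact: finite_int_interval.
move=> [n s] /= [[x y] [[/= hy hx] [/= xa yb]]].
rewrite !ltr_norml in xa yb.
exists n.
  have : (B - 2)%:~R < (n + 1)%:~R :> R by rewrite rmorphB rmorphD /=; lra.
  have : n%:~R < (B + 3)%:~R :> R by rewrite rmorphD /=; lra.
  by rewrite !ltr_int /=; lia.
by exists s => //=; apply: (hlr n s y) => //; lra.
Qed.

Variable k : seq nat.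
Hypothesis k_ge3 : (2 < size k)%N.
Hypothesis vertexS : forall n j, exists w w',
  [/\ reads (S n) (high (S n)) j w, reads (S (n + 1)) (low (S (n + 1))) j w' &
      perm_eq (w ++ w') k].

Lemma climbs_low n : climbs (low (S n)). Proof. by case: (stripS n). Qed.
Lemma climbs_high n : climbs (high (S n)). Proof. by case: (stripS n). Qed.

Lemma meet_at_corner f g (X : set (R * R)) v :
  (exists i : 'I_(@face_size R T f), corner i = v) ->
  (exists j : 'I_(@face_size R T g), corner j = v) -> X = [set v] ->
  exists (i : 'I_(@face_size R T f)) (j : 'I_(@face_size R T g)),
    corner i = corner j /\ X = [set corner i].
Proof. by move=> [i ci] [j cj] ->; exists i, j; split; rewrite ?ci ?cj. Qed.

Lemma meet_along_side f g (X Y : set (R * R)) :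
  (exists i : 'I_(@face_size R T f), side i = Y) ->
  (exists j : 'I_(@face_size R T g), side j = Y) -> X = Y ->
  exists (i : 'I_(@face_size R T f)) (j : 'I_(@face_size R T g)),
    side i = side j /\ X = side i.
Proof. by move=> [i ci] [j cj] ->; exists i, j; split; rewrite ?ci ?cj. Qed.

(** Faces of one strip meet in a side when they are neighbours, and otherwise at
    most in a common end of sides.  Faces of consecutive strips meet in an interval
    of the line between them; its inner lattice points would be vertices with a
    single face above and a single face below, which is excluded by [2 < size k],
    so that the interval is at most one edge. *)
Lemma slab_edge_to_edge f g : f.1 < g.1 \/ (f.1 = g.1 /\ f.2 < g.2) ->
  [\/ slab f `&` slab g = set0,
      exists (i : 'I_(@face_size R T f)) (j : 'I_(@face_size R T g)),
        corner i = corner j /\ slab f `&` slab g = [set corner i]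
    | exists (i : 'I_(@face_size R T f)) (j : 'I_(@face_size R T g)),
        side i = side j /\ slab f `&` slab g = side i].
Proof.
case: f g => [n s] [m t] /= [nm|[-> st]].
- case: (ltP (n + 1) m) => nm1; first by constructor 1; apply: slab_apart.
  have -> : m = n + 1 by lia.
  have := slab_above n s t; set l := Num.max _ _; set r := Num.min _ _.
  have hl : high (S n) s <= l /\ low (S (n + 1)) t <= l.
    by rewrite /l !le_max !lexx orbT.
  have hr : r <= high (S n) (s + 1) /\ r <= low (S (n + 1)) (t + 1).
    by rewrite /r !ge_min !lexx orbT.
  move: l r hl hr => l r hl hr E.
  case: (ltgtP l r) => [lr|rl|lr].
  + have lr1 : l + 1 = r.
      suff : ~ (l + 1 < r) by lia.
      move=> h; have [w [w' [rw rw' pw]]] := vertexS n (l + 1).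
      have s1 : size w = 1%N by apply: (reads_inner (climbs_high n) rw (s := s)); lia.
      have s2 : size w' = 1%N.
        by apply: (reads_inner (climbs_low (n + 1)) rw' (s := t)); lia.
      by move: k_ge3; rewrite -(perm_size pw) size_cat s1 s2.
    have lrR : r%:~R = l%:~R + 1 :> R by rewrite -lr1 rmorphD.
    constructor 3; apply: (@meet_along_side _ _ _ (link l (n + 1))).
    * by apply: (@has_top_side (n, s)); rewrite /=; lia.
    * by apply: (@has_bottom_side (n + 1, t)); rewrite /=; lia.
    * by rewrite E; apply/seteqP; split=> z /=; rewrite /link lrR => -[? ?]; split.
  + constructor 1; rewrite E; apply/seteqP; split=> // z /= [_ h].
    by move: rl; rewrite -(ltr_int R); lra.
  + constructor 2; apply: (@meet_at_corner _ _ _ (lattice l (n + 1))).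
    * by apply: (@has_top_corner (n, s)); rewrite /=; lia.
    * by apply: (@has_bottom_corner (n + 1, t)); rewrite /=; lia.
    * rewrite E -lr; apply/seteqP; split=> [[x y] /=|_ ->].
        by move=> [-> /le_anti <-].
      by rewrite /lattice /= lexx.
- case: (eqVneq t (s + 1)) => [->|st1].
    constructor 3; apply: (meet_along_side (has_right_side (m, s))).
      exact: (has_left_side (m, s + 1)).
    exact: slab_next.
  have st2 : s + 1 < t by lia.
  have ls : low (S m) s <= low (S m) (s + 1) by apply: low_le; lia.
  have lt : low (S m) t <= low (S m) (t + 1) by apply: low_le; lia.
  have hs : high (S m) s <= high (S m) (s + 1) by apply: high_le; lia.
  have ht : high (S m) t <= high (S m) (t + 1) by apply: high_le; lia.
  case: (slab_far m st2) => [E|[e E]|[e E]]; first by constructor 1.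
  + constructor 2; apply: (meet_at_corner _ _ E).
    * by apply: (@has_bottom_corner (m, s)); rewrite /=; lia.
    * by apply: (@has_bottom_corner (m, t)); rewrite /=; lia.
  + constructor 2; apply: (meet_at_corner _ _ E).
    * by apply: (@has_top_corner (m, s)); rewrite /=; lia.
    * by apply: (@has_top_corner (m, t)); rewrite /=; lia.
Qed.

Lemma strip_is_tiling : is_tiling T.
Proof.
split.
- by [].
- move=> f z; have [cf _ _ _] := phiP f.
  by apply: (continuous_comp (cf z)); exact: place_continuous.
- move=> f z w hz hw /place_inj; have [_ inj _ _] := phiP f; exact: inj.
- by rewrite -slab_cover; apply: eq_bigcupr => f _; rewrite tile_slab.
- move=> z; have [U Uz fU] := slab_locally_finite z; exists U => //.
  by apply: sub_finite_set fU => f /=; rewrite tile_slab.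
- move=> f g fg; rewrite !tile_slab.
  have : (f.1 < g.1 \/ (f.1 = g.1 /\ f.2 < g.2)) \/
         (g.1 < f.1 \/ (g.1 = f.1 /\ g.2 < f.2)).
    case: f g fg => [n s] [m t] /= fg.
    case: (ltgtP n m) => [h|h|e]; [by left; left|by right; left|].
    case: (ltgtP s t) => [h|h|e']; [by left; right|by right; right|].
    by case: fg; rewrite e e'.
  case=> /slab_edge_to_edge; first by [].
  rewrite setIC => -[E|[j [i [e E]]]|[j [i [e E]]]].
  + by constructor 1.
  + by constructor 2; exists i, j; split; [exact: esym|rewrite E; congr [set _]].
  + by constructor 3; exists i, j; split; [exact: esym|rewrite E].
Qed.

Lemma vertex_lattice v : is_vertex T v -> exists j n, v = lattice j (n + 1).
Proof.
move=> [f [i ->]]; have [a [n e]] := corner_lattice i.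
by exists a, (n - 1); rewrite e subrK.
Qed.

Lemma side_shared f g (X : set (R * R)) v :
  (exists i : 'I_(@face_size R T f), side i = X) ->
  (exists j : 'I_(@face_size R T g), side j = X) -> X v -> @share_edge_at R T v f g.
Proof. by move=> [i si] [j sj] Xv; exists i, j; rewrite si sj. Qed.

(** Around a vertex one meets the lower faces from left to right, then the upper
    faces from right to left. *)
Lemma lattice_vertex_type j n w w' a a' :
  reads_from (S n) (high (S n)) j w a ->
  reads_from (S (n + 1)) (low (S (n + 1))) j w' a' ->
  vertex_type T (lattice j (n + 1)) (w ++ rev w').
Proof.
move=> rw rw'; have [w0 wend win wsz] := rw; have [w0' wend' win' wsz'] := rw'.
set s := w ++ rev w'.
have sz : size s = (size w + size w')%N by rewrite size_cat size_rev.
pose at_ (i : nat) : int * int :=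
  if (i < size w)%N then (n, a + i%:Z)
  else (n + 1, a' + (size w' - (i - size w).+1)%N%:Z).
pose fs (i : 'I_(size s)) : face T := at_ i.
have atL i : (i < size w)%N -> at_ i = (n, a + i%:Z) by rewrite /at_ => ->.
have atR i : (i < size w')%N -> at_ (size w + (size w' - i.+1))%N = (n + 1, a' + i%:Z).
  move=> ib; rewrite /at_ ltnNge leq_addr /=; congr (_, _ + Posz _); lia.
have high1 : j <= high (S n) (a + 1).
  case: (ltnP 1 (size w)) => h; first by rewrite (win 1%N).
  have e : size w = 1%N by lia.
  by move: wend; rewrite e => /andP[_ /ltW].
have low1 : j <= low (S (n + 1)) (a' + 1).
  case: (ltnP 1 (size w')) => h; first by rewrite (win' 1%N).
  have e : size w' = 1%N by lia.
  by move: wend'; rewrite e => /andP[_ /ltW].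
have highN : high (S n) (a + (size w).-1%:Z) <= j.
  case: (ltnP 1 (size w)) => h; first by rewrite win //; lia.
  have -> : (size w).-1 = 0%N by lia.
  by rewrite addr0 ltW //; case/andP: wend.
have lowN : low (S (n + 1)) (a' + (size w').-1%:Z) <= j.
  case: (ltnP 1 (size w')) => h; first by rewrite win' //; lia.
  have -> : (size w').-1 = 0%N by lia.
  by rewrite addr0 ltW //; case/andP: wend'.
exists fs; split.
- move=> i i' /=; rewrite /fs /at_ => e; apply: val_inj => /=.
  have ib : (i < size w + size w')%N by rewrite -sz ltn_ord.
  have ib' : (i' < size w + size w')%N by rewrite -sz ltn_ord.
  by move: e; case: ifP => h; case: ifP => h' /pair_equal_spec[e1 e2]; lia.
- apply/seteqP; split=> [_ [i _ <-]|[m t]] /=; rewrite tile_slab.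
  + have ib : (i < size w + size w')%N by rewrite -sz ltn_ord.
    apply/slab_lattice; rewrite /fs /at_; case: ltnP => h /=.
      right; split => //; rewrite (reads_range _ (climbs_high n) rw); lia.
    left; split => //; rewrite (reads_range _ (climbs_low (n + 1)) rw'); lia.
  + move=> /slab_lattice /= [[-> h]|[/addIr e h]].
      rewrite (reads_range _ (climbs_low (n + 1)) rw') in h.
      have lt : (size w + (size w' - `|(t - a')%R|%N.+1) < size s)%N by lia.
      exists (Ordinal lt) => //; rewrite /fs /= atR; last lia.
      by congr (_, _); lia.
    move: h; rewrite e (reads_range _ (climbs_high n) rw) => h.
    have lt : (`|(t - a)%R|%N < size s)%N by lia.
    by exists (Ordinal lt) => //; rewrite /fs /= atL; [congr (_, _)|]; lia.
- move=> i; have ib : (i < size w + size w')%N by rewrite -sz ltn_ord.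
  have ej : (i.+1 < size s)%N -> ordS i = i.+1 :> nat.
    by move=> h /=; rewrite modn_small.
  rewrite /fs; case: (ltngtP i.+1 (size w)) => hw.
  + rewrite ej; last by lia.
    rewrite !atL //; last by lia.
    have e : a + i.+1%:Z = a + i%:Z + 1 by lia.
    apply: (side_shared (has_right_side (n, a + i%:Z))).
      by rewrite e; exact: (has_left_side (n, a + i%:Z + 1)).
    split=> /=; first by rewrite rmorphD /= lexx lerDl ler01.
    by rewrite rmorphD /= wall_top -e win.
  + case: (ltngtP i.+1 (size s)) => hs; last 2 first.
    * by lia.
    * have -> : ordS i = 0%N :> nat by rewrite /= hs modnn.
      have iE : i = (size w + (size w' - 1))%N :> nat by lia.
      rewrite iE atR // atL // !addr0.
      apply: (@side_shared _ _ (link (j - 1) (n + 1))).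
      - by apply: (@has_bottom_side (n + 1, a')); rewrite /=; lia.
      - by apply: (@has_top_side (n, a)); rewrite /=; lia.
      - by rewrite /link /lattice /= rmorphB /=; split => //; lra.
    * rewrite ej //.
      pose m := (size w' - (i - size w).+1)%N.
      have iE : i = (size w + (size w' - m.+1))%N :> nat by rewrite /m; lia.
      have iE' : i.+1 = (size w + (size w' - m.-1.+1))%N :> nat by rewrite /m; lia.
      have e : a' + m%:Z = a' + m.-1%:Z + 1 by rewrite /m; lia.
      rewrite iE' iE !atR; [|rewrite /m; lia|rewrite /m; lia].
      apply: (side_shared (has_left_side (n + 1, a' + m%:Z))).
        by rewrite /= e; exact: (has_right_side (n + 1, a' + m.-1%:Z)).
      split=> /=; first by rewrite lexx lerDl ler01.
      by rewrite wall_bottom win' // /m; lia.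
  + rewrite ej; last by lia.
    have iE : i.+1 = (size w + (size w' - (size w').-1.+1))%N by lia.
    rewrite iE atR; last by lia.
    rewrite atL; last by lia.
    apply: (@side_shared _ _ (link j (n + 1))).
    * apply: (@has_top_side (n, a + i%:Z)); rewrite /=.
      have -> : i = (size w).-1 :> nat by lia.
      rewrite highN /=; have -> : a + (size w).-1%:Z + 1 = a + (size w)%:Z by lia.
      by case/andP: wend.
    * apply: (@has_bottom_side (n + 1, a' + (size w').-1%:Z)); rewrite /= lowN /=.
      have -> : a' + (size w').-1%:Z + 1 = a' + (size w')%:Z by lia.
      by case/andP: wend'.
    * by rewrite /link /lattice /= lexx lerDl ler01.
- move=> i; have ib : (i < size w + size w')%N by rewrite -sz ltn_ord.
  rewrite /fs /at_ nth_cat; case: ltnP => h; first by rewrite wsz.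
  by rewrite nth_rev ?wsz' //=; lia.
Qed.

(** A vertex type lists the sizes of the faces that contain the vertex, each face
    once, hence it is determined up to permutation. *)
Lemma vertex_type_perm v (w w' : seq nat) :
  vertex_type T v w -> vertex_type T v w' -> perm_eq w w'.
Proof.
have code u : vertex_type T v u -> exists2 l : seq (int * int),
    uniq l /\ (forall f, f \in l <-> @tile R T f v) & u = [seq @face_size R T f | f <- l].
  move=> [fs [inj rng _ sz]]; exists [seq fs i | i <- enum 'I_(size u)].
    split; first by rewrite map_inj_uniq ?enum_uniq.
    move=> f; have -> : @tile R T f v = range fs f by rewrite rng.
    split=> [/mapP[i _ ->]|[i _ <-]]; first by exists i.
    by apply: map_f; rewrite mem_enum.
  rewrite -map_comp; apply: (@eq_from_nth _ 0%N).
    by rewrite size_map size_enum_ord.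
  move=> i iu; rewrite (nth_map (Ordinal iu)) ?size_enum_ord //=.
  have -> : nth (Ordinal iu) (enum 'I_(size u)) i = Ordinal iu.
    by apply: val_inj; rewrite /= nth_enum_ord.
  exact: (sz (Ordinal iu)).
move=> /code[l [ul hl] ->] /code[l' [ul' hl'] ->]; apply: perm_map.
apply: uniq_perm => // f; apply/idP/idP => h.
- by apply/hl'/hl.
- by apply/hl/hl'.
Qed.

Lemma strip_tiling_has_type : tiling_has_type T k.
Proof.
move=> v /vertex_lattice[j [n ->]].
have [w [w' [[a rw] [a' rw'] pw]]] := vertexS n j.
exists (w ++ rev w'); first exact: lattice_vertex_type rw rw'.
by apply: perm_trans pw; rewrite perm_cat2l perm_rev.
Qed.

Lemma strip_pseudo_homogeneous : pseudo_homogeneous T.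
Proof.
move=> v w s t /strip_tiling_has_type[sv tv pv] /strip_tiling_has_type[sw tw pw].
move=> /(vertex_type_perm tv) ps /(vertex_type_perm tw) pt.
rewrite perm_sym in ps; apply: perm_trans ps _; apply: perm_trans pv _.
by rewrite perm_sym in pw; apply: perm_trans pw _.
Qed.

End StripTiling.

(** The geometric half of the construction: only the abscissas of the ends of the
    sides have to be provided. *)
Theorem tiling_of_strips (R : realType) (S : int -> strip) (k : seq nat) :
  (forall n, is_strip (S n)) -> (2 < size k)%N ->
  (forall n j, exists w w',
     [/\ reads (S n) (high (S n)) j w, reads (S (n + 1)) (low (S (n + 1))) j w' &
         perm_eq (w ++ w') k]) ->
  exists T : polygon_family R,
    [/\ is_tiling T, pseudo_homogeneous T & tiling_has_type T k].
Proof.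
move=> stripS k3 vertexS.
have [phi phiP] := boolp.choice
  (fun f : int * int => trapezoid_param R (lengths_gt0 stripS f)).
exists (strip_tiling S phi); split.
- exact: (strip_is_tiling stripS phiP k3 vertexS).
- exact: (strip_pseudo_homogeneous stripS phiP k3 vertexS).
- exact: (strip_tiling_has_type stripS phiP k3 vertexS).
Qed.

(** * Growing a tiling strip by strip *)

Definition flip (S : strip) : strip := Strip (high S) (low S).

Lemma is_strip_flip S : is_strip S -> is_strip (flip S).
Proof.
by case=> cl ch lt; split => // s; rewrite /= addrC [ltRHS]addrC; exact: lt.
Qed.

Lemma reads_flip S f z w : reads S f z w -> reads (flip S) f z w.
Proof.
move=> [a [w0 we wi ws]]; exists a; split => // i hi.
by rewrite ws // /size_at /= addnC.
Qed.

Definition tops (S : strip) (D : int -> seq nat) : Prop :=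
  forall j, reads S (high S) j (D j).

Definition bottoms (S : strip) (U : int -> seq nat) : Prop :=
  forall j, reads S (low S) j (U j).

(** Strips are added one at a time, upwards above the given one and downwards
    below it; [Good] is the property of a line that lets the construction go on.
    Growing downwards is growing upwards upside down. *)
Theorem tiling_of_growth (R : realType) (k : seq nat)
    (Good : (int -> seq nat) -> Prop) : (2 < size k)%N ->
  (forall D, Good D -> exists U S D',
     [/\ is_strip S, forall j, perm_eq (D j ++ U j) k, bottoms S U, tops S D' &
         Good D']) ->
  (exists S D D', [/\ is_strip S, bottoms S D, tops S D', Good D & Good D']) ->
  exists T : polygon_family R,
    [/\ is_tiling T, pseudo_homogeneous T & tiling_has_type T k].
Proof.
move=> k3 grow [S0 [D0 [D1 [strip0 bot0 top0 good0 good1]]]].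
pose stage := (strip * (int -> seq nat))%type.
pose valid (x : stage) := [/\ is_strip x.1, tops x.1 x.2 & Good x.2].
pose above (x y : stage) := exists U,
  (forall j, perm_eq (x.2 j ++ U j) k) /\ bottoms y.1 U.
have ex_next x : exists y : stage, valid x -> valid y /\ above x y.
  case: (pselect (valid x)) => [[_ _ gx]|nx]; last by exists x.
  have [U [S [D' [sS pU bS tS gD]]]] := grow _ gx.
  by exists (S, D') => _; split; [split|exists U].
have [next nextP] := boolp.choice ex_next.
pose up m := iter m next (S0, D1); pose down m := iter m next (flip S0, D0).
have upP m : valid (up m) by elim: m => [//|m IH]; case: (nextP _ IH).
have downP m : valid (down m).
  elim: m => [|m IH]; last by case: (nextP _ IH).
  split => //; first exact: is_strip_flip.
  by move=> j; apply: reads_flip; exact: bot0.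
have up_above m : above (up m) (up m.+1) by case: (nextP _ (upP m)).
have down_above m : above (down m) (down m.+1) by case: (nextP _ (downP m)).
have [S [Spos Sneg]] : exists S : int -> strip,
    (forall m, S (Posz m) = (up m).1) /\
    (forall m, S (Negz m) = flip (down m.+1).1).
  by exists (fun n => match n with
    | Posz m => (up m).1 | Negz m => flip (down m.+1).1 end).
have Sneg' m : S (- m%:Z) = if m is 0%N then S0 else flip (down m).1.
  by case: m => [|m]; rewrite ?oppr0 ?Spos // -NegzE Sneg.
apply: (@tiling_of_strips R S k) => //.
- move=> [m|m]; first by rewrite Spos; case: (upP m).
  by rewrite Sneg; apply: is_strip_flip; case: (downP m.+1).
- move=> [m|m] j.
  + have [U [pU bU]] := up_above m; have [_ tm _] := upP m.
    have -> : Posz m + 1 = Posz m.+1 by lia.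
    by rewrite !Spos; exists ((up m).2 j), (U j).
  + have [U [pU bU]] := down_above m; have [_ tm _] := downP m.
    have -> : Negz m + 1 = - m%:Z by lia.
    rewrite Sneg Sneg'; exists (U j), ((down m).2 j).
    split; [by apply: reads_flip; exact: bU| |by rewrite perm_catC; exact: pU].
    case: m tm {bU pU} => [|m] tm; first exact: bot0.
    by apply: reads_flip; exact: tm.
Qed.

(** * Bi-infinite sums and concatenations *)

Section CumulativeSum.
Implicit Types (f : int -> nat) (i : int).

(** The bi-infinite sequence that vanishes at 0 and has the increments [f]. *)
Definition csum f i : int :=
  match i with
  | Posz n => (\sum_(m < n) f (Posz m))%N%:Z
  | Negz n => - (\sum_(m < n.+1) f (Negz m))%N%:Z
  end.

Lemma csumS f i : csum f (i + 1) = csum f i + (f i)%:Z.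
Proof.
case: i => [n|[|n]].
- have -> : Posz n + 1 = Posz n.+1 by lia.
  by rewrite /csum big_ord_recr PoszD.
- by rewrite /= big_ord1 big_ord0 addNr.
- have -> : Negz n.+1 + 1 = Negz n by lia.
  by rewrite /csum [in RHS]big_ord_recr PoszD opprD addrNK.
Qed.

Lemma csum_climbs f : (forall i, exists2 i', i <= i' & (0 < f i')%N) ->
  (forall i, exists2 i', i' <= i & (0 < f i')%N) -> climbs (csum f).
Proof.
move=> fup fdown.
have mono i : csum f i <= csum f (i + 1) by rewrite csumS lerDl.
have le i i' : i <= i' -> csum f i <= csum f i'.
  move=> ii'; have -> : i' = i + `|(i' - i)%R|%N%:Z by lia.
  elim: `|_|%N => [|m IH]; first by rewrite addr0.
  apply: le_trans IH _; rewrite (_ : i + m.+1%:Z = i + m%:Z + 1) //; lia.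
split => // z.
- suff [n hn] : exists n : nat, exists i, csum f i <= - n%:Z /\ - n%:Z <= z.
    by case: hn => i [h1 h2]; exists i; apply: le_trans h1 h2.
  exists `|z|%N; suff : exists i, csum f i <= - `|z|%N%:Z.
    by move=> [i h]; exists i; split => //; lia.
  elim: `|z|%N => [|n [i IH]]; first by exists 0; rewrite /= big_ord0.
  have [i' ii' fi'] := fdown (i - 1); exists i'.
  have := csumS f i'; have : csum f (i' + 1) <= csum f i by apply: le; lia.
  lia.
- suff : exists i, `|z|%N%:Z <= csum f i by move=> [i h]; exists i; lia.
  elim: `|z|%N => [|n [i IH]]; first by exists 0; rewrite /= big_ord0.
  have [i' ii' fi'] := fup i; exists (i' + 1).
  have : csum f i <= csum f i' by apply: le.
  by have := csumS f i'; lia.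
Qed.

End CumulativeSum.

Lemma climbs_locate f z : climbs f -> exists s, f s <= z < f (s + 1).
Proof.
move=> cf; have [_ fdown fup] := cf.
have [a ha] := fdown z; have [b hb] := fup (z + 1).
have ab : a <= b.
  by rewrite leNgt; apply/negP => h; have := climbs_le cf (ltW h); lia.
have [|s [_ _ h1 h2]] := int_crossing (P := fun s => f s <= z) ab ha; first by lia.
by exists s; lia.
Qed.

Lemma reads_uniq S f z w w' : climbs f -> reads S f z w -> reads S f z w' -> w = w'.
Proof.
move=> cf [a ra] [a' ra']; have [w0 _ _ sw] := ra; have [w0' _ _ sw'] := ra'.
have e s : (a <= s < a + (size w)%:Z) = (a' <= s < a' + (size w')%:Z).
  by rewrite -(reads_range s cf ra) -(reads_range s cf ra').
have ea : a = a' by have := e a; have := e a'; lia.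
have es : size w = size w'.
  have := e (a + (size w).-1%:Z); have := e (a' + (size w').-1%:Z).
  by rewrite ea; lia.
apply: (@eq_from_nth _ 0%N) => // i iw; rewrite sw // sw' -?es //.
by rewrite ea.
Qed.

Lemma reads_exists S f z : climbs f -> exists w, reads S f z w.
Proof.
move=> cf; have [b /andP[hb1 hb2]] := climbs_locate z cf.
have [a /andP[ha1 ha2]] := climbs_locate (z - 1) cf.
have ab : a <= b.
  by rewrite leNgt; apply/negP => h; have := climbs_le cf (_ : b + 1 <= a); lia.
pose w := [seq size_at S (a + i%:Z) | i <- iota 0 `|(b - a + 1)%R|%N].
have sw : size w = `|(b - a + 1)%R|%N by rewrite size_map size_iota.
exists w, a; split.
- by rewrite sw; lia.
- rewrite sw; have -> : a + `|(b - a + 1)%R|%N%:Z = b + 1 by lia.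
  by apply/andP; split; lia.
- move=> i; rewrite sw => hi.
  have : f (a + 1) <= f (a + i%:Z) by apply: climbs_le => //; lia.
  have : f (a + i%:Z) <= f b by apply: climbs_le => //; lia.
  lia.
- move=> i; rewrite sw => hi.
  by rewrite (nth_map 0%N) ?size_iota // nth_iota.
Qed.

(** A bi-infinite concatenation of blocks [c i], each entry weighing [g]; the
    weights of block [i] add up to [L (i + 1) - L i]. *)
Section Concatenation.
Variables (X : Type) (x0 : X) (c : int -> seq X).
Hypothesis c_up : forall i, exists2 i', i <= i' & (0 < size (c i'))%N.
Hypothesis c_down : forall i, exists2 i', i' <= i & (0 < size (c i'))%N.

Definition start : int -> int := csum (fun i => size (c i)).

Lemma start_climbs : climbs start.
Proof. exact: csum_climbs. Qed.

Lemma startS i : start (i + 1) = start i + (size (c i))%:Z.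
Proof. exact: csumS. Qed.

Lemma block_ex s : exists i, start i <= s < start (i + 1).
Proof. exact: climbs_locate start_climbs. Qed.

Definition block : int -> int := projT1 (boolp.choice block_ex).

Lemma blockP s : start (block s) <= s < start (block s + 1).
Proof. exact: (projT2 (boolp.choice block_ex)). Qed.

Definition offset s : nat := `|s - start (block s)|%N.

Lemma offset_lt s : (offset s < size (c (block s)))%N.
Proof. by have := blockP s; rewrite startS /offset; lia. Qed.

Lemma offsetE s : s = start (block s) + (offset s)%:Z.
Proof. by have := blockP s; rewrite /offset; lia. Qed.

Lemma block_start i (m : nat) : (m < size (c i))%N ->
  block (start i + m%:Z) = i /\ offset (start i + m%:Z) = m.
Proof.
move=> mi; set s := start i + m%:Z; have /andP[h1 h2] := blockP s.
have e : block s = i.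
  case: (ltgtP (block s) i) => // h.
  + have : start (block s + 1) <= start i.
      by apply: climbs_le; [exact: start_climbs|lia].
    by lia.
  + have : start (i + 1) <= start (block s).
      by apply: climbs_le; [exact: start_climbs|lia].
    by rewrite startS; lia.
by split => //; rewrite /offset e /s; lia.
Qed.

Definition entry s : X := nth x0 (c (block s)) (offset s).

Lemma entry_start i (m : nat) : (m < size (c i))%N ->
  entry (start i + m%:Z) = nth x0 (c i) m.
Proof. by move=> /block_start[e1 e2]; rewrite /entry e1 e2. Qed.

Variables (g : X -> nat) (L : int -> int).
Hypothesis LS : forall i, L (i + 1) = L i + (sumn [seq g x | x <- c i])%:Z.

Definition weigh s : int :=
  L (block s) + (sumn [seq g x | x <- take (offset s) (c (block s))])%:Z.

Lemma weigh_start0 i : weigh (start i) = L i.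
Proof.
(* Blocks may be empty: the sum stays put until the next nonempty block. *)
have [i' ii' ci'] := c_up i.
have [n] : exists n : nat, i' = i + n%:Z by exists `|(i' - i)%R|%N; lia.
elim: n i {ii'} => [|n IH] i i'E.
  rewrite -[start i]addr0 -[0]/(0%N%:Z) /weigh.
  by have [|-> ->] := @block_start i 0; [move: ci'; rewrite i'E addr0|rewrite take0 addr0].
case: (posnP (size (c i))) => [/size0nil ci0|ci].
  have := LS i; have := startS i; rewrite ci0 /= !addr0 => <- <-.
  by apply: IH; rewrite i'E; lia.
rewrite -[start i]addr0 -[0]/(0%N%:Z) /weigh.
by have [-> ->] := block_start ci; rewrite take0 addr0.
Qed.

Lemma weigh_start i (m : nat) : (m <= size (c i))%N ->
  weigh (start i + m%:Z) = L i + (sumn [seq g x | x <- take m (c i)])%:Z.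
Proof.
rewrite leq_eqVlt => /predU1P[->|mi].
  by rewrite take_size -LS -startS weigh_start0.
by have [e1 e2] := block_start mi; rewrite /weigh e1 e2.
Qed.

Lemma weighS s : weigh (s + 1) = weigh s + (g (entry s))%:Z.
Proof.
have hs := offset_lt s; rewrite [in LHS](offsetE s) -addrA -PoszD addn1.
rewrite weigh_start // (take_nth x0) // map_rcons sumn_rcons PoszD addrA.
by rewrite [in RHS](offsetE s) weigh_start ?(ltnW hs) // -offsetE.
Qed.

End Concatenation.

(** * The strip over a line *)

(** A face above a line is recorded by its size and the number of its bottom
    sides; all its remaining sides but two are top sides. *)
Definition top_of (x : nat * nat) : nat := (x.1 - 2 - x.2)%N.

(** The faces first met at a vertex whose upper faces are [u], when [u0] are those
    of the vertex on its left: the face over the edge between the two, which is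
    longer by one when the left vertex lies inside its bottom, and the faces
    touching the line only at the vertex. *)
Definition own (u0 u : seq nat) : seq (nat * nat) :=
  if size u == 1%N then [::] else
  (head 0%N u, (size u0 == 1%N).+1) ::
    [seq (x, 0%N) | x <- behead (take (size u).-1 u)].

(** Going through the faces [c] of a strip from left to right, [p] collects the
    sizes of the faces since the last one with a top side: these are the faces
    that the next vertex on the upper line has below it, before the new one. *)
Fixpoint emit (p : seq nat) (c : seq (nat * nat)) : seq (seq nat) :=
  if c is x :: c' then
    if top_of x is q.+1 then
      rcons p x.1 :: nseq q [:: x.1] ++ emit [:: x.1] c'
    else emit (rcons p x.1) c'
  else [::].

Definition carry1 (p : seq nat) (x : nat * nat) : seq nat :=
  if top_of x is q.+1 then [:: x.1] else rcons p x.1.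

Definition carry (p : seq nat) (c : seq (nat * nat)) : seq nat := foldl carry1 p c.

Lemma carry_rcons p c x : carry p (rcons c x) = carry1 (carry p c) x.
Proof. exact: foldl_rcons. Qed.

Definition block_of (U : int -> seq nat) (i : int) := own (U i) (U (i + 1)).

Definition rise (U : int -> seq nat) (i : int) : nat :=
  sumn [seq top_of x | x <- block_of U i].

(** The upper faces along a line, as a word for each vertex: the face over the edge
    on its left, the faces that touch the line only here, and the face over the
    edge on its right.  A word with a single letter belongs to a vertex in the
    middle of two bottom edges of one face. *)
Definition upper_line (U : int -> seq nat) : Prop := forall i,
  [/\ (0 < size (U i))%N, last 0%N (U i) = head 0%N (U (i + 1)),
      (size (U i) = 1%N -> size (U (i + 1)) <> 1%N),
      all (leq 3) (U i) & (size (U i) = 1%N -> (3 < head 0%N (U i))%N)].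

Definition rising (U : int -> seq nat) : Prop := forall i,
  (exists2 i', i <= i' & (0 < rise U i')%N) /\
  (exists2 i', i' <= i & (0 < rise U i')%N).

Lemma size_emit p c : size (emit p c) = sumn [seq top_of x | x <- c].
Proof.
elim: c p => [|x c IH] p //=; case: (top_of x) => [|m]; first by rewrite IH.
by rewrite /= size_cat size_nseq IH addSn.
Qed.

Section StripAbove.
Variables (U : int -> seq nat) (pend : int -> seq nat).
Hypothesis lineU : upper_line U.
Hypothesis risingU : rising U.
Hypothesis pendS : forall i, pend (i + 1) = carry (pend i) (block_of U i).

Local Notation c := (block_of U).

Lemma sumn_gt0 (s : seq nat) : (0 < sumn s)%N -> (0 < size s)%N.
Proof. by case: s. Qed.

Lemma block_up i : exists2 i', i <= i' & (0 < size (c i'))%N.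
Proof.
by have [[i' ii' ri'] _] := risingU i; exists i' => //; rewrite -(size_map top_of) sumn_gt0.
Qed.

Lemma block_down i : exists2 i', i' <= i & (0 < size (c i'))%N.
Proof.
by have [_ [i' ii' ri']] := risingU i; exists i' => //; rewrite -(size_map top_of) sumn_gt0.
Qed.

(** The abscissa of the left end of the first side that block [i] brings in: that
    of vertex [i], or of the vertex before it if vertex [i] is inside the bottom of
    a face, because this face is listed with the vertex at its right end. *)
Definition low_at (i : int) : int := i - (size (U i) == 1%N)%:Z.

Lemma low_atS i : low_at (i + 1) = low_at i + (sumn [seq x.2 | x <- c i])%:Z.
Proof.
have [_ _ h1 _ _] := lineU i; rewrite /low_at /block_of /own.
have z (s : seq nat) : sumn [seq x.2 | x <- [seq (x, 0%N) | x <- s]] = 0%N.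
  by elim: s.
case: eqP => h2 /=.
  by case: eqP => [/h1//|_]; rewrite subr0 addr0 addrK.
by rewrite z addn0; case: eqP => _ /=; lia.
Qed.

Definition high_at : int -> int := csum (rise U).

Lemma high_atS i : high_at (i + 1) = high_at i + (sumn [seq top_of x | x <- c i])%:Z.
Proof. exact: csumS. Qed.

Definition strip_above : strip :=
  Strip (weigh block_up block_down snd low_at)
        (weigh block_up block_down top_of high_at).

Local Arguments low : simpl never.
Local Arguments high : simpl never.
Local Notation S := strip_above.
Local Notation entry := (entry (0%N, 0%N) block_up block_down).
Local Notation start := (start c).

Lemma low_start i (m : nat) : (m <= size (c i))%N ->
  low S (start i + m%:Z) = low_at i + (sumn [seq x.2 | x <- take m (c i)])%:Z.
Proof. exact: weigh_start low_atS _ _. Qed.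

Lemma low_start0 i : low S (start i) = low_at i.
Proof. exact: weigh_start0 low_atS _. Qed.

Lemma high_start0 i : high S (start i) = high_at i.
Proof. exact: weigh_start0 high_atS _. Qed.

Lemma lowS s : low S (s + 1) = low S s + (entry s).2%:Z.
Proof. exact: weighS low_atS _. Qed.

Lemma highS s : high S (s + 1) = high S s + (top_of (entry s))%:Z.
Proof. exact: weighS high_atS _. Qed.

Lemma entry_valid s : (3 <= (entry s).1 /\ (entry s).2 + 2 <= (entry s).1)%N.
Proof.
have : entry s \in c (block block_up block_down s) by exact/mem_nth/offset_lt.
move: (block _ _ s) => i; rewrite /block_of /own.
have [s0 lh h1 U3 h4] := lineU i; have [s0' _ _ U3' _] := lineU (i + 1).
case: eqP => // h2; rewrite inE => /predU1P[->|/mapP[x xu ->]] /=; last first.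
  have : x \in U (i + 1) by apply: (mem_take (n0 := (size (U (i + 1))).-1)); exact: mem_behead.
  by move=> /(allP U3'); lia.
have h3 : (3 <= head 0%N (U (i + 1)))%N.
  by apply: (allP U3'); case: (U _) s0' => // a l _; rewrite inE eqxx.
split=> //; case: eqP => h5; last by rewrite add1n; lia.
have := h4 h5; rewrite -lh; case: (U i) h5 => // a [|//] _ /=; lia.
Qed.

Lemma size_at_entry s : size_at S s = (entry s).1.
Proof.
have [h1 h2] := entry_valid s; have e (x y : int) : x + y - x = y by lia.
by rewrite /size_at lowS highS !e /top_of; lia.
Qed.

Lemma strip_above_is_strip : is_strip S.
Proof.
split; first 2 last.
- move=> s; have [h1 h2] := entry_valid s; rewrite lowS highS /top_of; lia.
- split => [s|z|z]; first by rewrite lowS lerDl.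
  + by exists (start z); rewrite low_start0 /low_at; lia.
  + by exists (start (z + 1)); rewrite low_start0 /low_at; lia.
- have [_ down up] : climbs high_at.
    by apply: csum_climbs => i; case: (risingU i).
  split => [s|z|z]; first by rewrite highS lerDl.
  + by have [i hz] := down z; exists (start i); rewrite high_start0.
  + by have [i hz] := up z; exists (start i); rewrite high_start0.
Qed.

Lemma next_entry i : (entry (start i)).1 = last 0%N (U i) /\ low S (start i + 1) > i.
Proof.
have [s0 lh h1 _ _] := lineU i.
have first_in i' : size (U (i' + 1)) <> 1%N ->
    (entry (start i')).1 = head 0%N (U (i' + 1)) /\ low S (start i' + 1) = i' + 1.
  move=> h; have ci : (0 < size (c i'))%N by rewrite /block_of /own; case: eqP.
  have := entry_start (0%N, 0%N) block_up block_down ci; rewrite addr0 => ->.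
  have -> : start i' + 1 = start i' + 1%N%:Z by [].
  rewrite (low_start ci).
  rewrite /block_of /own; case: eqP => // _; split => //=.
  by rewrite take0 /= addn0 /low_at; case: eqP => _ /=; lia.
case: (eqVneq (size (U (i + 1))) 1%N) => [e|/eqP h]; last first.
  by have [-> ->] := first_in _ h; rewrite lh; split => //; lia.
have -> : start i = start (i + 1).
  by rewrite startS /block_of /own e eqxx addr0.
have [_ lh' h1' _ _] := lineU (i + 1).
have [-> ->] := first_in _ (h1' e); rewrite -lh' lh; split; last by lia.
by case: (U (i + 1)) e => // a [].
Qed.

Lemma strip_above_bottoms : bottoms S U.
Proof.
move=> j; rewrite -(subrK 1 j); move: (j - 1) => i {j}.
have [s0 _ _ _ _] := lineU (i + 1); have [nx nl] := next_entry (i + 1).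
have lowi : low S (start i) < i + 1 by rewrite low_start0 /low_at; lia.
exists (start i); case: (eqVneq (size (U (i + 1))) 1%N) => [e|h].
  have si : start i = start (i + 1).
    by rewrite startS /block_of /own e eqxx addr0.
  split; rewrite ?e //; try by move=> [|i'] //; lia.
  - by rewrite lowi /= si; exact: nl.
  - case=> // _; rewrite addr0 size_at_entry si nx.
    by case: (U (i + 1)) e => // a [].
have ciE : c i = (head 0%N (U (i + 1)), (size (U i) == 1%N).+1) ::
    [seq (x, 0%N) | x <- behead (take (size (U (i + 1))).-1 (U (i + 1)))].
  by rewrite /block_of /own (negbTE h).
have sc : (size (c i)).+1 = size (U (i + 1)).
  rewrite ciE /= size_map size_behead size_takel ?leq_pred //.
  by move/eqP: h; lia.
have z (s : seq nat) m : sumn [seq x.2 | x <- take m [seq (x, 0%N) | x <- s]] = 0%N.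
  by elim: s m => [|x s IH] [|m] //=; rewrite IH.
have lowm (m : nat) : (0 < m <= size (c i))%N -> low S (start i + m%:Z) = i + 1.
  move=> hm; rewrite low_start; last by lia.
  rewrite ciE; case: m hm => // m _ /=; rewrite z addn0 /low_at.
  by case: eqP => _ /=; lia.
have si : start i + (size (c i))%:Z = start (i + 1) by rewrite startS.
split => //.
- rewrite lowi -sc /= (_ : start i + (size (c i)).+1%:Z = start (i + 1) + 1).
    exact: nl.
  by rewrite -addn1 PoszD addrA si.
- by move=> m; rewrite -sc ltnS; exact: lowm.
- move=> m; rewrite -sc ltnS leq_eqVlt => /predU1P[->|hm].
    rewrite size_at_entry si nx -nth_last -sc; congr nth; lia.
  rewrite size_at_entry entry_start //.
  rewrite ciE; case: m hm => [|m] hm /=; first by rewrite nth0.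
  have hm' : (m < size (behead (take (size (U (i + 1))).-1 (U (i + 1)))))%N.
    by move: hm; rewrite ciE /= size_map ltnS.
  rewrite (nth_map 0%N) //= nth_behead nth_take //.
  by move: hm'; rewrite size_behead size_takel; lia.
Qed.

(** [w] lists the faces from the last one with a top side before [s] up to [s]. *)
Definition trail (s : int) (w : seq nat) : Prop := exists (a : int) (n : nat),
  [/\ s = a + n.+1%:Z, w = [seq (entry (a + i%:Z)).1 | i <- iota 0 n.+1],
      (0 < top_of (entry a))%N &
      forall i : nat, (0 < i <= n)%N -> top_of (entry (a + i%:Z)) = 0%N].

Lemma trail_reset s : (0 < top_of (entry s))%N -> trail (s + 1) [:: (entry s).1].
Proof.
by move=> h; exists s, 0%N; split => //=; [rewrite addr0|move=> i; lia].
Qed.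

Lemma trailS s w : trail s w -> trail (s + 1) (carry1 w (entry s)).
Proof.
rewrite /carry1; case e: (top_of (entry s)) => [|m] tr; last first.
  by apply: trail_reset; rewrite e.
have [a [n [sE -> a0 an]]] := tr; exists a, n.+1; split => //.
- by rewrite sE; lia.
- by rewrite -(addn1 n.+1) iotaD map_cat cats1 add0n sE.
- move=> i; rewrite andbC leq_eqVlt => /andP[/predU1P[->|h] i0]; first by rewrite -sE.
  by apply: an; lia.
Qed.

Lemma trail_carry i p : trail (start i) p -> trail (start (i + 1)) (carry p (c i)).
Proof.
move=> tr; suff H m : (m <= size (c i))%N ->
    trail (start i + m%:Z) (carry p (take m (c i))).
  by rewrite startS; have := H _ (leqnn _); rewrite take_size.
elim: m => [|m IH] hm.
  by rewrite take0 addr0.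
rewrite (take_nth (0%N, 0%N)) // carry_rcons.
rewrite -(entry_start (0%N, 0%N) block_up block_down hm).
rewrite (_ : start i + m.+1%:Z = start i + m%:Z + 1); last by lia.
by apply: trailS; apply: IH; exact: ltnW.
Qed.

Lemma trail_rise i p : (0 < rise U i)%N -> trail (start (i + 1)) (carry p (c i)).
Proof.
move=> ri; suff [] : trail (start (i + 1)) (carry p (c i)) \/ rise U i = 0%N.
- by [].
- by move=> e; rewrite e in ri.
suff H m : (m <= size (c i))%N ->
    trail (start i + m%:Z) (carry p (take m (c i))) \/
    sumn [seq top_of x | x <- take m (c i)] = 0%N.
  by rewrite startS; have := H _ (leqnn _); rewrite take_size.
elim: m => [|m IH] hm.
  by right; rewrite take0.
rewrite (take_nth (0%N, 0%N)) // carry_rcons.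
rewrite -(entry_start (0%N, 0%N) block_up block_down hm).
rewrite (_ : start i + m.+1%:Z = start i + m%:Z + 1); last by lia.
case e: (top_of (entry (start i + m%:Z))) => [|q].
  case: (IH (ltnW hm)) => [tr|z]; [left; exact: trailS|right].
  by rewrite map_rcons sumn_rcons z e.
by left; rewrite /carry1 e; apply: trail_reset; rewrite e.
Qed.

Lemma trail_pend i : trail (start i) (pend i).
Proof.
have [_ [i' ii' ri']] := risingU (i - 1).
have -> : i = i' + 1 + `|(i - (i' + 1))%R|%N%:Z by lia.
elim: `|_|%N => [|n IH]; first by rewrite addr0 pendS; exact: trail_rise.
rewrite (_ : i' + 1 + n.+1%:Z = i' + 1 + n%:Z + 1); last by lia.
by rewrite pendS; exact: trail_carry.
Qed.

(** While no face has a top side, the sides pile up at one vertex of the upper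
    line; a face with [q.+1] top sides closes this vertex and passes [q] vertices
    that see nothing but this face. *)
Lemma reads_emit i m p : (m <= size (c i))%N -> trail (start i + m%:Z) p ->
  forall n, (n < size (emit p (drop m (c i))))%N ->
  reads S (high S) (high S (start i + m%:Z) + n%:Z) (nth [::] (emit p (drop m (c i))) n).
Proof.
move: {2}(size (c i) - m)%N (erefl (size (c i) - m)%N) => r rE.
elim: r m rE p => [|r IH] m rE p mc tr n.
  by rewrite drop_oversize //; lia.
have mlt : (m < size (c i))%N by lia.
rewrite (drop_nth (0%N, 0%N)) //=.
have := entry_start (0%N, 0%N) block_up block_down mlt.
set s := start i + m%:Z in tr * => es; rewrite -es.
have sS : s + 1 = start i + m.+1%:Z by rewrite /s; lia.
have hS := highS s; have trS := trailS tr; rewrite sS in hS trS.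
move: hS trS; rewrite /carry1; case eq: (top_of (entry s)) => [|q] hS trS hn.
  by rewrite -[high S s]addr0 -hS; apply: IH => //; lia.
case: n hn => [|n] hn /=.
  have [a [l [sE -> a0 al]]] := tr; rewrite addr0.
  have aS : high S a < high S (a + 1) by rewrite highS; lia.
  have same j : (0 < j <= l.+1)%N -> high S (a + j%:Z) = high S (a + 1).
    elim: j => // j IHj hj; case: (posnP j) => [->//|j0].
    have -> : a + j.+1%:Z = a + j%:Z + 1 by lia.
    by rewrite highS al ?addr0 ?IHj //; lia.
  have hs : high S s = high S (a + 1) by rewrite sE same //; lia.
  exists a; rewrite /reads_from size_rcons size_map size_iota; split => //.
  - rewrite hs aS /= -hs (_ : a + l.+2%:Z = start i + m.+1%:Z).
      by rewrite hS; lia.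
    by rewrite -sS sE; lia.
  - by move=> j hj; rewrite hs same //; lia.
  - move=> j hj; rewrite nth_rcons size_map size_iota size_at_entry.
    case: (ltngtP j l.+1) hj => [h _|//|-> _]; first 2 last.
      by rewrite -sE.
      by rewrite (nth_map 0%N) ?size_iota // nth_iota.
    by move=> h; lia.
rewrite nth_cat size_nseq; case: ltnP => nq.
  rewrite nth_nseq nq; exists s; split => //=.
  - rewrite (_ : s + 1 = start i + m.+1%:Z) // hS; lia.
  - by move=> [|j] //; lia.
  - by case=> // _; rewrite addr0 size_at_entry.
have -> : high S s + n.+1%:Z = high S (start i + m.+1%:Z) + (n - q)%N%:Z.
  by rewrite hS; lia.
apply: IH => //; first by lia.
by move: hn; rewrite /= size_cat size_nseq; lia.
Qed.

End StripAbove.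

(** The faces over the edges and at the vertices, taken from left to right, are the
    faces of the strip.  Their sizes and their numbers of bottom sides give their
    numbers of top sides, whose sums place the sides on the upper line. *)
Theorem strip_over_line U pend : upper_line U -> rising U ->
  (forall i, pend (i + 1) = carry (pend i) (block_of U i)) ->
  exists S H D,
    [/\ [/\ is_strip S, bottoms S U & tops S D], climbs H,
        forall i, H (i + 1) = H i + (size (emit (pend i) (block_of U i)))%:Z &
        forall i n, (n < size (emit (pend i) (block_of U i)))%N ->
          D (H i + n%:Z) = nth [::] (emit (pend i) (block_of U i)) n].
Proof.
move=> lineU risingU pendS.
have sS := strip_above_is_strip lineU risingU.
have ch : climbs (high (strip_above risingU)) by case: sS.
have [D tD] := boolp.choice (fun z => reads_exists (strip_above risingU) z ch).
exists (strip_above risingU), (high_at U), D; split => //.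
- by split => //; exact: strip_above_bottoms.
- by apply: csum_climbs => i; case: (risingU i).
- by move=> i; rewrite size_emit; exact: high_atS.
- move=> i n hn; apply: reads_uniq ch (tD _) _.
  have := @reads_emit U lineU risingU i 0 (pend i) (leq0n _).
  rewrite addr0 drop0 high_start0; apply => //.
  by apply: trail_pend.
Qed.

(** * Choices along a line *)

(** Follow an ultrafilter on the lengths of the stretches: the value at a place is
    the one that is chosen there for almost all lengths. *)
Lemma bi_infinite_choice (X : eqType) (cand : int -> seq X)
    (ok : int -> X -> X -> Prop) :
  (forall m : nat, exists f : int -> X, forall i : int, - m%:Z <= i <= m%:Z ->
     f i \in cand i /\ ok i (f i) (f (i + 1))) ->
  exists f : int -> X, forall i, f i \in cand i /\ ok i (f i) (f (i + 1)).
Proof.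
move=> stretch; have [F FP] := boolp.choice stretch.
have [G [GU GF]] := @ultraFilterLemma nat \oo _.
have late i : G [set m | F m i \in cand i /\ ok i (F m i) (F m (i + 1))].
  apply: GF; exists `|i|%N => // m /= hm; apply: FP; lia.
have pick i : exists x, x \in cand i /\ G [set m | F m i = x].
  have : G [set m | F m i \in cand i].
    by apply: filterS (late i) => m [].
  elim: (cand i) => [|x s IH] h.
    by have [m] := @filter_ex _ G _ _ h.
  have [hx|hx] := @in_ultra_setVsetC _ G [set m | F m i = x] GU.
    by exists x; rewrite inE eqxx.
  have [|y [ys hy]] := IH; last by exists y; rewrite inE ys orbT.
  apply: filterS2 h hx => m /=; rewrite inE => /predU1P[-> //|//].
have [f fP] := boolp.choice pick.
exists f => i; have [fi Gi] := fP i; have [_ Gi1] := fP (i + 1).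
split => //; have [m [[_ hm] [e1 e2]]] :=
  @filter_ex _ G _ _ (filterI (late i) (filterI Gi Gi1)).
by rewrite -e1 -e2.
Qed.

(** * Tables of moves *)

Section Moves.
Local Open Scope nat_scope.
Local Notation bits := BinNums.N.
Local Notation no_bits := BinNums.N0.

(** Face sizes are written as symbols: 3 and 4 stand for themselves, and a larger
    symbol for an arbitrary size that is at least the one given here. *)
Definition least (s : nat) : nat :=
  nth 0 [:: 0; 0; 0; 3; 4; 4; 4; 4; 4; 5; 5; 5; 6; 5; 5; 5] s.

(** Symbols for faces that are required to show a vertex with no other lower face
    between two vertices that have several lower faces. *)
Definition spaced (s : nat) : bool := 8 < s < 13.

Definition top_least (x : nat * nat) : nat := top_of (least x.1, x.2).

(** The lower faces along the next line, as [emit] gives them, when the sizes are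
    only known through their symbols.  A starred letter may be repeated any number
    of times, because a face of unknown size has an unknown number of top sides. *)
Fixpoint script (p : seq nat) (c : seq (nat * nat)) : seq (seq nat * bool) :=
  if c is x :: c' then
    if top_least x is q.+1 then
      (rcons p x.1, false) :: nseq q ([:: x.1], false) ++
      nseq (4 < x.1) ([:: x.1], true) ++ script [:: x.1] c'
    else script (rcons p x.1) c'
  else [::].

Definition carry1_least (p : seq nat) (x : nat * nat) : seq nat :=
  if top_least x is q.+1 then [:: x.1] else rcons p x.1.

(** The symbol decides whether the face has a top side. *)
Definition firm (x : nat * nat) : bool := (x.1 <= 4) || (0 < top_least x).

(** The comparisons and memberships used by the search are spelled out, since the
    canonical ones are much slower to evaluate. *)
Fixpoint eqs (s t : seq nat) : bool :=
  match s, t with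
  | [::], [::] => true
  | x :: s', y :: t' => if eqn x y then eqs s' t' else false
  | _, _ => false
  end.

Fixpoint among (x : seq nat) (s : seq (seq nat)) : bool :=
  if s is y :: s' then if eqs x y then true else among x s' else false.

Fixpoint distinct (s : seq (seq nat)) : seq (seq nat) :=
  if s is x :: s' then if among x s' then distinct s' else x :: distinct s'
  else [::].

(** The place between two neighbouring vertices of a line, as far as it matters for
    what comes next: the face over the edge, the face under the edge, whether the
    vertex on the left has several lower faces, whether it has a single upper face,
    and then the faces collected since the last top side. *)
Definition junction := seq nat.

(** The lower and the upper faces of a vertex. *)
Definition word := (seq nat * seq nat)%type.
Definition move := (junction * word * junction)%type.

Definition joint (w : word) (p : seq nat) : junction :=
  [:: last 0 w.2, last 0 w.1, (1 < size w.1) : nat, (size w.2 == 1) : nat & p].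

Definition pending (x : junction) : seq nat := drop 4 x.

(** [own] only asks whether the left neighbour has a single upper face. *)
Definition above (x : junction) (w : word) : seq (nat * nat) :=
  own (nseq (nth 0 x 3) 0) w.2.

Definition arrive (x : junction) (w : word) : option junction :=
  if x is [:: e, f, k, s & p] then
    if [&& eqn (head 0 w.2) e, eqn (head 0 w.1) f,
         (k == 0) || (size w.1 == 1) || ~~ spaced f,
         (s == 0) || (size w.2 != 1) & all firm (above x w)]
    then Some (joint w (foldl carry1_least p (above x w)))
    else None
  else None.

(** The move emits only letters that the labels of the next line know. *)
Definition lettered (V : seq (seq nat)) (x : junction) (w : word) : bool :=
  all (fun c => among c.1 V) (script (pending x) (above x w)).

Definition leave (V : seq (seq nat)) (W : seq word) (x : junction) : seq move :=
  pmap (fun w => if arrive x w is Some y then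
    if lettered V x w then Some (x, w, y) else None else None) W.

(** Moves that no move can follow or precede are useless on a bi-infinite line. *)
Fixpoint prune (n : nat) (T : seq move) : seq move :=
  if n is n'.+1 then
    let A := distinct [seq t.1.1 | t <- T] in let B := distinct [seq t.2 | t <- T] in
    let T' := [seq t <- T | among t.1.1 B && among t.2 A] in
    if size T' == size T then T else prune n' T'
  else T.

Definition prefixes (c : seq nat) : seq (seq nat) :=
  [seq take i.+1 c | i <- iota 0 (size c).-1].

(** The moves by words in [W] whose letters lie in [V]; what has been collected at
    a junction is a proper prefix of some letter. *)
Definition table (V : seq (seq nat)) (W : seq word) : seq move :=
  let P := distinct (flatten [seq prefixes c | c <- V]) in
  let J := distinct [seq joint w p | w <- W, p <- P] in
  prune 20 (flatten [seq leave V W x | x <- J]).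

(** Pruning may lose letters, and moves that emit these have to go as well. *)
Fixpoint self_table (n : nat) (V : seq (seq nat)) (W : seq word) : seq move :=
  let T := table V W in
  let V' := distinct [seq t.1.2.1 | t <- T] in
  if n is n'.+1 then
    if size V' == size V then T else self_table n' V' [seq w <- W | among w.1 V']
  else T.

(** Sets of junctions are written as bits of a binary number, in the order of a
    fixed list; equal sets are then equal numbers. *)
Fixpoint position (x : seq nat) (s : seq (seq nat)) : bits :=
  if s is y :: s' then if eqs x y then no_bits else BinNat.N.succ (position x s') else no_bits.

Definition by_letter (J : seq junction) (T : seq move) : seq (seq nat * seq (bits * bits)) :=
  [seq (c, [seq (position t.1.1 J, position t.2 J) | t <- T & eqs t.1.2.1 c])
  | c <- distinct [seq t.1.2.1 | t <- T]].

Fixpoint entries_at (ix : seq (seq nat * seq (bits * bits))) (c : seq nat) : seq (bits * bits) :=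
  if ix is e :: ix' then if eqs c e.1 then e.2 else entries_at ix' c else [::].

(** The junctions at which a labelling can stand after the letter [c], if it could
    stand at those of [R] before. *)
Definition advance ix (R : bits) (c : seq nat) : bits :=
  foldl (fun Q e => if BinNat.N.testbit R e.1 then BinNat.N.setbit Q e.2 else Q)
    no_bits (entries_at ix c).

(** A set of junctions contained in [R], each reached from the set by the letter
    [c]: it survives any number of repetitions of [c]. *)
Fixpoint stable (n : nat) ix (R : bits) (c : seq nat) : bits :=
  if n is n'.+1 then
    let Q := BinNat.N.land R (advance ix R c) in
    if BinNat.N.eqb Q R then R else stable n' ix Q c
  else no_bits.

Fixpoint distinct_bits (s : seq bits) : seq bits :=
  if s is x :: s' then
    if has (BinNat.N.eqb x) s' then distinct_bits s' else x :: distinct_bits s'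
  else [::].

(** One of the resulting sets is adequate, whatever the numbers of repetitions of
    the starred letters are. *)
Fixpoint follow ix (Rs : seq bits) (v : seq (seq nat * bool)) : seq bits :=
  if v is (c, star) :: v' then
    let Rs' := [seq advance ix R c | R <- Rs] in
    follow ix (distinct_bits (if star then [seq stable 9 ix R c | R <- Rs'] ++ Rs else Rs')) v'
  else Rs.

(** The search follows a path along a line, together with a set of junctions in
    which a labelling of the letters emitted so far can end. *)
Definition node := (junction * bits)%type.

Definition next_nodes ix (G : seq move) (e : node) : seq node :=
  flatten [seq [seq (t.2, R) | R <- follow ix [:: e.2] (script (pending e.1) (above e.1 t.1.2))]
          | t <- G & eqs t.1.1 e.1].

Definition same_node (e e' : node) : bool := eqs e.1 e'.1 && BinNat.N.eqb e.2 e'.2.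

Fixpoint extend (seen todo new : seq node) : seq node :=
  if new is e :: new' then
    extend seen (if has (same_node e) seen || has (same_node e) todo then todo
                 else e :: todo) new'
  else todo.

Fixpoint explore (n : nat) ix (G : seq move) (seen todo : seq node) : bool :=
  if todo is e :: todo' then
    if n is n'.+1 then
      ~~ BinNat.N.eqb e.2 no_bits &&
      explore n' ix G (e :: seen) (extend (e :: seen) todo' (next_nodes ix G e))
    else false
  else true.

Definition full (J : seq junction) : bits :=
  foldr (fun x Q => BinNat.N.setbit Q (position x J)) no_bits J.

(** Along any path in [G], the set of possible ends of labellings in [L] of the
    emitted letters never becomes empty. *)
Definition tracks (G L : seq move) : bool :=
  let J := distinct [seq t.1.1 | t <- L] in
  explore 2000 (by_letter J L) G [::] [seq (x, full J) | x <- distinct [seq t.1.1 | t <- G]].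

Definition rises (t : move) : bool := has (fun x => 0 < top_least x) (above t.1.1 t.1.2).

Fixpoint soon (n : nat) (T : seq move) (t : move) : bool :=
  if rises t then true else
  if n is n'.+1 then
    all (fun t' => if eqs t.2 t'.1.1 then soon n' T t' else true) T else false.

(** What a path in [T] needs in order to prescribe an [upper_line] that is
    [rising]. *)
Definition playable (T : seq move) : bool :=
  let J := distinct [seq t.1.1 | t <- T] in
  all (fun t => [&& arrive t.1.1 t.1.2 == Some t.2, among t.2 J,
    0 < size t.1.2.2, all (fun s => 2 < least s) t.1.2.2,
    (size t.1.2.2 != 1) || (3 < least (head 0 t.1.2.2)) &
    soon 2 T t]) T.

Lemma eqsE (s t : seq nat) : eqs s t = (s == t).
Proof.
elim: s t => [|x s IH] [|y t] //=; rewrite eqseq_cons -IH.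
by rewrite -[eqn x y]/(x == y); case: eqP.
Qed.

Lemma amongE x s : among x s = (x \in s).
Proof. by elim: s => //= y s IH; rewrite inE -IH eqsE; case: eqP. Qed.

Lemma mem_distinct s : distinct s =i s.
Proof.
elim: s => //= x s IH y; rewrite amongE; case: ifP => xs; last by rewrite !inE IH.
by rewrite inE IH; case: eqP => // ->.
Qed.

Lemma position_inj x y s : y \in s -> position x s = position y s -> x = y.
Proof.
elim: s => //= z s IH; rewrite inE !eqsE.
case: (eqVneq y z) => [->|yz] /=; case: (eqVneq x z) => [->|xz] //= ys.
- by move=> h; case: (BinNat.N.neq_succ_0 _ h).
- by move=> h; case: (BinNat.N.neq_succ_0 _ (esym h)).
- by move/BinNat.N.succ_inj; exact: IH.
Qed.

Lemma full_testbit J n : BinNat.N.testbit (full J) n -> exists2 x, x \in J & position x J = n.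
Proof.
suff H s : {subset s <= J} -> BinNat.N.testbit
    (foldr (fun x Q => BinNat.N.setbit Q (position x J)) no_bits s) n ->
    exists2 x, x \in J & position x J = n by apply: H.
elim: s => [|x s IH] sub //=; move/(proj1 (BinNat.N.setbit_iff _ _ _)) => [<-|].
  by exists x => //; apply: sub; rewrite inE eqxx.
by apply: IH => y ys; apply: sub; rewrite inE ys orbT.
Qed.

Lemma entries_by_letter J T c e : e \in entries_at (by_letter J T) c ->
  exists t, [/\ t \in T, t.1.2.1 = c & e = (position t.1.1 J, position t.2 J)].
Proof.
rewrite /by_letter; elim: (distinct _) => //= c' cs IH; rewrite eqsE.
case: eqP => [-> /mapP[t]|_ //]; rewrite mem_filter eqsE => /andP[/eqP tc tT] ->.
by exists t.
Qed.

Lemma advance_testbit ix R c n : BinNat.N.testbit (advance ix R c) n ->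
  exists2 e, e \in entries_at ix c & BinNat.N.testbit R e.1 /\ e.2 = n.
Proof.
rewrite /advance; set l := entries_at ix c.
suff H Q : BinNat.N.testbit (foldl (fun Q e => if BinNat.N.testbit R e.1
    then BinNat.N.setbit Q e.2 else Q) Q l) n ->
    (exists2 e, e \in l & BinNat.N.testbit R e.1 /\ e.2 = n) \/ BinNat.N.testbit Q n.
  by move/H => [//|]; rewrite BinNat.N.bits_0.
elim: l Q => [|e l IH] Q /=; first by right.
case/IH => [[e' el h]|]; first by left; exists e' => //; rewrite inE el orbT.
case: ifP => h; last by right.
move/(proj1 (BinNat.N.setbit_iff _ _ _)) => [<-|]; last by right.
by left; exists e; rewrite ?inE ?eqxx.
Qed.

Lemma stable_testbit m ix R c n : BinNat.N.testbit (stable m ix R c) n ->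
  BinNat.N.testbit R n /\ BinNat.N.testbit (advance ix (stable m ix R c) c) n.
Proof.
elim: m R => [|m IH] R /=; first by [].
case: ifP => [/BinNat.N.eqb_eq e h|_ /IH[]].
  by move: (h); rewrite -{1}e BinNat.N.land_spec => /andP[].
by rewrite BinNat.N.land_spec => /andP[].
Qed.

Lemma mem_distinct_bits (s : seq bits) R : (R \in distinct_bits s) = (R \in s).
Proof.
elim: s => //= Q s IH; have -> : has (BinNat.N.eqb Q) s = (Q \in s).
  elim: s {IH} => //= Q' s IH; rewrite inE IH; congr (_ || _).
by case: ifP => Qs; rewrite !inE IH //; case: eqP => // ->.
Qed.

Fixpoint expands (d : seq (seq nat * bool)) (v : seq (seq nat)) : Prop :=
  if d is (c, star) :: d' then
    if star then exists j v', v = nseq j c ++ v' /\ expands d' v'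
    else exists v', v = c :: v' /\ expands d' v'
  else v = [::].

Lemma expands_nseq j c d v : expands d v ->
  expands (nseq j (c, false) ++ d) (nseq j c ++ v).
Proof. by elim: j => //= j IH /IH h; exists (nseq j c ++ v). Qed.

Definition sizing (sz : nat -> nat) : Prop :=
  forall s, least s <= sz s /\ (s <= 4 -> sz s = least s).

Section Sizing.
Variable sz : nat -> nat.
Hypothesis szP : sizing sz.

Definition resize (x : nat * nat) : nat * nat := (sz x.1, x.2).

Lemma top_resize x : top_least x <= top_of (resize x) /\
  (x.1 <= 4 -> top_of (resize x) = top_least x).
Proof.
rewrite /top_least /top_of /=; have [h1 h2] := szP x.1.
by split => [|/h2 -> //]; rewrite !leq_sub2r.
Qed.

Lemma emit_script p c : all firm c -> exists2 v, expands (script p c) v &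
  emit (map sz p) (map resize c) = map (map sz) v.
Proof.
elim: c p => [|x c IH] p /=; first by exists [::].
case/andP=> fx /IH{}IH; have [h1 h2] := top_resize x; move: fx h1 h2.
rewrite /firm; case: (top_least x) => [|q] fx h1 h2.
  have x4 : x.1 <= 4 by case/orP: fx.
  by rewrite h2 //= -map_rcons; apply: IH.
have [v hv ev] := IH [:: x.1]; move: h1.
case eq: (top_of (resize x)) => [//|q'] qq'.
exists (rcons p x.1 :: nseq q [:: x.1] ++ nseq (q' - q) [:: x.1] ++ v).
  eexists; split; first by [].
  apply: expands_nseq; case: ltnP => x4 /=; first by exists (q' - q), v.
  by have := h2 x4; rewrite eq => -[->]; rewrite subnn.
rewrite /= !map_cat map_rcons !map_nseq -ev catA -nseqD; congr (_ :: nseq _ _ ++ _).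
by move: qq'; rewrite ltnS => /subnKC.
Qed.

Lemma carry_resize p c : all firm c ->
  carry (map sz p) (map resize c) = map sz (foldl carry1_least p c).
Proof.
elim: c p => //= x c IH p /andP[fx fc]; rewrite -IH //; congr carry.
have [h1 h2] := top_resize x; move: fx h1 h2; rewrite /carry1 /carry1_least /firm.
case: (top_least x) => [|q] fx h1 h2.
  by rewrite h2 ?map_rcons //; case/orP: fx.
by move: h1; case: (top_of _).
Qed.

End Sizing.
End Moves.

(** * Labelling the next line *)

Section Labelling.
Local Open Scope nat_scope.
Local Notation bits := BinNums.N.
Variable sz : nat -> nat.
Hypothesis szP : sizing sz.

Definition linked (x : int -> move) (T : seq move) (i : int) : Prop :=
  x i \in T /\ (x i).2 = (x (i + 1)%R).1.1.

(** The line with lower faces [D] can be completed by a path of moves. *)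
Definition labelled (T : seq move) (D : int -> seq nat) : Prop :=
  exists x, forall i, linked x T i /\ D i = map sz (x i).1.2.1.

Section Reading.
Variables (L : seq move) (D : int -> seq nat) (a : int).
Hypothesis playL : playable L.
Local Notation J := (distinct [seq t.1.1 | t <- L]).
Local Notation ix := (by_letter J L).

(** Every junction in the set [R] ends a labelling of the letters from [a] to
    [h - 1]. *)
Definition reached (h : int) (R : bits) : Prop :=
  forall n, BinNat.N.testbit R n -> exists y,
  [/\ forall i, (a <= i < h)%R -> linked y L i /\ D i = map sz (y i).1.2.1,
      (y h).1.1 \in J & position (y h).1.1 J = n].

Lemma reached_sub h R R' : (forall n, BinNat.N.testbit R' n -> BinNat.N.testbit R n) ->
  reached h R -> reached h R'.
Proof. by move=> sub hR n /sub /hR. Qed.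

Lemma reached_full : reached a (full J).
Proof.
move=> n /full_testbit[j jJ jn]; exists (fun=> (j, ([::], [::]), j)).
by split => // i; lia.
Qed.

Lemma reached_advance h R c : (a <= h)%R -> D h = map sz c -> reached h R ->
  reached (h + 1)%R (advance ix R c).
Proof.
move=> ah Dh hR n /advance_testbit[e /entries_by_letter[t [tL tc ->]] /= [/hR[y [yl yJ yn]] tn]].
have ey : (y h).1.1 = t.1.1.
  apply: (position_inj _ yn); rewrite mem_distinct; exact: map_f.
have := allP playL _ tL; case/and3P=> _ tJ _.
exists (fun i => if (i < h)%R then y i else if i == h then t
                 else (t.2, ([::], [::]), t.2)).
rewrite (_ : (h + 1 < h)%R = false); last by lia.
rewrite (_ : (h + 1 == h)%R = false); last by lia.
split => //=; last by rewrite amongE in tJ.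
move=> i hi; rewrite /linked; case: (ltgtP i h) => [ih|ih|ih]; last first.
- rewrite ih (_ : (h + 1 < h)%R = false); last by lia.
  rewrite (_ : (h + 1 == h)%R = false); last by lia.
  by rewrite Dh tc.
- by lia.
- have [|[yL y1] y2] := yl i; first by lia.
  case: (ltgtP (i + 1)%R h) => [_|ih1|ih1]; [by []|by lia|].
  by split => //; split => //; rewrite y1 ih1.
Qed.

Lemma reached_stable m h R c j : (a <= h)%R ->
  (forall i : nat, i < j.+1 -> D (h + i%:Z)%R = map sz c) -> reached h R ->
  reached (h + j.+1%:Z)%R (stable m ix (advance ix R c) c).
Proof.
move=> ah; elim: j => [|j IH] Dj hR.
  have D0 : D h = map sz c by have := Dj 0%N isT; rewrite addr0.
  by apply: reached_sub (reached_advance ah D0 hR) => n /stable_testbit[].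
have -> : (h + j.+2%:Z = h + j.+1%:Z + 1)%R by lia.
have ahj : (a <= h + j.+1%:Z)%R by lia.
have hS : reached (h + j.+1%:Z)%R (stable m ix (advance ix R c) c).
  by apply: IH => // i ij; apply: Dj; lia.
by apply: reached_sub (reached_advance ahj (Dj _ _) hS) => // n /stable_testbit[].
Qed.

Lemma reached_follow h Rs d v : (a <= h)%R ->
  (forall n : nat, n < size v -> D (h + n%:Z)%R = nth [::] (map (map sz) v) n) ->
  expands d v -> (exists2 R, R \in Rs & reached h R) ->
  exists2 R, R \in follow ix Rs d & reached (h + (size v)%:Z)%R R.
Proof.
elim: d v h Rs => [|[c star] d IH] v h Rs ah Dv /=.
  by move=> -> [R Rs1 hR]; exists R; rewrite ?addr0.
case: star => [[j [v' [vE ev]]]|[v' [vE ev]]] [R Rs1 hR]; last first.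
  rewrite vE /= (_ : (h + (size v').+1%:Z = h + 1 + (size v')%:Z)%R); last by lia.
  apply: IH ev _ => //; first by lia.
    move=> n nv; have := Dv n.+1; rewrite vE /= => <- //.
    by congr D; lia.
  exists (advance ix R c).
    by rewrite mem_distinct_bits; exact: (map_f (fun R => advance ix R c)).
  by apply: reached_advance => //; have := Dv 0%N; rewrite vE /= addr0 => ->.
rewrite vE size_cat size_nseq PoszD addrA.
apply: IH ev _ => //; first by lia.
  move=> n nv; have := Dv (j + n)%N; rewrite vE size_cat size_nseq ltn_add2l => /(_ nv).
  rewrite map_cat map_nseq nth_cat size_nseq ltnNge leq_addr /= addKn => <-.
  by congr D; lia.
case: j vE => [|j] vE.
  by exists R; rewrite ?addr0 // mem_distinct_bits mem_cat Rs1 orbT.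
exists (stable 9 ix (advance ix R c) c).
  rewrite mem_distinct_bits mem_cat; apply/orP; left.
  exact/(map_f (fun R => stable 9 ix R c))/(map_f (fun R => advance ix R c)).
apply: reached_stable => // i ij; have := Dv i.
rewrite vE size_cat size_nseq map_cat map_nseq => ->; last by lia.
by rewrite nth_cat size_nseq ij nth_nseq ij.
Qed.

End Reading.

Lemma same_nodeE (e e' : node) : same_node e e' = (e == e').
Proof.
rewrite /same_node eqsE; case: e e' => [x R] [x' R'] /=.
by rewrite xpair_eqE.
Qed.

Lemma has_same_node e s : has (same_node e) s = (e \in s).
Proof. by elim: s => //= e' s IH; rewrite inE IH same_nodeE. Qed.

Lemma mem_extend seen todo new e :
  (e \in todo) || (e \in new) -> (e \in seen) || (e \in extend seen todo new).
Proof.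
elim: new todo => [|e' new IH] todo /=; first by rewrite orbF => ->; rewrite orbT.
rewrite inE => h; rewrite !has_same_node.
have [/eqP ee|ne] := boolP (e == e').
  rewrite -ee; case: ifP => [/orP[->//|et]|_]; apply: IH; rewrite ?et //.
  by rewrite inE eqxx.
apply: IH; move: h; rewrite (negbTE ne) /= => /orP[h|->]; last by rewrite orbT.
by case: ifP => _; rewrite ?inE h ?orbT.
Qed.

(** A search that comes to an end has found a set of nodes that is closed under
    [next_nodes] and contains no empty set of junctions. *)
Lemma explore_sound n ix G seen todo : explore n ix G seen todo ->
  (forall e, e \in seen -> ~~ BinNat.N.eqb e.2 BinNums.N0 /\
     forall e', e' \in next_nodes ix G e -> (e' \in seen) || (e' \in todo)) ->
  exists P : node -> Prop, (forall e, (e \in seen) || (e \in todo) -> P e) /\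
    forall e, P e -> ~~ BinNat.N.eqb e.2 BinNums.N0 /\
      forall e', e' \in next_nodes ix G e -> P e'.
Proof.
elim: n seen todo => [|n IH] seen [|e todo] //=.
- move=> _ h; exists (fun e => e \in seen); split => [e|e /h[he hs]].
    by rewrite orbF.
  by split => // e' /hs; rewrite orbF.
- move=> _ h; exists (fun e => e \in seen); split => [e|e /h[he hs]].
    by rewrite orbF.
  by split => // e' /hs; rewrite orbF.
case/andP=> e0 /IH h hseen; case: h.
  move=> e1; rewrite inE => /predU1P[->|es]; first split => // e' e's.
    by apply: mem_extend; rewrite e's orbT.
  have [e10 hs] := hseen _ es; split => // e' /hs.
  rewrite !inE => /orP[->|/predU1P[->|et]]; rewrite ?eqxx ?orbT //.
  by have := @mem_extend (e :: seen) todo (next_nodes ix G e) e'; rewrite et inE => ->.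
move=> P [hP sP]; exists P; split => // e1.
rewrite inE => h; apply: hP; rewrite inE.
case/or3P: h => [->|->|h]; rewrite ?orbT //.
by have := @mem_extend (e :: seen) todo (next_nodes ix G e) e1; rewrite h inE => ->.
Qed.

End Labelling.

(** * Tilings from tables *)

Section Tables.
Local Open Scope nat_scope.
Variable sz : nat -> nat.
Hypothesis szP : sizing sz.

Definition upper_faces (x : int -> move) (i : int) : seq nat := map sz (x i).1.2.2.

Section Path.
Variables (G : seq move) (x : int -> move).
Hypotheses (playG : playable G) (xG : forall i, linked x G i).

Lemma play_at i : [/\ arrive (x i).1.1 (x i).1.2 = Some (x i).2,
  0 < size (x i).1.2.2, all (fun s => 2 < least s) (x i).1.2.2,
  (size (x i).1.2.2 != 1) || (3 < least (head 0 (x i).1.2.2)) & soon 2 G (x i)].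
Proof.
have [xi _] := xG i.
by have /and5P[/eqP h1 _ h2 h3 /andP[h4 h5]] := allP playG _ xi; split.
Qed.

Lemma soon_rises n i : soon n G (x i) ->
  exists2 j : nat, j <= n & rises (x (i + j%:Z)%R).
Proof.
elim: n i => [|n IH] i /=.
  by case: ifP => // h _; exists 0%N; rewrite ?addr0.
case: ifP => [h _|_ /allP h]; first by exists 0%N; rewrite ?addr0.
have [xi1 _] := xG (i + 1)%R; have [_ xS] := xG i.
have := h _ xi1; rewrite xS eqsE eqxx => /IH[j jn hj]; exists j.+1 => //.
by have -> : (i + j.+1%:Z = i + 1 + j%:Z)%R by lia.
Qed.

Lemma arrived i : [/\ (x i).2 = joint (x i).1.2
    (foldl carry1_least (pending (x i).1.1) (above (x i).1.1 (x i).1.2)),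
  all firm (above (x i).1.1 (x i).1.2), head 0 (x i).1.2.2 = nth 0 (x i).1.1 0 &
  (nth 0 (x i).1.1 3 == 0) || (size (x i).1.2.2 != 1)].
Proof.
have [+ _ _ _ _] := play_at i; rewrite /arrive.
case: (x i).1.1 => [|e [|f [|k [|s p]]]] //.
case: ifP => // /and5P[/eqP h1 _ _ h2 h3] [<-]; split => //.
by rewrite /pending /= drop0.
Qed.

Lemma joined i : (x (i + 1)%R).1.1 = joint (x i).1.2
    (foldl carry1_least (pending (x i).1.1) (above (x i).1.1 (x i).1.2)).
Proof. by have [_ <-] := xG i; have [] := arrived i. Qed.

(** Block [i] belongs to vertex [i + 1] and is collected at the junction before
    it. *)
Lemma block_upper_faces i : block_of (upper_faces x) i =
  map (resize sz) (above (x (i + 1)%R).1.1 (x (i + 1)%R).1.2).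
Proof.
have [_ U0 _ _ _] := play_at (i + 1)%R.
rewrite /block_of /above joined /= /own /upper_faces !size_map size_nseq.
case: eqP => // _ /=; congr (_ :: _).
  congr (_, _); last by case: (size _ == 1).
  by case: (x _).1.2.2 U0.
by rewrite -map_take behead_map -!map_comp.
Qed.

Lemma upper_line_path : upper_line (upper_faces x).
Proof.
move=> i; have [_ U0 U3 U1 _] := play_at i; have [_ U0' _ _ _] := play_at (i + 1)%R.
have [_ _ h1 h2] := arrived (i + 1)%R; rewrite /upper_faces !size_map.
rewrite joined /= in h1 h2; split => //.
- move: U0 U0' h1; case: (x i).1.2.2 => // u U _.
  by case: (x _).1.2.2 => // u' U' _ /= ->; rewrite last_map.
- by move=> e; move: h2; rewrite e /= => /eqP.
- rewrite all_map; apply: sub_all U3 => s /= hs.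
  by have [h _] := szP s; exact: leq_trans h.
- move=> e; move: U1; rewrite e /=; case: (x i).1.2.2 U0 => //= u U _ h.
  by have [h' _] := szP u; exact: leq_trans h'.
Qed.

Lemma rising_path : rising (upper_faces x).
Proof.
have rise1 i : rises (x (i + 1)%R) -> 0 < rise (upper_faces x) i.
  case/hasP => y yx y0; rewrite /rise block_upper_faces -map_comp.
  suff : 0 < top_of (resize sz y).
    elim: (above _ _) yx => //= z s IH; rewrite inE => /predU1P[<-|/IH h] hy.
      by rewrite ltn_addr.
    by rewrite ltn_addl ?h.
  by have [h _] := top_resize szP y; exact: leq_trans h.
have r (j : int) : exists2 n : nat, n <= 2 & 0 < rise (upper_faces x) (j + n%:Z)%R.
  have [_ _ _ _ /soon_rises[n n2 hn]] := play_at (j + 1)%R.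
  by exists n => //; apply: rise1; rewrite addrAC.
move=> i; split; first by have [n _ hn] := r i; exists (i + n%:Z)%R => //; lia.
by have [n n2 hn] := r (i - 2)%R; exists (i - 2 + n%:Z)%R => //; lia.
Qed.

(** The letters along the next line can be labelled by [L] because the search
    followed, along with the path, the set of junctions that a labelling of the
    letters emitted so far can end in. *)
Theorem strip_over_path L : playable L -> tracks G L ->
  exists S D, [/\ is_strip S, bottoms S (upper_faces x), tops S D & labelled sz L D].
Proof.
move=> playL GL.
pose pend i := map sz (pending (x (i + 1)%R).1.1).
have pendS i : pend (i + 1)%R = carry (pend i) (block_of (upper_faces x) i).
  have [_ firm1 _ _] := arrived (i + 1)%R.
  by rewrite /pend block_upper_faces carry_resize // joined /pending /= drop0.
have [S [H [D [[sS bS tS] cH HS DH]]]] :=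
  strip_over_line upper_line_path rising_path pendS.
exists S, D; split => //.
pose J := distinct [seq t.1.1 | t <- L]; pose ix := by_letter J L.
have [|P [P0 PS]] := explore_sound GL; first by [].
have emitted i : exists2 v,
    expands (script (pending (x (i + 1)%R).1.1)
                    (above (x (i + 1)%R).1.1 (x (i + 1)%R).1.2)) v &
    emit (pend i) (block_of (upper_faces x) i) = map (map sz) v.
  rewrite block_upper_faces; apply: emit_script => //.
  by have [] := arrived (i + 1)%R.
have HSn (i0 : int) (n : nat) : (H i0 <= H (i0 + n%:Z))%R.
  by apply: climbs_le => //; lia.
have run (i0 : int) (n : nat) : exists2 R, P ((x (i0 + n%:Z + 1)%R).1.1, R) &
    reached sz L D (H i0) (H (i0 + n%:Z)%R) R.
  elim: n => [|n [R PR hR]].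
    exists (full J); last by rewrite addr0; exact: reached_full.
    apply: P0; apply/orP; right; apply: (map_f (fun x => (x, full J))).
    rewrite mem_distinct; have [xi _] := xG (i0 + 0%:Z + 1)%R.
    exact: (map_f (fun t : move => t.1.1) xi).
  have [v ev eE] := emitted (i0 + n%:Z)%R.
  have sv := HS (i0 + n%:Z)%R; rewrite eE size_map in sv.
  have iS : (i0 + n.+1%:Z = i0 + n%:Z + 1)%R by lia.
  have letters (m : nat) : m < size v ->
      D (H (i0 + n%:Z) + m%:Z)%R = nth [::] (map (map sz) v) m.
    by move=> mv; rewrite DH eE ?size_map.
  have [|R' R'in hR'] := reached_follow playL (Rs := [:: R]) (HSn i0 n) letters ev.
    by exists R; rewrite ?inE.
  exists R'; last by rewrite iS sv.
  have [_ +] := PS _ PR; apply; rewrite iS; have [xG1 <-] := xG (i0 + n%:Z + 1)%R.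
  apply/flatten_mapP; exists (x (i0 + n%:Z + 1)%R).
    by rewrite mem_filter xG1 eqsE eqxx.
  exact: (map_f (fun R => (_, R))).
have [|y yP] := @bi_infinite_choice move (fun=> L)
  (fun i t t' => t.2 = t'.1.1 /\ D i = map sz t.1.2.1); last first.
  by exists y => i; have [h1 [h2 h3]] := yP i.
move=> m; have [_ Hdown Hup] := cH.
have [i0 h0] := Hdown (- m%:Z)%R; have [i1 h1] := Hup (m%:Z + 1)%R.
have le01 : (i0 <= i1)%R.
  by rewrite leNgt; apply/negP => h; have := climbs_le cH (ltW h); lia.
have [R PR hR] := run i0 `|(i1 - i0)%R|%N.
have i1E : (i0 + `|(i1 - i0)%R|%N%:Z = i1)%R by lia.
rewrite i1E in hR; have [R0 _] := PS _ PR.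
have [|y [yl _ _]] := hR (BinNat.N.log2 R).
  by apply: BinNat.N.bit_log2 => e; rewrite e in R0.
by exists y => i hi; have [|[h2 h3] h4] := yl i; first by lia.
Qed.

End Path.

Definition fits (K : seq nat) (T : seq move) : bool :=
  playable T && all (fun t => perm_eq (t.1.2.1 ++ t.1.2.2) K) T.

Definition closes (c : seq move) : bool :=
  cycle (fun t t' => t.2 == t'.1.1) c.

(** From any line labelled by a table of [Ts] one gets to a line labelled by a
    table of [Ts].  The first strip lies over a line along which the cycle [c0]
    repeats for ever; upside down, this line has the upper faces of [c0] as lower
    faces, and the cycle [c1] labels them. *)
Definition certificate (K : seq nat) (Ts : seq (seq move)) (c0 c1 : seq move) : bool :=
  [&& all (fits K) Ts, all (fun T => has (tracks T) Ts) Ts,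
      [&& 0 < size c0, playable c0, closes c0, closes c1 &
          [seq t.1.2.1 | t <- c1] == [seq t.1.2.2 | t <- c0]],
      has (tracks c0) Ts & has (fun T => all (mem T) c1) Ts].

Definition repeat (t0 : move) (c : seq move) (i : int) : move :=
  nth t0 c `|(i %% (size c)%:Z)%Z|%N.

Lemma repeat_linked t0 c T : 0 < size c -> closes c -> {subset c <= T} ->
  forall i, linked (repeat t0 c) T i.
Proof.
move=> c0 cc cT i; rewrite /linked /repeat.
have := ltz_pmod i (_ : (0 < (size c)%:Z)%R).
have := modz_ge0 i (_ : (size c)%:Z != 0%R).
have e : ((i + 1) %% (size c)%:Z)%Z = (((i %% (size c)%:Z)%Z + 1) %% (size c)%:Z)%Z.
  by rewrite modzDml.
rewrite e; move: (i %% _)%Z => {e} r r0 r1.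
have {}r0 : (0 <= r)%R by apply: r0; lia.
have {}r1 : (r < (size c)%:Z)%R by apply: r1; lia.
have -> : ((r + 1) %% (size c)%:Z)%Z = (if (r + 1 < (size c)%:Z)%R then r + 1 else 0)%R.
  case: ifP => h; first by apply: modz_small; lia.
  by rewrite (_ : r + 1 = (size c)%:Z)%R ?modzz //; lia.
case: r r0 r1 => // n _ n1; split; first by apply/cT/mem_nth.
case: c c0 cc cT n1 => // t c _ /pathP cc _; rewrite size_rcons in cc.
move=> n1; have /eqP := cc t0 n n1.
rewrite -rcons_cons nth_rcons /= (_ : n < (size c).+1) // => ->; rewrite nth_rcons.
have [h|h] := ltnP n (size c).
  rewrite ifT; last by lia.
  by have -> : `|(n%:Z + 1)%R|%N = n.+1 by lia.
have nc : n = size c by move: n1 h => /=; lia.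
by rewrite nc eqxx ifF //; lia.
Qed.

Theorem tiling_of_tables (R : realType) (k K : seq nat) Ts c0 c1 :
  2 < size k -> perm_eq (map sz K) k -> certificate K Ts c0 c1 ->
  exists T : polygon_family R,
    [/\ is_tiling T, pseudo_homogeneous T & tiling_has_type T k].
Proof.
move=> k3 Kk /and5P[/allP fitTs /allP nextTs /and5P[s0 play0 cl0 cl1 /eqP c01]].
case/hasP => T0 T0Ts tracks0 /hasP[T1 T1Ts /allP c1T].
have playT T : T \in Ts -> playable T by case/fitTs/andP.
apply: (@tiling_of_growth R k (fun D => exists2 T, T \in Ts & labelled sz T D)) => //.

- move=> D [T TTs [x xP]]; have /hasP[T' T'Ts TT'] := nextTs _ TTs.
  have xT i : linked x T i by have [] := xP i.
  have [S [D' [sS bS tS lD']]] :=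
    strip_over_path (playT _ TTs) xT (playT _ T'Ts) TT'.
  exists (upper_faces x), S, D'; split => //; last by exists T'.
  move=> j; have [[xj _] ->] := xP j.
  have /andP[_ /allP/(_ _ xj) pK] := fitTs _ TTs.
  by rewrite /upper_faces -map_cat; apply: perm_trans Kk; exact: perm_map.
- have t0 : move := ([::], ([::], [::]), [::]).
  have x0 := repeat_linked t0 s0 cl0 (fun _ => id).
  have s01 : size c1 = size c0.
    by move/(congr1 size): c01; rewrite !size_map.
  have [S [D' [sS bS tS lD']]] := strip_over_path play0 x0 (playT _ T0Ts) tracks0.
  exists S, (upper_faces (repeat t0 c0)), D'; split => //; last by exists T0.
  exists T1 => //; exists (repeat t0 c1) => i; split.
    by apply: repeat_linked => //; rewrite s01.
  rewrite /upper_faces; congr map; rewrite /repeat s01.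
  have lt : `|(i %% (size c0)%:Z)%Z|%N < size c0.
    have := ltz_pmod i (_ : (0 < (size c0)%:Z)%R).
    have := modz_ge0 i (_ : (size c0)%:Z != 0%R); lia.
  have := congr1 (fun s => nth [::] s `|(i %% (size c0)%:Z)%Z|%N) c01.
  by rewrite !(nth_map t0) ?s01.
Qed.

End Tables.

(** * Tables for the types with five or six entries *)

Section Instances.
Local Open Scope nat_scope.

Fixpoint arrangements (n : nat) (s : seq nat) : seq (seq nat) :=
  if n is n'.+1 then
    flatten [seq [seq x :: t | t <- arrangements n' (rem x s)] | x <- undup s]
  else [:: [::]].

Definition splits (K : seq nat) : seq word :=
  flatten [seq [seq (take i s, drop i s) | i <- iota 1 3] |
    s <- arrangements (size K) K].

(** Between the end faces of a letter there are only faces without a top side, and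
    these are triangles over an edge; a vertex never sees a triangle only, because
    a triangle has at most one top side.  The words [[:: 3; x; 3]] occur below the
    first strip. *)
Definition plain (w : word) : bool :=
  (w.1 != [:: 3]) && ((all (pred1 3) (behead (take (size w.1).-1 w.1))) ||
   [&& size w.1 == 3, head 0 w.1 == 3 & last 0 w.1 == 3]).

Definition shape (w : word) : seq nat * seq nat :=
  ([seq (s == 3) : nat | s <- w.1], [seq (s == 3) : nat | s <- w.2]).

Fixpoint walk (x : junction) (ws : seq word) : seq move :=
  if ws is w :: ws' then
    if arrive x w is Some y then (x, w, y) :: walk y ws' else [::]
  else [::].

(** The moves of a closed walk through [ws], if [p] has been collected when the walk
    comes back to its start. *)
Definition loop (p : seq nat) (ws : seq word) : seq move :=
  walk (joint (last ([::], [::]) ws) p) ws.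

(** The words [us] repeat along the line under the first strip; [[:: 0]] is a dummy
    for the faces below it.  Upside down, the words [us] are below the line, and
    [us'] are above it. *)
Definition simple_certificate K (rule : word -> bool) p us p' us' : bool :=
  let W := [seq w <- splits K | plain w && rule w] in
  certificate K [:: self_table 9 (distinct [seq w.1 | w <- W]) W]
    (loop p [seq ([:: 0], u) | u <- us]) (loop p' (zip us us')).

(** Restricting the words keeps the search short, and in some cases it is what makes
    the search succeed. *)
Definition any_word (w : word) := true.

Definition three_last (w : word) :=
  (3 \notin w.2) || (last 0 (take (size w.2).-1 w.2) == 3).

Definition wide_edges (w : word) :=
  [&& size w.1 <= 2, head 0 w.2 != 3 & last 0 w.2 != 3].

Lemma certificate_333333 :
  simple_certificate [:: 3; 3; 3; 3; 3; 3] any_word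
    [:: 3] [:: [:: 3; 3; 3]] [:: 3] [:: [:: 3; 3; 3]].
Proof. by vm_compute. Qed.

Lemma certificate_33333a :
  simple_certificate [:: 3; 3; 3; 3; 3; 5] any_word
    [:: 3] [:: [:: 3; 3; 3]; [:: 3; 3; 3]]
    [:: 3] [:: [:: 3; 3; 5]; [:: 5; 3; 3]].
Proof. by vm_compute. Qed.

Lemma certificate_3333ab :
  simple_certificate [:: 3; 3; 3; 3; 5; 6] any_word
    [:: 3] [:: [:: 3; 3; 3]; [:: 3; 3; 3]]
    [:: 3] [:: [:: 5; 3; 6]; [:: 6; 3; 5]].
Proof. by vm_compute. Qed.

Lemma certificate_333abc :
  simple_certificate [:: 3; 3; 3; 5; 6; 7] three_last
    [:: 3] [:: [:: 3; 3; 3]; [:: 3; 3; 3]]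
    [:: 6] [:: [:: 5; 6; 7]; [:: 7; 6; 5]].
Proof. by vm_compute. Qed.

Definition shapes_33abcd := [::
  ([:: 0], [:: 0; 1; 0; 0; 1]); ([:: 0], [:: 0; 1; 0; 1; 0]);
  ([:: 0; 0], [:: 1; 0; 0; 1]); ([:: 0; 0], [:: 1; 0; 1; 0]);
  ([:: 0; 1], [:: 0; 1; 0; 0]); ([:: 0; 1; 0], [:: 1; 0; 0]);
  ([:: 1; 0], [:: 0; 0; 1; 0])].

Lemma certificate_33abcd :
  simple_certificate [:: 3; 3; 5; 6; 7; 8] (fun w => shape w \in shapes_33abcd)
    [:: 6] [:: [:: 5; 6]; [:: 6; 5]]
    [:: 7] [:: [:: 3; 8; 7; 3]; [:: 3; 8; 7; 3]].
Proof. by vm_compute. Qed.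

Lemma certificate_3abcd :
  simple_certificate [:: 3; 5; 13; 14; 15] wide_edges
    [:: 15] [:: [:: 14; 15]; [:: 15; 14]]
    [:: 3] [:: [:: 5; 3; 13]; [:: 13; 3; 5]].
Proof. by vm_compute. Qed.

Lemma certificate_344ab :
  simple_certificate [:: 3; 4; 4; 9; 10] three_last
    [:: 3] [:: [:: 4; 3; 4]; [:: 4; 3; 4]]
    [:: 10] [:: [:: 9; 10]; [:: 10; 9]].
Proof. by vm_compute. Qed.

Lemma certificate_3444a :
  simple_certificate [:: 3; 4; 4; 4; 5] three_last
    [:: 3] [:: [:: 4; 3; 4]; [:: 4; 3; 4]]
    [:: 5] [:: [:: 4; 5]; [:: 5; 4]].
Proof. by vm_compute. Qed.

Definition uncrowded (w : word) : bool := shape w \notin [::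
  ([:: 0], [:: 0; 0; 1; 1]); ([:: 0], [:: 1; 1; 0; 0]);
  ([:: 0; 1], [:: 0; 0; 1]); ([:: 1; 0], [:: 1; 0; 0])].

Lemma certificate_33abc :
  simple_certificate [:: 3; 3; 9; 10; 11] uncrowded
    [:: 11] [:: [:: 3; 9; 3]; [:: 3; 10; 3]; [:: 3; 11; 3]]
    [:: 9] [:: [:: 10; 11]; [:: 11; 9]; [:: 9; 10]].
Proof. by vm_compute. Qed.

Lemma certificate_334ab :
  simple_certificate [:: 3; 3; 4; 9; 10] uncrowded
    [:: 10] [:: [:: 3; 4; 3]; [:: 3; 9; 3]; [:: 3; 10; 3]]
    [:: 4] [:: [:: 9; 10]; [:: 10; 4]; [:: 4; 9]].
Proof. by vm_compute. Qed.

Lemma certificate_3344a :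
  simple_certificate [:: 3; 3; 4; 4; 9] uncrowded
    [:: 9] [:: [:: 3; 4; 3]; [:: 3; 4; 3]; [:: 3; 9; 3]]
    [:: 4] [:: [:: 4; 9]; [:: 9; 4]; [:: 4; 4]].
Proof. by vm_compute. Qed.

Definition shapes_33444 := [::
  ([:: 0], [:: 0; 1; 0; 1]); ([:: 0], [:: 1; 0; 0; 1]); ([:: 0], [:: 1; 0; 1; 0]);
  ([:: 0; 0], [:: 1; 0; 1]);
  ([:: 0; 1], [:: 0; 1; 0]); ([:: 0; 1], [:: 1; 0; 0]);
  ([:: 1; 0], [:: 0; 1; 0]); ([:: 1; 0], [:: 0; 0; 1]);
  ([:: 0; 1; 0], [:: 0; 1]); ([:: 0; 1; 0], [:: 1; 0]);
  ([:: 1; 0; 1], [:: 0; 0])].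

Lemma certificate_33444 :
  simple_certificate [:: 3; 3; 4; 4; 4] (fun w => shape w \in shapes_33444)
    [:: 4] [:: [:: 3; 4; 3]] [:: 4] [:: [:: 4; 4]].
Proof. by vm_compute. Qed.

Definition mirror (W : seq word) : seq word := [seq (rev w.1, rev w.2) | w <- W].

(** Lines labelled by [W] whose next line has letters of [W']. *)
Definition leading_to (W' W : seq word) : seq move := table [seq w.1 | w <- W'] W.

(** Lines labelled by these words and by their mirror images alternate. *)
Definition words_333ab : seq word := [::
  ([:: 3; 3; 6], [:: 5; 3]); ([:: 6], [:: 3; 3; 5; 3]); ([:: 6; 3], [:: 3; 3; 5]);
  ([:: 3; 3; 5], [:: 6; 3]); ([:: 5], [:: 3; 3; 6; 3]); ([:: 5; 3], [:: 3; 3; 6])].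

Lemma certificate_333ab :
  let W := words_333ab in let us := [:: [:: 3; 5]; [:: 5; 3; 3]] in
  certificate [:: 3; 3; 3; 5; 6]
    [:: leading_to (mirror W) W; leading_to W (mirror W)]
    (loop [:: 3] [seq ([:: 0], u) | u <- us])
    (loop [:: 3; 3] (zip us [:: [:: 6; 3; 3]; [:: 3; 6]])).
Proof. by vm_compute. Qed.

(** With four triangles at each vertex there is hardly any freedom: lines of the
    first and of the second kind alternate upwards from the first strip, and their
    mirror images do so downwards. *)
Definition words_3333a : seq word := [::
  ([:: 3; 3; 12], [:: 3; 3]); ([:: 12], [:: 3; 3; 3; 3]); ([:: 12; 3], [:: 3; 3; 3])].

Definition words_3333a' : seq word := [::
  ([:: 3; 3], [:: 12; 3; 3]); ([:: 3; 3; 3], [:: 3; 12]); ([:: 3; 3; 3; 3], [:: 12])].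

Lemma certificate_3333a :
  let W := words_3333a in let W' := words_3333a' in
  let us := [:: [:: 3; 12]; [:: 12]; [:: 12; 3; 3]] in
  certificate [:: 3; 3; 3; 3; 12]
    [:: leading_to W' W; leading_to W W';
        leading_to (mirror W') (mirror W); leading_to (mirror W) (mirror W')]
    (loop [:: 3] [seq ([:: 0], u) | u <- us])
    (loop [:: 3; 3] (zip us [:: [:: 3; 3; 3]; [:: 3; 3; 3; 3]; [:: 3; 3]])).
Proof. by vm_compute. Qed.

End Instances.

(** * Greedy choices *)

Section Multisets.
Local Open Scope nat_scope.
Implicit Types (x y : nat) (k s t r : seq nat).

Definition mult x s : nat := count_mem x s.
Definition wide s : nat := count (predC1 3) s.
Arguments mult : simpl never.
Arguments wide : simpl never.

Lemma mult_nil x : mult x [::] = 0. Proof. by []. Qed.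
Lemma mult_cons x y s : mult x (y :: s) = (y == x) + mult x s. Proof. by []. Qed.
Lemma mult_cat x s t : mult x (s ++ t) = mult x s + mult x t.
Proof. exact: count_cat. Qed.
Lemma mult_rcons x s y : mult x (rcons s y) = mult x s + (y == x).
Proof. by rewrite -cats1 mult_cat mult_cons mult_nil addn0. Qed.
Definition multE := (mult_nil, mult_cons, mult_cat, mult_rcons).

Lemma wide_nil : wide [::] = 0. Proof. by []. Qed.
Lemma wide_cons y s : wide (y :: s) = (y != 3) + wide s. Proof. by []. Qed.
Lemma wide_cat s t : wide (s ++ t) = wide s + wide t.
Proof. exact: count_cat. Qed.
Lemma wide_rcons s y : wide (rcons s y) = wide s + (y != 3).
Proof. by rewrite -cats1 wide_cat wide_cons wide_nil addn0. Qed.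
Definition wideE := (wide_nil, wide_cons, wide_cat, wide_rcons).

Lemma wide_mult3 s : wide s + mult 3 s = size s.
Proof. by rewrite addnC; exact: (count_predC (pred1 3)). Qed.

Lemma mult_gt0 x s : (0 < mult x s) = (x \in s).
Proof. by rewrite -has_count has_pred1. Qed.

Lemma perm_mult s t x : perm_eq s t -> mult x s = mult x t.
Proof. by move=> /permP/(_ (pred1 x)). Qed.

Lemma wide_le s t : (forall x, x != 3 -> mult x s <= mult x t) -> wide s <= wide t.
Proof.
move=> st; rewrite /wide -!size_filter.
have /count_subseqP[u ut /perm_size ->] :
    forall x, count_mem x [seq y <- s | y != 3] <= count_mem x [seq y <- t | y != 3].
  move=> x; rewrite !count_filter; have [->|px] := eqVneq x 3.
    rewrite (eq_count (a2 := pred0)) ?count_pred0 // => y /=.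
    by rewrite andbN.
  have e : predI (pred1 x) (fun y => y != 3) =1 pred1 x.
    by move=> y /=; case: eqP => // ->; rewrite px.
  by rewrite !(eq_count e); exact: st.
exact: size_subseq.
Qed.

Definition within k s : Prop := forall x, mult x s <= mult x k.

Lemma within_rest k s : within k s -> exists r, perm_eq (s ++ r) k.
Proof.
elim: s k => [|x s IH] k sk; first by exists k.
have xk : x \in k by rewrite -mult_gt0; have := sk x; rewrite multE eqxx; lia.
have kE : perm_eq (x :: rem x k) k by rewrite perm_sym perm_to_rem.
have [|r rP] := IH (rem x k).
  by move=> y; have := sk y; have := perm_mult y kE; rewrite !multE; lia.
by exists r; apply: perm_trans kE; rewrite perm_cons.
Qed.

Lemma within_sub k s t : within k t -> (forall x, mult x s <= mult x t) -> within k s.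
Proof. by move=> kt st x; exact: leq_trans (st x) (kt x). Qed.

Lemma within_mem k s x : within k s -> x \in s -> x \in k.
Proof. by move=> ks; rewrite -!mult_gt0 => h; exact: leq_trans (ks x). Qed.

Lemma within_cons k s x : within k s -> mult x s < mult x k -> within k (x :: s).
Proof.
by move=> ks xs y; have := ks y; rewrite multE; case: (eqVneq x y) xs => [->|_]; lia.
Qed.

End Multisets.
Arguments mult : simpl never.
Arguments wide : simpl never.

(** The stretches are chosen from left to right, each from its own start. *)
Lemma greedy_choice (X : eqType) (cand : int -> seq X) (P : int -> X -> Prop)
    (ok : int -> X -> X -> Prop) :
  (forall i x, P i x -> x \in cand i) -> (forall i, exists x, P i x) ->
  (forall i x, P i x -> exists2 y, P (i + 1) y & ok i x y) ->
  exists f : int -> X, forall i, P i (f i) /\ ok i (f i) (f (i + 1)).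
Proof.
move=> Pcand start step.
have [|f fP] := @bi_infinite_choice X cand (fun i x y => P i x /\ ok i x y).
  move=> m.
  have [next nextP] : {g : int -> X -> X | forall i x, P i x ->
      P (i + 1) (g i x) /\ ok i x (g i x)}.
    have [|g gP] := boolp.choice (P := fun (ix : int * X) y => P ix.1 ix.2 ->
        P (ix.1 + 1) y /\ ok ix.1 ix.2 y).
      move=> [i x]; case: (pselect (P i x)) => [Px|nP]; last by exists x.
      by have [y h1 h2] := step _ _ Px; exists y.
    by exists (fun i x => g (i, x)) => i x; exact: (gP (i, x)).
  have [x0 Px0] := start (- m%:Z).
  pose fix run (n : nat) : X :=
    if n is n'.+1 then next (- m%:Z + n'%:Z) (run n') else x0.
  have runP n : P (- m%:Z + n%:Z) (run n).
    elim: n => [|n IH]; first by rewrite addr0.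
    have -> : - m%:Z + n.+1%:Z = - m%:Z + n%:Z + 1 by lia.
    by have [] := nextP _ _ IH.
  exists (fun i => run `|(i + m%:Z)%R|%N) => i hi.
  have iE : i = - m%:Z + `|(i + m%:Z)%R|%N%:Z by lia.
  have -> : `|(i + 1 + m%:Z)%R|%N = `|(i + m%:Z)%R|%N.+1 by lia.
  have Pr := runP `|(i + m%:Z)%R|%N; rewrite -iE in Pr.
  split; [exact: Pcand|split => //=]; rewrite -iE.
  by have [] := nextP _ _ Pr.
by exists f => i; have [_ ?] := fP i.
Qed.

Section Crowns.
Local Open Scope nat_scope.

(** The lower faces along the next line that come from the faces [vs] touching the
    line at one vertex, after the face [y]. *)
Fixpoint fan (y : nat) (vs : seq nat) : seq (seq nat) :=
  if vs is v :: vs' then [:: y; v] :: nseq (v - 3) [:: v] ++ fan v vs' else [::].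

Lemma emit_fan y vs : all (leq 3) vs ->
  emit [:: y] [seq (v, 0) | v <- vs] = fan y vs /\
  carry [:: y] [seq (v, 0) | v <- vs] = [:: last y vs].
Proof.
elim: vs y => //= v vs IH y /andP[v3 /IH{}IH]; have [h1 h2] := IH v.
have vE : top_of (v, 0) = (v - 3).+1 by rewrite /top_of /=; lia.
by rewrite /carry1 vE h1; split => //; exact: h2.
Qed.

(** What the faces above a vertex emit: [x] is the face before the left edge,
    [l] the face over this edge, and [vs] are the faces at the vertex. *)
Definition crown (x l : nat) (vs : seq nat) : seq (seq nat) :=
  if l == 3 then
    if vs is v :: vs' then [:: x; 3; v] :: nseq (v - 3) [:: v] ++ fan v vs'
    else [::]
  else [:: x; l] :: nseq (l - 4) [:: l] ++ fan l vs.

Lemma emit_crown x u0 l vs e : size u0 != 1 -> 3 <= l -> (vs != [::]) || (l != 3) ->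
  all (leq 3) vs ->
  emit [:: x] (own u0 (l :: rcons vs e)) = crown x l vs /\
  carry [:: x] (own u0 (l :: rcons vs e)) = [:: last l vs].
Proof.
move=> u01 l3 vs0 vs3; rewrite /own -rcons_cons size_rcons (negbTE u01).
rewrite -cats1 take_size_cat //=.
rewrite /crown; case: (eqVneq l 3) vs0 => [->|l4] /= vs0.
  case: vs vs0 vs3 => //= v vs _ /andP[v3 vs3].
  have vE : top_of (v, 0) = (v - 3).+1 by rewrite /top_of /=; lia.
  by rewrite /carry1 vE; have [-> h] := emit_fan v vs3; split => //; exact: h.
have lE : top_of (l, 1) = (l - 4).+1 by rewrite /top_of /=; lia.
by rewrite /carry1 lE; have [-> h] := emit_fan l vs3; split => //; exact: h.
Qed.

Lemma crown_cons x l vs : (vs != [::]) || (l != 3) ->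
  crown x l vs = head [::] (crown x l vs) :: behead (crown x l vs).
Proof. by rewrite /crown; case: (eqVneq l 3) => // _; case: vs. Qed.

(** Consecutive letters of the next line are consecutive in what one vertex emits,
    or they are the last letter of one vertex and the first of the next. *)
Theorem strip_over_crowns (l : int -> nat) (vs : int -> seq nat) :
  (forall i, ((vs i != [::]) || (l i != 3)) /\ all (leq 3) (l i :: vs i)) ->
  let E i := crown (last (l i) (vs i)) (l (i + 1)%R) (vs (i + 1)%R) in
  exists S D, [/\ is_strip S, bottoms S (fun i => l i :: rcons (vs i) (l (i + 1)%R)),
    tops S D & forall j, exists i n, let F := rcons (E i) (head [::] (E (i + 1)%R)) in
    [/\ n.+1 < size F, D j = nth [::] F n & D (j + 1)%R = nth [::] F n.+1]].
Proof.
move=> vsP E; pose U i := l i :: rcons (vs i) (l (i + 1)%R).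
have sU i : 1 < size (U i) by rewrite /U /= size_rcons.
have lineU : upper_line U.
  move=> i; have [_ h1] := vsP i; have [_ h2] := vsP (i + 1)%R.
  have := sU i; have := sU (i + 1)%R; split => //; try by lia.
  - by rewrite /U /= last_rcons.
  - by move: h1 h2; rewrite /= all_rcons => /andP[-> ->] /andP[-> _].
have emitU i : emit [:: last (l i) (vs i)] (block_of U i) = E i /\
    carry [:: last (l i) (vs i)] (block_of U i) = [:: last (l (i + 1)%R) (vs (i + 1)%R)].
  have [h0 /andP[h1 h2]] := vsP (i + 1)%R; have := sU i => sUi.
  by apply: emit_crown => //; lia.
have E0 i : 0 < size (E i).
  by have [h _] := vsP (i + 1)%R; rewrite /E crown_cons.
have risingU : rising U.
  have r i : 0 < rise U i.
    by have := E0 i; have [<- _] := emitU i; rewrite size_emit.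
  by move=> i; split; exists i.
have [i|S [H [D [[sS bS tS] cH HS DH]]]] :=
    @strip_over_line U (fun i => [:: last (l i) (vs i)]) lineU risingU _.
  by have [_ ->] := emitU i.
exists S, D; split => // j.
have [i /andP[ij ji]] := climbs_locate j cH; rewrite HS in ji.
have [eE _] := emitU i; rewrite eE in ji.
pose n := `|(j - H i)%R|%N; have jE : (j = H i + n%:Z)%R by rewrite /n; lia.
have nE : n < size (E i) by rewrite /n; lia.
exists i, n; split; first by rewrite size_rcons ltnS.
  by rewrite jE DH eE // nth_rcons nE.
have j1E : (j + 1 = H i + n.+1%:Z)%R by rewrite jE; lia.
rewrite nth_rcons; have [h|h] := ltnP n.+1 (size (E i)).
  by rewrite j1E DH eE.
have nS : n.+1 = size (E i) by lia.
have -> : (j + 1 = H (i + 1)%R + 0%:Z)%R by rewrite HS eE j1E nS addr0.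
have [eE' _] := emitU (i + 1)%R.
by rewrite DH eE' ?E0 // nth0 -nS eqxx.
Qed.

End Crowns.

(** * Types with many entries other than 3 *)

Section ManyWideFaces.
Local Open Scope nat_scope.
Variable k : seq nat.

(** There is room for two edge faces other than triangles and for another face
    above a vertex with the lower faces [c]; the last clause saves a triangle among
    the upper faces. *)
Definition roomy (c : seq nat) : Prop :=
  [/\ within k c, size c + 3 <= size k, wide c + 1 < wide k &
      wide k = 4 -> mult 3 c < 3].

(** Whatever the face [l] over the edge on the left is, there is a face for the edge
    between the vertices with lower faces [c] and [c']. *)
Definition extendable (c c' : seq nat) : Prop :=
  forall l : nat, l != 3 -> within k (l :: c) ->
  exists e : nat, [/\ e != 3, within k [:: e, l & c] & within k (e :: c')].

Lemma spare_wide (s : seq nat) : wide s < wide k ->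
  exists2 e : nat, e != 3 & mult e s < mult e k.
Proof.
move=> sk; case: (pselect (exists2 e : nat, e != 3 & mult e s < mult e k)) => // no.
suff : wide k <= wide s by rewrite leqNgt sk.
apply: wide_le => x x3; rewrite leqNgt; apply/negP => h.
by apply: no; exists x.
Qed.

(** The values forbidden for the new face are [l] and those used up in [c] or in
    [c'], fewer than there are. *)
Lemma extendableI (c c' t : seq nat) : wide c + wide t + 1 < wide k -> within k c' ->
  (forall e : nat, mult e c' <= mult e (c ++ t)) -> extendable c c'.
Proof.
move=> ck kc' c't l l3 klc.
have [|e e3 he] := @spare_wide (l :: c ++ t); first by rewrite !wideE l3; lia.
rewrite !multE in he; exists e; split => //; apply: within_cons => //.
  by rewrite multE; lia.
by have := c't e; rewrite multE; lia.
Qed.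

(** Neighbouring vertices share a lower face, which counts only once among the
    forbidden ones. *)
Definition flows (c c' : seq nat) : bool :=
  [&& last 0 c == head 0 c', c != [::], c' != [::] & wide c + wide (behead c') + 1 < wide k].

Lemma flows_extendable (c c' : seq nat) : within k c' -> flows c c' -> extendable c c'.
Proof.
move=> kc' /and4P[/eqP cc' c0 c'0 h]; apply: extendableI h kc' _ => e.
case: c' cc' c'0 => //= y c' <- _; rewrite !multE.
case/lastP: c c0 => // c z _; rewrite last_rcons !multE; lia.
Qed.

Lemma fan_letter (y : nat) (vs c : seq nat) : c \in fan y vs ->
  size c <= 2 /\ forall x : nat, mult x c <= mult x (y :: vs).
Proof.
elim: vs y => //= v vs IH y; rewrite inE mem_cat mem_nseq.
case/or3P => [/eqP->|/andP[_ /eqP->]|/IH[c2 h]].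
- by split => // x; rewrite !multE; lia.
- by split => // x; rewrite !multE; lia.
- by split => // x; have := h x; rewrite !multE; lia.
Qed.

Lemma crown_letter (x l : nat) (vs c : seq nat) : l != 3 -> c \in crown x l vs ->
  c = [:: x; l] \/ size c <= 2 /\ forall z : nat, mult z c <= mult z (l :: vs).
Proof.
move=> l3; rewrite /crown (negbTE l3) inE mem_cat mem_nseq.
case/or3P => [/eqP->|/andP[_ /eqP->]|/fan_letter h]; [by left|right|by right].
by split => // z; rewrite !multE; lia.
Qed.

Hypothesis many : (4 < wide k) || (wide k == 4) && (mult 3 k == 3).

Lemma short_roomy (c : seq nat) : within k c -> size c <= 2 -> roomy c.
Proof.
by move=> kc c2; have := wide_mult3 k; have := wide_mult3 c; split => //; lia.
Qed.

Lemma wide4 : 4 <= wide k.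
Proof. by move: many; lia. Qed.

Lemma nseq_path (m v : nat) s : path flows [:: v] s -> path flows [:: v] (nseq m [:: v] ++ s).
Proof.
move=> h; elim: m => //= m ->; rewrite andbT /flows /= eqxx !wideE.
by have := wide4; lia.
Qed.

Lemma fan_path (c : seq nat) (y : nat) (vs : seq nat) (e : nat) :
  last 0 c = y -> c != [::] -> wide c + 2 < wide k ->
  all (leq 3) vs -> path flows c (rcons (fan y vs) [:: last y vs; e]).
Proof.
elim: vs c y => [|v vs IH] c y cy c0 ck /=.
  by move=> _; rewrite /flows cy eqxx c0 /= !wideE; lia.
case/andP=> v3 vs3; rewrite {1}/flows cy eqxx c0 /= !wideE; apply/andP; split; first by lia.
rewrite rcons_cat; case: (posnP (v - 3)) => [e0|v4].
  rewrite e0 /=; apply: IH => //=; have -> : v = 3 by lia.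
  by have := wide4; rewrite !wideE; lia.
rewrite -(prednK v4) /= {1}/flows /= eqxx !wideE; apply/andP; split.
  by have := wide4; lia.
by apply/nseq_path/IH => //=; have := wide4; rewrite !wideE; lia.
Qed.

(** With four entries other than 3 one must avoid two vertices [[:: a; f]] and
    [[:: f; b]] without triangles in a row.  They could come only from a square over
    an edge; but the face before this square is a triangle. *)
Lemma crown_path (x l : nat) (vs : seq nat) (e : nat) : l != 3 -> 3 <= l -> (wide k = 4 -> x = 3) ->
  all (leq 3) vs -> sorted flows (rcons (crown x l vs) [:: last l vs; e]).
Proof.
move=> l3 l4 x3 vs3; rewrite /crown (negbTE l3) /= rcons_cat.
have w4 := wide4; have w5 : (x != 3) + 4 <= wide k.
  have [_|xn] := eqVneq x 3; first by lia.
  have : wide k != 4 by apply: contra_neq xn.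
  by lia.
case: (posnP (l - 4)) => [e0|l5].
  by rewrite e0 /=; apply: fan_path => //=; rewrite !wideE l3; lia.
rewrite -(prednK l5) /= {1}/flows /= eqxx !wideE l3; apply/andP; split; first by lia.
by apply/nseq_path/fan_path => //=; rewrite !wideE l3; lia.
Qed.

Hypothesis k3 : all (leq 3) k.

Definition good (D : int -> seq nat) : Prop :=
  forall j, roomy (D j) /\ extendable (D j) (D (j + 1)%R).

Lemma good_over_crowns (l : int -> nat) (vs : int -> seq nat) :
  (forall i, [/\ l i != 3, within k (l i :: vs i),
     within k [:: last (l i) (vs i); l (i + 1)%R] &
     wide k = 4 -> last (l i) (vs i) = 3]) ->
  exists S D, [/\ is_strip S, bottoms S (fun i => l i :: rcons (vs i) (l (i + 1)%R)),
    tops S D & good D].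
Proof.
move=> h.
have all3 s : within k s -> all (leq 3) s.
  by move=> ks; apply/allP => x /(within_mem ks)/(allP k3).
have [|S [D [sS bS tS DP]]] := @strip_over_crowns l vs.
  by move=> i; have [-> /all3 -> _ _] := h i; rewrite orbT.
exists S, D; split => // j; have [i [n [nF Dj Dj1]]] := DP j.
set F := rcons _ _ in nF Dj Dj1.
have [l3 klv kvl n4] := h i; have [l3' klv' kvl' n4'] := h (i + 1)%R.
have zE : head [::] (crown (last (l (i + 1)%R) (vs (i + 1)%R)) (l (i + 1 + 1)%R)
    (vs (i + 1 + 1)%R)) = [:: last (l (i + 1)%R) (vs (i + 1)%R); l (i + 1 + 1)%R].
  by have [l3'' _ _ _] := h (i + 1 + 1)%R; rewrite /crown (negbTE l3'').
have letter c : c \in F -> within k c /\ size c <= 2.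
  rewrite mem_rcons inE => /predU1P[->|]; first by rewrite zE.
  case/(crown_letter l3') => [-> //|[c2 hc]]; split => //.
  exact: within_sub hc.
have kj m : m < size F -> within k (nth [::] F m) /\ size (nth [::] F m) <= 2.
  by move=> mF; apply: letter; apply: mem_nth.
have [k1 s1] := kj n (ltnW nF); have [k2 s2] := kj n.+1 nF.
rewrite Dj Dj1; split; first exact: short_roomy.
apply: flows_extendable => //.
have : sorted flows F.
  rewrite /F zE; apply: crown_path => //; first by have /andP[] := all3 _ klv'.
  by have /andP[] := all3 _ klv'.
by move/(sortedP [::]); apply.
Qed.

(** The faces over the edges are chosen from left to right, all of them other than
    triangles; at each vertex the remaining faces come in between, with a triangle
    last if there is one. *)
Lemma good_grows D : good D -> exists U S D',
  [/\ is_strip S, forall j, perm_eq (D j ++ U j) k, bottoms S U, tops S D' & good D'].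
Proof.
move=> gD.
pose fan_of i (u : seq nat) (lv : nat * seq nat) :=
  exists e, [/\ u = lv.1 :: rcons lv.2 e, lv.1 != 3, e != 3,
    wide k = 4 -> last lv.1 lv.2 = 3 & within k (e :: D (i + 1)%R)].
pose P i u := perm_eq (D i ++ u) k /\ exists lv, fan_of i u lv.
have grow i l : l != 3 -> within k (l :: D i) -> exists2 u, P i u & head 0 u = l.
  move=> l3 klD; have [_ /(_ _ l3 klD)[e [e3 kelD keD]]] := gD i.
  have [r rk] := within_rest kelD; have [[_ szD _ n4] _] := gD i.
  have szr : 0 < size r by have := perm_size rk; rewrite size_cat /=; lia.
  pose vs := if 3 \in r then rcons (rem 3 r) 3 else r.
  have vsr : perm_eq vs r.
    rewrite /vs; case: ifP => // r3; rewrite perm_rcons perm_sym; exact: perm_to_rem.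
  exists (l :: rcons vs e) => //; split.
    apply: perm_trans rk; apply/permP => p; rewrite /= !count_cat /= -cats1 count_cat.
    by rewrite (permP vsr p) /=; lia.
  exists (l, vs), e; split => //= k4; rewrite /vs ifT ?last_rcons //.
  have m3 : mult 3 k = 3 by move: many; rewrite k4 => /andP[_ /eqP].
  have := perm_mult 3 rk; rewrite m3 !multE (negbTE e3) (negbTE l3).
  by rewrite -mult_gt0; have := n4 k4; lia.
have [|||f fP] := @greedy_choice (seq nat)
    (fun i => [seq drop (size (D i)) s | s <- permutations k]) P
    (fun i u u' => last 0 u = head 0 u').
- move=> i u [pu _]; apply/mapP; exists (D i ++ u); first by rewrite mem_permutations.
  by rewrite drop_size_cat.
- move=> i; have [[kD _ wD _] _] := gD i.
  have [|l l3 lD] := @spare_wide (D i); first by lia.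
  by have [|u Pu _] := grow i l l3; [exact: within_cons|exists u].
- move=> i u [_ [lv [e [-> _ e3 _ keD]]]].
  have [u' Pu' hu'] := grow (i + 1)%R e e3 keD.
  by exists u' => //; rewrite hu' /= last_rcons.
have [lv lvP] := boolp.choice (fun i => (fP i).1.2).
have lS i : f i = (lv i).1 :: rcons (lv i).2 (lv (i + 1)%R).1.
  have [e [fE _ _ _ _]] := lvP i; have [e' [fE' _ _ _ _]] := lvP (i + 1)%R.
  by have [_] := fP i; rewrite fE' fE /= last_rcons => ->.
have kf i : within k (f i).
  by have [[pf _] _] := fP i => x; rewrite -(perm_mult x pf) multE; lia.
have [i|S [D' [sS bS tS gD']]] := @good_over_crowns (fun i => (lv i).1) (fun i => (lv i).2).
  have [e [_ l3 _ n4 _]] := lvP i; split => //.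
    by apply: within_sub (kf i) _ => x; rewrite lS !multE; lia.
  apply: within_sub (kf i) _ => x; rewrite lS !multE.
  case: (lv i).2 => [|v vs]; first by rewrite /= !multE; lia.
  by have := congr1 (mult x) (lastI v vs); rewrite /= !multE; lia.
exists f, S, D'; split => //; first by move=> j; have [[]] := fP j.
by move=> j; have := bS j; rewrite lS.
Qed.

End ManyWideFaces.

Definition alternate (T : Type) (a b : T) (i : int) : T := if odd `|i|%N then a else b.

Lemma alternateS (T : Type) (a b : T) (i : int) : alternate a b (i + 1) = alternate b a i.
Proof.
rewrite /alternate; have -> : odd `|(i + 1)%R|%N = ~~ odd `|i|%N by lia.
by rewrite if_neg.
Qed.

(** In the first strip two sizes alternate over the edges, with a triangle between
    them in the tight case. *)
Theorem tiling_of_many_wide (R : realType) (k : seq nat) : all (leq 3) k ->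
  (4 < wide k)%N ||
    (wide k == 4%N) && (mult 3%N k == 3%N) ->
  exists T : polygon_family R,
    [/\ is_tiling T, pseudo_homogeneous T & tiling_has_type T k].
Proof.
move=> k3 many; have w4 : (4 <= wide k)%N by lia.
apply: (@tiling_of_growth R k (good k)).
- by have := wide_mult3 k; lia.
- exact: good_grows.
have [|a a3 ka] := @spare_wide k [::]; first by rewrite wide_nil; lia.
have [|b b3 kb] := @spare_wide k [:: a]; first by rewrite !wideE; lia.
pose w := if wide k == 4%N then [:: 3%N] else [::].
have kabw : within k [:: a, b & w].
  have kab : within k [:: b; a] by apply: within_cons => //; apply: within_cons.
  move=> x; have := kab x; rewrite /w !multE; case: ifP => [/eqP e4|_]; rewrite !multE.
    have m3 : mult 3%N k = 3%N by move: many; rewrite e4 => /andP[_ /eqP].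
    case: (eqVneq 3%N x) => [<-|_]; last by lia.
    by rewrite (negbTE a3) (negbTE b3) m3.
  by lia.
have [ww wm] : wide w = 0%N /\ (mult 3%N w < 3)%N by rewrite /w; case: ifP.
have wlast x y : (wide k = 4%N -> last x w = 3%N) /\
    (forall z, mult z [:: last x w; y] <= mult z [:: x, y & w])%N.
  rewrite /w; case: eqP => // _; split => // z; rewrite /= !multE; lia.
have kal x y : within k [:: x, y & w] -> x != 3%N -> y != 3%N ->
    [/\ roomy k (x :: rcons w y), extendable k (x :: rcons w y) (y :: rcons w x),
        within k (x :: w) & within k [:: last x w; y]].
  move=> kxy x3 y3; have wxy : wide (x :: rcons w y) = 2%N by rewrite !wideE x3 y3 ww.
  have sz : (size w + 5 <= size k)%N.
    by have := wide_mult3 k; move: many; rewrite /w; case: eqP => /= e; lia.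
  have kxwy : within k (x :: rcons w y).
    by apply: within_sub kxy _ => z; rewrite !multE; lia.
  split.
  - split => //; first by rewrite /= size_rcons; lia.
      by rewrite wxy; lia.
    by move=> _; rewrite !multE (negbTE x3) (negbTE y3); lia.
  - apply: (extendableI (t := [::])); first by rewrite wxy wide_nil; lia.
      by apply: within_sub kxy _ => z; rewrite !multE; lia.
    by move=> z; rewrite cats0 !multE; lia.
  - by apply: within_sub kxy _ => z; rewrite !multE; lia.
  - by apply: within_sub kxy _ => z; have [_] := wlast x y; apply.
have kba : within k [:: b, a & w] by apply: within_sub kabw _ => z; rewrite !multE; lia.
have [r1 e1 w1 l1] := kal _ _ kabw a3 b3; have [r2 e2 w2 l2] := kal _ _ kba b3 a3.
have [i|S [D' [sS bS tS gD']]] := @good_over_crowns k many k3 (alternate a b) (fun=> w).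
  rewrite alternateS /alternate; case: ifP => _; split => //.
    by have [] := wlast a b.
  by have [] := wlast b a.
exists S, (fun i => alternate a b i :: rcons w (alternate a b (i + 1))), D'; split => //.
by move=> j; rewrite !alternateS /alternate; case: ifP.
Qed.

(** * Types with many triangles *)

Section ManyTriangles.
Local Open Scope nat_scope.
Variable k : seq nat.
Hypothesis k7 : 7 <= size k.
Hypothesis k33 : 4 <= mult 3 k.

(** Two triangles are left for the edges on both sides of the vertex. *)
Definition frugal (c : seq nat) : Prop :=
  [/\ within k c, size c <= 3, mult 3 c + 2 <= mult 3 k & size c = 3 -> 3 \in c].

Lemma mult_size (x : nat) (s : seq nat) : mult x s <= size s.
Proof. exact: count_size. Qed.

Lemma short_frugal (c : seq nat) : within k c -> size c <= 2 -> frugal c.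
Proof. by move=> kc c2; have := mult_size 3 c; split => //; lia. Qed.

(** All edges carry triangles, so that the last face [x] of a vertex, the triangle
    and the first face [y] of the next vertex are the lower faces of one vertex, and
    [y] must be chosen accordingly.  Any [y] other than [x] will do.  If all the
    faces to choose from are equal to [x], they are at least two, which leaves
    enough copies of [x] in [k]. *)
Lemma next_face (D : seq nat) (x : nat) : frugal D -> x \in k ->
  exists2 vs, vs != [::] /\ perm_eq (D ++ 3 :: rcons vs 3) k &
    frugal [:: x; 3; head 3 vs].
Proof.
move=> [kD D3 D33 D333]; rewrite -mult_gt0 => xk.
have k33D : within k [:: 3, 3 & D].
  by move=> z; have := kD z; rewrite !multE; case: (eqVneq 3 z) => [<-|_]; lia.
have [r rk] := within_rest k33D.
have szr : size k = 2 + size D + size r by rewrite -(perm_size rk) size_cat.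
have rm z : mult z k = (3 == z) + (3 == z) + mult z D + mult z r.
  by rewrite -(perm_mult z rk) !multE; lia.
suff [y yr xy] : exists2 y, y \in r & frugal [:: x; 3; y].
  have yP : perm_eq (y :: rem y r) r by rewrite perm_sym perm_to_rem.
  exists (y :: rem y r) => //; split => //; apply: perm_trans rk.
  apply/permP => p; rewrite !count_cat /= -cats1 count_cat /=.
  by have := permP yP p => /=; lia.
have triple y : (forall z, (x == z) + (3 == z) + (y == z) <= mult z k) ->
    (x == 3) + (y == 3) + 3 <= mult 3 k -> frugal [:: x; 3; y].
  move=> h1 h2; split => //; last by rewrite !inE orbT.
  - by move=> z; have := h1 z; rewrite !multE; lia.
  - by rewrite !multE; lia.
have [/hasP[y yr /= yx]|/hasPn all_x] := boolP (has (predC1 x) r).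
  exists y => //; have yk : 0 < mult y r by rewrite mult_gt0.
  apply: triple => [z|]; last by lia.
  case: (eqVneq x z) yx => [<-|xz] yx; first by have := rm x; lia.
  have := rm z; case: (eqVneq 3 z) => [<-|z3]; first by lia.
  by case: (eqVneq y z) yk => [->|_]; lia.
have rx : mult x r = size r.
  apply/eqP; rewrite /mult -all_count; apply/allP => y /all_x /=.
  by rewrite negbK.
have xr : x \in r by rewrite -mult_gt0 rx; lia.
exists x => //; have [x3|x3] := eqVneq x 3; last first.
  apply: triple => [z|]; last by lia.
  case: (eqVneq x z) => [<-|xz]; first by have := rm x; lia.
  by case: (eqVneq 3 z) => [<-|_]; lia.
have rm3 := rm 3; rewrite x3 in rx; rewrite rx /= in rm3.
(* Otherwise all four triangles are above, and the three lower faces contain one. *)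
have five : 5 <= mult 3 k.
  rewrite ltnNge; apply/negP => h; have D30 : mult 3 D = 0 by lia.
  have /D333 : size D = 3 by lia.
  by rewrite -mult_gt0 D30.
apply: triple => [z|]; last by lia.
by rewrite x3; case: (eqVneq 3 z) => [<-|_]; lia.
Qed.

Definition thrifty (D : int -> seq nat) : Prop := forall j, frugal (D j).

Hypothesis k3 : all (leq 3) k.

Lemma thrifty_over_crowns (l : int -> nat) (vs : int -> seq nat) :
  (forall i, [/\ (vs i != [::]) || (l i != 3), within k (l i :: vs i) &
    frugal (if l (i + 1)%R == 3 then [:: last (l i) (vs i); 3; head 3 (vs (i + 1)%R)]
            else [:: last (l i) (vs i); l (i + 1)%R])]) ->
  exists S D, [/\ is_strip S, bottoms S (fun i => l i :: rcons (vs i) (l (i + 1)%R)),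
    tops S D & thrifty D].
Proof.
move=> h.
have [|S [D [sS bS tS DP]]] := @strip_over_crowns l vs.
  move=> i; have [h1 h2 _] := h i; split => //.
  by apply/allP => x /(within_mem h2)/(allP k3).
exists S, D; split => // j; have [i [n [+ -> _]]] := DP j.
rewrite size_rcons ltnS nth_rcons => nE; rewrite nE.
move: (nth _ _ _) (mem_nth [::] nE) => c {n nE}.
have [_ _ hi] := h i; have [v0 kv _] := h (i + 1)%R.
have short y ws : c \in fan y ws -> within k (y :: ws) -> frugal c.
  by case/fan_letter => c2 cw kyw; apply: short_frugal => //; exact: within_sub cw.
move: hi v0 kv short; rewrite /crown; case: eqP => [->|/eqP l3] /=.
  case: (vs (i + 1)%R) => [|v ws] //= hi _ kv short.
  rewrite inE mem_cat mem_nseq => /or3P[/eqP->//|/andP[_ /eqP->]|/short]; last first.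
    by apply; apply: within_sub kv _ => z; rewrite !multE; lia.
  by apply: short_frugal => //; apply: within_sub kv _ => z; rewrite !multE; lia.
move=> hi _ kv short.
rewrite inE mem_cat mem_nseq => /or3P[/eqP->//|/andP[_ /eqP->]|/short]; last exact.
by apply: short_frugal => //; apply: within_sub kv _ => z; rewrite !multE; lia.
Qed.

Lemma thrifty_grows D : thrifty D -> exists U S D',
  [/\ is_strip S, forall j, perm_eq (D j ++ U j) k, bottoms S U, tops S D' & thrifty D'].
Proof.
move=> gD.
pose P i vs := vs != [::] /\ perm_eq (D i ++ 3 :: rcons vs 3) k.
have last_in i vs : P i vs -> within k (3 :: vs).
  by case=> _ pk z; rewrite -(perm_mult z pk) !multE; lia.
have [|||f fP] := @greedy_choice (seq nat)
    (fun i => [seq behead (behead (drop (size (D i)) s)) | s <- permutations k]) P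
    (fun i vs vs' => frugal [:: last 3 vs; 3; head 3 vs']).
- move=> i vs [_ pk]; apply/mapP; exists (D i ++ [:: 3, 3 & vs]).
    rewrite mem_permutations; apply: perm_trans pk.
    by apply/permP => p; rewrite !count_cat /= -cats1 count_cat /=; lia.
  by rewrite drop_size_cat.
- move=> i; have k30 : 3 \in k by rewrite -mult_gt0; lia.
  by have [vs vsP _] := next_face (gD i) k30; exists vs.
- move=> i vs Pvs; have lk : last 3 vs \in k.
    by apply: within_mem (last_in _ _ Pvs) _; rewrite mem_last.
  by have [vs' h1 h2] := next_face (gD (i + 1)%R) lk; exists vs'.
have [i|S [D' [sS bS tS gD']]] := @thrifty_over_crowns (fun=> 3) f.
  by have [Pf okf] := fP i; have [f0 _] := Pf; rewrite f0; split => //; exact: last_in Pf.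
exists (fun i => 3 :: rcons (f i) 3), S, D'; split => // j.
by have [[_ pk] _] := fP j.
Qed.

End ManyTriangles.

(** The first strip is a zigzag of triangles if there are five of them to spend at
    a vertex; otherwise two larger sizes alternate in it. *)
Theorem tiling_of_many_triangles (R : realType) (k : seq nat) : all (leq 3) k ->
  (7 <= size k)%N -> (4 <= mult 3 k)%N ->
  exists T : polygon_family R,
    [/\ is_tiling T, pseudo_homogeneous T & tiling_has_type T k].
Proof.
move=> k3 k7 k33; apply: (@tiling_of_growth R k (thrifty k)); first by lia.
  exact: thrifty_grows.
have [five|four] := ltnP 4 (mult 3 k).
  have k333 : within k [:: 3; 3; 3]%N.
    by move=> z; rewrite !multE; case: (eqVneq 3%N z) => [<-|_]; lia.
  have f333 : frugal k [:: 3; 3; 3]%N by split => //; rewrite !multE; lia.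
  have [i|S [D [sS bS tS gD]]] := @thrifty_over_crowns k k7 k33 k3 (fun=> 3%N) (fun=> [:: 3%N]).
    by split => //; apply: within_sub k333 _ => z; rewrite !multE; lia.
  by exists S, (fun=> [:: 3; 3; 3]%N), D; split.
have k3w : (3 <= wide k)%N by have := wide_mult3 k; lia.
have [|a a3 ka] := @spare_wide k [::]; first by rewrite wide_nil; lia.
have [|b b3 kb] := @spare_wide k [:: a]; first by rewrite !wideE; lia.
have kba : within k [:: b; a] by apply: within_cons => //; apply: within_cons.
have kab : within k [:: a; b] by apply: within_sub kba _ => z; rewrite !multE; lia.
have fab : frugal k [:: a; b] by exact: short_frugal.
have fba : frugal k [:: b; a] by exact: short_frugal.
have [i|S [D [sS bS tS gD]]] :=
    @thrifty_over_crowns k k7 k33 k3 (alternate a b) (fun=> [::]).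
  rewrite !alternateS /alternate; case: ifP => _; rewrite ?(negbTE a3) ?(negbTE b3);
    by split => //; apply: within_sub kba _ => z; rewrite !multE; lia.
exists S, (fun i => [:: alternate a b i; alternate a b (i + 1)]), D; split => //.
by move=> j; rewrite alternateS /alternate; case: ifP.
Qed.

(** * All types *)

Section Assignments.
Local Open Scope nat_scope.

Fixpoint assign (al : seq (nat * nat)) (s : nat) : nat :=
  if al is e :: al' then if s == e.1 then e.2 else assign al' s else least s.

Lemma assign_sizing al : all (fun e => (4 < e.1) && (least e.1 <= e.2)) al ->
  sizing (assign al).
Proof.
elim: al => [|e al IH] /= ; first by [].
case/andP => /andP[e4 le] /IH{}IH s; case: eqP => [->|_]; last exact: IH.
by split => //; lia.
Qed.

End Assignments.

Lemma tiling_of_simple_certificate (R : realType) (al : seq (nat * nat))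
    (k K : seq nat) rule p us p' us' :
  simple_certificate K rule p us p' us' ->
  all (fun e => (4 < e.1) && (least e.1 <= e.2))%N al ->
  perm_eq (map (assign al) K) k -> (2 < size K)%N ->
  exists T : polygon_family R,
    [/\ is_tiling T, pseudo_homogeneous T & tiling_has_type T k].
Proof.
move=> cert /assign_sizing sz Kk K2.
refine (@tiling_of_tables _ sz R k K _ _ _ _ Kk cert).
by rewrite -(perm_size Kk) size_map.
Qed.

Arguments tiling_of_simple_certificate R al {k K rule p us p' us'}.

Lemma angle_sum_perm d (k : d.-tuple nat) (s : seq nat) : perm_eq s k ->
  angle_sum k = \sum_(x <- s) (x%:R - 2) / x%:R.
Proof.
move=> sk; rewrite (perm_big _ sk) /angle_sum.
by rewrite -(big_tuple _ _ k xpredT (fun x => (x%:R - 2) / x%:R)).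
Qed.

(** Four triangles contribute 4/3 to the angle-sum, so the fifth entry must
    contribute 2/3. *)
Lemma fifth_entry_gt5 m : (0 < m)%N ->
  2 <= \sum_(x <- [:: 3; 3; 3; 3; m]%N) (x%:R - 2) / x%:R :> rat -> (5 < m)%N.
Proof.
move=> m0; rewrite !big_cons big_nil addr0; have m0' : 0 < m%:R :> rat by rewrite ltr0n.
have -> : (m%:R - 2) / m%:R = 1 - 2 / m%:R :> rat by field; exact: lt0r_neq0.
move=> h; have h3 : 2 / m%:R <= 1 / 3 :> rat by lra.
by move: h3; rewrite ler_pdivrMr // -(ltr_nat rat); lra.
Qed.

Theorem proposition2p4 (R : realType) (d : nat) (k : d.-tuple nat) :
  (5 <= d)%N ->
  (forall i : 'I_d, (3 <= tnth k i)%N) ->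
  2 <= angle_sum k ->
  exists T : polygon_family R,
    [/\ is_tiling T, pseudo_homogeneous T & tiling_has_type T k].
Proof.
move=> d5 kP ang.
have k3 : all (leq 3) k by apply/all_tnthP.
have kd : size k = d := size_tuple k.
have wm := wide_mult3 k.
have [tri|notri] := boolP ((7 <= size k) && (4 <= mult 3 k))%N.
  by case/andP: tri => *; exact: tiling_of_many_triangles.
have [many|few] := boolP ((4 < wide k) || (wide k == 4) && (mult 3 k == 3))%N.
  exact: tiling_of_many_wide.
pose w := sort leq [seq x <- k | x != 3%N].
have wk : perm_eq (nseq (mult 3 k) 3%N ++ w) k.
  rewrite perm_sym; apply: perm_trans (_ : perm_eq (_ ++ _) _).
    by rewrite perm_sym; exact: (permEl (perm_filterC (pred1 3%N) k)).
  apply: perm_cat; last by rewrite perm_sym perm_sort.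
  have /all_pred1P -> := filter_all (pred1 3%N) k.
  by rewrite size_filter.
have sw : size w = wide k by rewrite size_sort size_filter.
have w4 : all (leq 4) w.
  apply/allP => x; rewrite mem_sort mem_filter => /andP[x3 /(allP k3)]; lia.
have ws : sorted leq w by apply: sort_sorted; exact: leq_total.
move: (mult 3 k) wk wm notri few => m wk wm notri few.
rewrite (angle_sum_perm wk) in ang.
have small : (m <= 6)%N /\ (m + wide k = 5 \/ m + wide k = 6)%N by lia.
move: w sw w4 ws wk ang => w sw w4 ws wk ang.
case: w sw w4 ws wk ang => [|a [|b [|c [|e [|? ?]]]]] /= sw w4 ws wk ang.
- have [m5|m6] : (m = 5 \/ m = 6)%N by lia.
    (* This is [3; 3; 3; 3; m] with m = 3. *)
    by rewrite m5 in ang; have := fifth_entry_gt5 (isT : (0 < 3)%N) ang.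
  rewrite m6 in wk.
  by refine (tiling_of_simple_certificate R [::] certificate_333333 _ _ _).
- have [m4|m5] : (m = 4 \/ m = 5)%N by lia.
    rewrite m4 in wk ang; have a6 : (5 < a)%N by apply: fifth_entry_gt5 ang; lia.
    have sz : sizing (assign [:: (12, a)]%N) by apply: assign_sizing; rewrite /= a6.
    by refine (@tiling_of_tables _ sz R k _ _ _ _ _ _ certificate_3333a) => //; lia.
  rewrite m5 in wk.
  refine (tiling_of_simple_certificate R [:: (5, a)]%N
        certificate_33333a _ _ _) => //; rewrite /least /=; lia.
- have [m3|m4] : (m = 3 \/ m = 4)%N by lia.
    rewrite m3 in wk.
    have sz : sizing (assign [:: (5, a); (6, b)]%N) by exact: assign_sizing.
    by refine (@tiling_of_tables _ sz R k _ _ _ _ _ _ certificate_333ab) => //; lia.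
  rewrite m4 in wk.
  refine (tiling_of_simple_certificate R [:: (5, a); (6, b)]%N
        certificate_3333ab _ _ _) => //; rewrite /least /=; lia.
- have [m2|m3] : (m = 2 \/ m = 3)%N by lia.
    rewrite m2 in wk; have [a5|a4] := ltnP 4 a.
      refine (tiling_of_simple_certificate R [:: (9, a); (10, b); (11, c)]%N
        certificate_33abc _ _ _) => //; rewrite /least /=; lia.
    have {a4} aE : a = 4%N by lia.
    rewrite aE in wk; have [b5|b4] := ltnP 4 b.
      refine (tiling_of_simple_certificate R [:: (9, b); (10, c)]%N
        certificate_334ab _ _ _) => //; rewrite /least /=; lia.
    have {b4} bE : b = 4%N by lia.
    rewrite bE in wk; have [c5|c4] := ltnP 4 c.
      refine (tiling_of_simple_certificate R [:: (9, c)]%N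
        certificate_3344a _ _ _) => //; rewrite /least /=; lia.
    have {c4} cE : c = 4%N by lia.
    by rewrite cE in wk; refine (tiling_of_simple_certificate R [::] certificate_33444 _ _ _).
  rewrite m3 in wk.
  refine (tiling_of_simple_certificate R [:: (5, a); (6, b); (7, c)]%N
        certificate_333abc _ _ _) => //; rewrite /least /=; lia.
- have [m1|m2] : (m = 1 \/ m = 2)%N by lia.
    rewrite m1 in wk; have [b5|b4] := ltnP 4 b.
      refine (tiling_of_simple_certificate R [:: (5, a); (13, b); (14, c); (15, e)]%N
        certificate_3abcd _ _ _) => //; rewrite /least /=; lia.
    have [bE aE] : b = 4%N /\ a = 4%N by lia.
    rewrite aE bE in wk; have [c5|c4] := ltnP 4 c.
      refine (tiling_of_simple_certificate R [:: (9, c); (10, e)]%N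
        certificate_344ab _ _ _) => //; rewrite /least /=; lia.
    have {c4} cE : c = 4%N by lia.
    rewrite cE in wk.
    refine (tiling_of_simple_certificate R [:: (5, e)]%N
        certificate_3444a _ _ _) => //; rewrite /least /=; lia.
  rewrite m2 in wk.
  refine (tiling_of_simple_certificate R [:: (5, a); (6, b); (7, c); (8, e)]%N
        certificate_33abcd _ _ _) => //; rewrite /least /=; lia.
- by move: few; rewrite -sw; lia.
Qed.
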